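(* For every integer $d\ge 1$ there is a constant $c_d>0$ (depending only on $d$) such that for every $0<\kappa<1$ there is a constant $C_{d,\kappa}$ with $c_d\le C_{d,\kappa}<\infty$ (depending only on $d$ and $\kappa$) such that, for all integers $L,N$ with $1\le L\le\kappa N$, \[ c_d\left(\frac{L}{N+1}\right)^2\le \lambda_d(L,N)-1\le C_{d,\kappa}\left(\frac{L}{N+1}\right)^2 . \] In terms of positivity loss, this reads \[ \frac{c_d}{2}\left(\frac{L}{N+1}\right)^2\le \inf\left\{\mathfrak p(\mathcal A):\ \mathcal A\in\mathcal L(C(\mathbb S^d)),\ \mathcal A|_{\mathbb P_L}=\mathcal I,\ \operatorname{ran}\mathcal A\subseteq\mathbb P_N\right\}\le \frac{C_{d,\kappa}}{2}\left(\frac{L}{N+1}\right)^2 . \]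
   Context: $\mathbb S^d\subset\mathbb R^{d+1}$ is the unit sphere. $C(\mathbb S^d)$ is the real Banach space of continuous real-valued functions on $\mathbb S^d$ with the uniform norm, and $\mathcal L(C(\mathbb S^d))$ is the space of bounded linear operators on it. $\mathbb H_\ell$ is the space of real spherical harmonics of degree $\ell$ on $\mathbb S^d$, and $\mathbb P_n=\bigoplus_{\ell=0}^n\mathbb H_\ell$ is the space of real spherical polynomials of degree at most $n$. The condition $\mathcal A|_{\mathbb P_L}=\mathcal I$ means $\mathcal Ap=p$ for all $p\in\mathbb P_L$; $\operatorname{ran}\mathcal A$ is the range of $\mathcal A$. For integers $0\le L\le N$, \[ \lambda_d(L,N):=\inf\left\{\|\mathcal A\|_{C(\mathbb S^d)\to C(\mathbb S^d)}:\ \mathcal A\in\mathcal L(C(\mathbb S^d)),\ \mathcal A|_{\mathbb P_L}=\mathcal I,\ \operatorname{ran}\mathcal A\subseteq\mathbb P_N\right\}. \] For a bounded operator $\mathcal A:C(\mathbb S^d)\to C(\mathbb S^d)$ with $\mathcal A1=1$ (which holds whenever $\mathcal A|_{\mathbb P_L}=\mathcal I$), for each $x\in\mathbb S^d$ let $\mu_x^{\mathcal A}$ be the unique finite signed regular Borel measure with $\mathcal Af(x)=\int_{\mathbb S^d}f\,\mathrm d\mu_x^{\mathcal A}$ for all $f\in C(\mathbb S^d)$, with Jordan decomposition $\mu_x^{\mathcal A}=\mu_{x,+}^{\mathcal A}-\mu_{x,-}^{\mathcal A}$. The positivity loss of $\mathcal A$ is $\mathfrak p(\mathcal A):=\sup_{x\in\mathbb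 S^d}\mu_{x,-}^{\mathcal A}(\mathbb S^d)$. *)

(* Defs.v *)
From HB Require Import structures.
From mathcomp Require Import all_boot all_order all_algebra.
From mathcomp Require Import all_classical all_reals all_analysis.
(* The notations of mpoly clash with those of MathComp-Analysis, hence the
   filtered import. *)
From mathcomp.multinomials Require mpoly.
Import -(notations) mpoly.

Set Implicit Arguments.
Unset Strict Implicit.
Unset Printing Implicit Defensive.

Import Order.TTheory GRing.Theory Num.Theory.
Import numFieldNormedType.Exports.

Local Open Scope classical_set_scope.
Local Open Scope ring_scope.

(* The library norm on 'rV[R]_d.+1 is the sup norm, so the Euclidean unit
   sphere is cut out by the sum of squares.  The topology of 'rV[R]_d.+1 is the
   usual one, and [sphere] carries the induced topology. *)
Definition unit_sphere (R : realType) (d : nat) : set 'rV[R]_d.+1 :=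
  [set x | \sum_(i < d.+1) x ord0 i ^+ 2 = 1].
Arguments unit_sphere : clear implicits.

Definition sphere (R : realType) (d : nat) : Type := unit_sphere R d.

Lemma unit_sphere_e0 (R : realType) (d : nat) :
  delta_mx ord0 ord0 \in unit_sphere R d.
Proof.
rewrite inE /unit_sphere /= (bigD1 ord0) //= big1 => [|i i0].
  by rewrite mxE !eqxx expr1n addr0.
by rewrite mxE eqxx (negPf i0) expr0n.
Qed.

HB.instance Definition _ (R : realType) (d : nat) :=
  PseudoMetric.copy (sphere R d) (set_type (unit_sphere R d)).
HB.instance Definition _ (R : realType) (d : nat) :=
  isPointed.Build (sphere R d)
    (exist (fun x => x \in unit_sphere R d) _ (unit_sphere_e0 R d)).

Lemma compact_unit_sphere (R : realType) (d : nat) : compact (unit_sphere R d).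
Proof.
apply: bounded_closed_compact.
  exists 1; split => [|y y1 x x1]; first exact: num_real.
  apply: le_trans (ltW y1); rewrite [leLHS]/Num.Def.normr/= mx_normrE.
  apply: bigmax_le => //= -[i j] _ /=; rewrite (ord1 i).
  rewrite -(@ler_pXn2r _ 2) ?nnegrE// expr1n -normrX ger0_norm ?sqr_ge0//.
  by rewrite -x1 (bigD1 j)//= lerDl sumr_ge0// => k _; exact: sqr_ge0.
have -> : unit_sphere R d =
    (fun x : 'rV[R]_d.+1 => \sum_(i < d.+1) x ord0 i ^+ 2) @^-1` [set 1] by [].
apply: closed_comp => [x _|]; last exact: closed_eq.
apply: (@cvg_big _ _ _ _ _ (@add_continuous R) _ (nbhs x)) => i _.
apply: (@cvg_comp _ _ _ _ (fun y : R => y ^+ 2)).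
  exact: coord_continuous.
exact: exprn_continuous.
Qed.

(* C(S^d), with the uniform norm. *)
Definition csphere (R : realType) (d : nat) : Type :=
  continuousType (sphere R d) R.

HB.instance Definition _ (R : realType) (d : nat) := Choice.on (csphere R d).

Section csphere.
Variables (R : realType) (d : nat).
Local Notation C := (csphere R d).
Implicit Types f g h : C.

Lemma csphereP f g : (forall x, f x = g x) -> f = g.
Proof. by move=> fg; apply/continuousEP. Qed.

Fact cadd_cts f g : continuous (fun x => f x + g x).
Proof. by move=> x; exact: (cvgD (@cts_fun _ _ f x) (@cts_fun _ _ g x)). Qed.
Fact copp_cts f : continuous (fun x => - f x).
Proof. by move=> x; exact: (cvgN (@cts_fun _ _ f x)). Qed.
Fact cscale_cts (a : R) f : continuous (fun x => a * f x).
Proof. by move=> x; exact: (cvgM (cvg_cst a) (@cts_fun _ _ f x)). Qed.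
Fact czero_cts : continuous (fun _ : sphere R d => 0 : R).
Proof. exact: cst_continuous. Qed.

Definition csphere_add f g : C := mkcts (@cadd_cts f g).
Definition csphere_opp f : C := mkcts (@copp_cts f).
Definition csphere_scale (a : R) f : C := mkcts (@cscale_cts a f).
Definition csphere_zero : C := mkcts czero_cts.

Fact csphere_addA : associative csphere_add.
Proof. by move=> f g h; apply: csphereP => x; exact: addrA. Qed.
Fact csphere_addC : commutative csphere_add.
Proof. by move=> f g; apply: csphereP => x; exact: addrC. Qed.
Fact csphere_add0 : left_id csphere_zero csphere_add.
Proof. by move=> f; apply: csphereP => x; exact: add0r. Qed.
Fact csphere_addN : left_inverse csphere_zero csphere_opp csphere_add.
Proof. by move=> f; apply: csphereP => x; exact: addNr. Qed.

HB.instance Definition _ := GRing.isZmodule.Build C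
  csphere_addA csphere_addC csphere_add0 csphere_addN.

Fact csphere_scaleA a b f :
  csphere_scale a (csphere_scale b f) = csphere_scale (a * b) f.
Proof. by apply: csphereP => x; exact: mulrA. Qed.
Fact csphere_scale1 : left_id 1 csphere_scale.
Proof. by move=> f; apply: csphereP => x; exact: mul1r. Qed.
Fact csphere_scaleDr : right_distributive csphere_scale +%R.
Proof. by move=> a f g; apply: csphereP => x; exact: mulrDr. Qed.
Fact csphere_scaleDl f : {morph csphere_scale^~ f : a b / a + b}.
Proof. by move=> a b; apply: csphereP => x; exact: mulrDl. Qed.

HB.instance Definition _ := GRing.Zmodule_isLmodule.Build R C
  csphere_scaleA csphere_scale1 csphere_scaleDr csphere_scaleDl.

Lemma csphere_addE f g x : (f + g : C) x = f x + g x.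
Proof. by []. Qed.
Lemma csphere_scaleE a f x : (a *: f : C) x = a * f x.
Proof. by []. Qed.
Lemma csphere_zeroE x : (0 : C) x = 0.
Proof. by []. Qed.

Definition unif_norm f : R := sup (range (fun x => `|f x|)).

Lemma unif_norm_has_sup f : has_sup (range (fun x => `|f x|)).
Proof.
split; first by exists `|f point|, point.
pose g := valL_ (0 : R) (f : unit_sphere R d -> R).
have gf : sigL (unit_sphere R d) g = f by exact: (valLK (0 : R)).
have : {within unit_sphere R d, continuous g}.
  by apply/subspace_sigL_continuousP; rewrite gf; exact: cts_fun.
move=> /continuous_compact/(_ (@compact_unit_sphere R d))/compact_bounded.
move=> [M [_ gM]].
exists (M + 1) => _ [x _ <-]; rewrite -gf; apply: (gM (M + 1)).
  by rewrite ltrDl.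
by exists (val x) => //; apply: set_mem; exact: (valP x).
Qed.

Lemma ler_unif_norm f x : `|f x| <= unif_norm f.
Proof.
by apply: ub_le_sup; [exact: (unif_norm_has_sup f).2|exists x].
Qed.

Lemma unif_norm_le f M : (forall x, `|f x| <= M) -> unif_norm f <= M.
Proof.
move=> fM; apply: ge_sup; first exact: (unif_norm_has_sup f).1.
by move=> _ [x _ <-].
Qed.

Fact unif_normD f g : unif_norm (f + g) <= unif_norm f + unif_norm g.
Proof.
apply: unif_norm_le => x; rewrite csphere_addE.
by rewrite (le_trans (ler_normD _ _))// lerD// ler_unif_norm.
Qed.

Fact unif_normZ_le a f : unif_norm (a *: f) <= `|a| * unif_norm f.
Proof.
apply: unif_norm_le => x.
by rewrite csphere_scaleE normrM ler_wpM2l// ler_unif_norm.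
Qed.

Fact unif_norm_eq0 f : unif_norm f = 0 -> f = 0.
Proof.
move=> f0; apply: csphereP => x; apply/eqP.
by rewrite -normr_eq0 eq_le normr_ge0 andbT -f0 ler_unif_norm.
Qed.

Fact unif_normZ a f : unif_norm (a *: f) = `|a| * unif_norm f.
Proof.
apply/eqP; rewrite eq_le unif_normZ_le/=.
have [->|a0] := eqVneq a 0.
  by rewrite normr0 mul0r (le_trans (normr_ge0 _) (ler_unif_norm _ point)).
rewrite -ler_pdivlMl ?normr_gt0// -normfV.
by rewrite (le_trans _ (unif_normZ_le _ _))// scalerA mulVf// scale1r.
Qed.

HB.instance Definition _ := Lmodule_isNormed.Build R C
  unif_normD unif_normZ unif_norm_eq0.

Lemma csphere_normE f : `|f| = sup (range (fun x => `|f x|)).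
Proof. by []. Qed.

End csphere.

Section spherical_polynomials.
Variables (R : realType) (d : nat).

Definition laplacian (p : mpoly d.+1 R) : mpoly d.+1 R :=
  \sum_(i < d.+1) mderiv i (mderiv i p).

(* Restrictions to the sphere of the harmonic homogeneous polynomials of degree
   [l] (the zero polynomial is homogeneous of every degree). *)
Definition spherical_harmonic (l : nat) : set (csphere R d) :=
  [set f | exists p : mpoly d.+1 R,
    [/\ p \is ishomog1 l mdeg, laplacian p = 0 &
        forall x : sphere R d, f x = meval (fun i => val x ord0 i) p]].

Definition spherical_poly (n : nat) : set (csphere R d) :=
  [set f | exists2 h : 'I_n.+1 -> csphere R d,
    (forall l : 'I_n.+1, spherical_harmonic l (h l)) &
    f = \sum_(l < n.+1) h l].

End spherical_polynomials.

Section operators.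
Variables (R : realType) (d : nat).
Local Notation C := (csphere R d).

(* For linear maps between normed modules, [bounded_near A (nbhs 0)] is
   boundedness in the operator sense: see [linear_boundedP]. *)
Definition admissible (L N : nat) : set {linear C -> C} :=
  [set A | [/\ bounded_near A (nbhs (0 : C)),
               forall p, spherical_poly L p -> A p = p &
               range A `<=` spherical_poly N]].

Definition opnorm (A : {linear C -> C}) : R :=
  sup [set `|A f| | f in [set f : C | `|f| <= 1]].

(* Extended-real infima and suprema, so that no junk value arises on an empty
   or unbounded set. *)
Definition lambda (L N : nat) : \bar R :=
  ereal_inf [set (opnorm A)%:E | A in admissible L N].

End operators.

Section jordan.
Variables (disp : measure_display) (T : measurableType disp) (R : realType).
Variable nu : {charge set T -> \bar R}.

Definition hahn_pos : set T := projT1 (cid (Hahn_decomposition nu)).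
Definition hahn_neg : set T :=
  projT1 (cid (projT2 (cid (Hahn_decomposition nu)))).
Lemma hahn_posneg : hahn_decomposition nu hahn_pos hahn_neg.
Proof. exact: projT2 (cid (projT2 (cid (Hahn_decomposition nu)))). Qed.

(* These do not depend on the chosen Hahn decomposition: see
   [Hahn_decomposition_uniq]. *)
Definition pos_part := jordan_pos hahn_posneg.
Definition neg_part := jordan_neg hahn_posneg.
Definition total_variation := charge_variation hahn_posneg.

End jordan.

Section positivity_loss.
Variables (R : realType) (d : nat).
Local Notation C := (csphere R d).

Definition borel_sphere := g_sigma_algebraType (@open (sphere R d)).

(* A [charge] is a finite signed measure. *)
Local Notation signed_measure := (charge borel_sphere R).

Definition regular (mu : signed_measure) : Prop :=
  forall A : set borel_sphere, measurable A -> forall e : R, 0 < e ->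
  exists K U : set (sphere R d),
    [/\ compact K, open U, K `<=` A, A `<=` U &
        (total_variation mu (U `\` K) < e%:E)%E].

Definition signed_integral (mu : signed_measure) (f : C) : R :=
  (\int[pos_part mu]_x (f x : R) - \int[neg_part mu]_x (f x : R))%R.

(* By the Riesz representation theorem, for every bounded [A] and every [x]
   exactly one [mu] satisfies this. *)
Definition represents (A : {linear C -> C}) (x : sphere R d)
    (mu : signed_measure) : Prop :=
  regular mu /\ forall f : C, A f x = signed_integral mu f.

Definition positivity_loss (A : {linear C -> C}) : \bar R :=
  ereal_sup [set m : \bar R | exists (x : sphere R d) (mu : signed_measure),
    represents A x mu /\ m = neg_part mu [set: borel_sphere]].

End positivity_loss.

(* Main.v *)
(** Lower bound.  For odd [k] and [a = k^-2], the function
    [(1 + a) Re w - a Re w^k] is bounded by 1 on the unit disc.  Put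
    [w = ((x_0 + i x_1) e^(-it))^L] with [N < k L <= N + 2 L].  An admissible
    operator keeps the part of degree [L], and averaging over rotations kills what
    it makes of the part of degree [k L > N]; its norm is thus at least [1 + a],
    and [a >= (L / (N + 1))^2 / 9].

    Upper bound.  Let [V] be a de la Vallee Poussin operator, reproducing degree
    [L] with range of degree [O(L)] and with bounded norm, and let [J] be a
    positive Jackson operator of degree [N], with error [O((M / N)^2)] on
    polynomials of degree [M] by Bernstein's inequality on great circles.  Then
    [J + V - J V] is admissible, of norm at most
    [1 + |(1 - J) V| = 1 + O((L / N)^2)].  Both are built from reproducing kernels
    for an invariant mean on polynomials, the minimiser of an invariant strictly
    convex energy, which replaces the surface measure.

    Positivity loss.  As operators fixing the constants satisfy
    [A (1 - 2 f) = 1 - 2 A f], the negative mass at [x], which is the supremum of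
    [- A f x] over [0 <= f <= 1], is half the excess of the norm of the functional
    [f |-> A f x] over 1.  This rests on the Riesz representation theorem, with
    regularity of the representing measure. *)

Require Import Defs.
From HB Require Import structures.
From mathcomp Require Import all_boot all_order all_algebra.
From mathcomp Require Import all_classical all_reals all_analysis.
From mathcomp Require Import measurable_realfun.
From mathcomp.multinomials Require mpoly.
Import -(notations) mpoly.
From mathcomp Require Import ring lra zify.

Set Implicit Arguments.
Unset Strict Implicit.
Unset Printing Implicit Defensive.

Import Order.TTheory GRing.Theory Num.Theory.
Import numFieldNormedType.Exports.

Local Open Scope classical_set_scope.
Local Open Scope ring_scope.

From mathcomp Require Import complex.

(** * Polynomials on the sphere *)

(** An operator reproducing degree [L] may be bounded without having norm close to 1, while
    positivity, which gives norm 1, is lost under reproduction. In [J + V - J V] the correction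
    [(1 - J) V] sees only polynomials of degree [O(L)], where the Jackson error is already of second
    order; the norm of [V] affects the constant alone. The parameter [kappa] enters only there: that
    norm is at most a ratio of dimensions, bounded as long as a fixed fraction of [N] is left above
    [L]. The Jackson error is of second order by symmetry: the kernel at [x] is invariant under the
    half-turn about [x], which cancels first-order terms. Invariance of the mean is used only on
    polynomials of degree at most [4 N], so a finitely additive mean is enough, and its energy is a
    finite sum of squares of moments. Its definiteness on polynomials, needed to invert a Gram
    matrix, follows from compactness and the transitivity of reflections. *)

Section spoly.
Context {R : realType} {d : nat}.
Local Notation S := (sphere R d).
Implicit Types (f g : S -> R) (x y : S).

Definition coor x (i : 'I_d.+1) : R := val x ord0 i.

Definition dot x y : R := \sum_i coor x i * coor y i.

(** Degree is tracked on functions rather than on [mpoly], so that products, reflections and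
    restrictions to circles go by induction; [spherical_poly_spoly] and [spoly_spherical_poly]
    relate it to [spherical_poly]. *)
Inductive spoly : nat -> (S -> R) -> Prop :=
| spoly_cst n c : spoly n (fun=> c)
| spoly_add n f g : spoly n f -> spoly n g -> spoly n (fun x => f x + g x)
| spoly_mulX n i f : spoly n f -> spoly n.+1 (fun x => f x * coor x i).

Lemma spoly_ext n f g : f =1 g -> spoly n f -> spoly n g.
Proof. by move=> /funext ->. Qed.

Lemma spoly_le m n f : (m <= n)%N -> spoly m f -> spoly n f.
Proof.
move=> + sf; elim: sf n => [k c n _|k g h _ IHg _ IHh n kn|k i g _ IHg [//|n] kn].
- exact: spoly_cst.
- by apply: spoly_add; [exact: IHg|exact: IHh].
- by apply: spoly_mulX; exact: IHg.
Qed.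

Lemma spoly_scale n c f : spoly n f -> spoly n (fun x => c * f x).
Proof.
elim=> [k b|k g h _ IHg _ IHh|k i g _ IHg].
- exact: spoly_cst.
- by apply: spoly_ext (spoly_add IHg IHh) => x; rewrite mulrDr.
- by apply: spoly_ext (spoly_mulX i IHg) => x; rewrite mulrA.
Qed.

Lemma spoly_opp n f : spoly n f -> spoly n (fun x => - f x).
Proof. by move=> /(spoly_scale (-1)); apply: spoly_ext => x; rewrite mulN1r. Qed.

Lemma spoly_sub n f g : spoly n f -> spoly n g -> spoly n (fun x => f x - g x).
Proof. by move=> sf /spoly_opp; exact: spoly_add. Qed.

Lemma spoly_mul m n f g :
  spoly m f -> spoly n g -> spoly (m + n) (fun x => f x * g x).
Proof.
move=> sf sg; elim: sf => [k c|k a b _ IHa _ IHb|k i a _ IHa].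
- by apply: (spoly_le (leq_addl _ _)); exact: spoly_scale.
- by apply: spoly_ext (spoly_add IHa IHb) => x; rewrite mulrDl.
- by apply: spoly_ext (spoly_mulX i IHa) => x; rewrite mulrAC.
Qed.

Lemma spoly_sum n (I : Type) (r : seq I) (F : I -> S -> R) :
  (forall i, spoly n (F i)) -> spoly n (fun x => \sum_(i <- r) F i x).
Proof.
move=> sF; elim: r => [|i r IHr].
  by apply: spoly_ext (spoly_cst _ 0) => x; rewrite big_nil.
by apply: spoly_ext (spoly_add (sF i) IHr) => x; rewrite big_cons.
Qed.

Lemma spoly_coor i : spoly 1 (coor ^~ i).
Proof.
by apply: spoly_ext (spoly_mulX i (spoly_cst 0 1)) => x; rewrite mul1r.
Qed.

Lemma spoly_exp n m f : spoly n f -> spoly (m * n) (fun x => f x ^+ m).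
Proof.
move=> sf; elim: m => [|m IHm]; first exact: spoly_cst.
by apply: spoly_ext (spoly_mul sf IHm) => x; rewrite exprS.
Qed.

Lemma spoly_dot x : spoly 1 (dot x).
Proof. by apply: spoly_sum => i; apply/spoly_scale/spoly_coor. Qed.

Lemma val_continuous : continuous (fun x : S => val x).
Proof.
apply/(@subspace_sigL_continuousP _ (unit_sphere R d) _ id).
by apply: continuous_subspaceT => x; exact: cvg_id.
Qed.

Lemma coor_continuous i : continuous (coor ^~ i).
Proof.
move=> x; have := @continuous_comp S 'rV[R]_d.+1 R (fun x => val x)
  (fun v => v ord0 i) x (@val_continuous x).
by apply; exact: coord_continuous.
Qed.

Lemma spoly_continuous n f : spoly n f -> continuous f.
Proof.
elim=> [k c|k g h _ cg _ ch|k i g _ cg] x.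
- exact: cst_continuous.
- exact: (cvgD (cg x) (ch x)).
- exact: (cvgM (cg x) (@coor_continuous i x)).
Qed.

Lemma dotC x y : dot x y = dot y x.
Proof. by apply: eq_bigr => i _; rewrite mulrC. Qed.

Lemma dotxx x : dot x x = 1.
Proof.
rewrite -(set_mem (valP x)); apply: eq_bigr => i _.
by rewrite expr2.
Qed.

Lemma coor_inj x y : coor x =1 coor y -> x = y.
Proof.
by move=> xy; apply/val_inj/matrixP => i j; rewrite (ord1 i); exact: xy.
Qed.

Lemma sqr_coor_le1 x i : coor x i ^+ 2 <= 1.
Proof.
by rewrite -(dotxx x) /dot (bigD1 i)//= -expr2 lerDl sumr_ge0// => j _; rewrite -expr2 sqr_ge0.
Qed.

Lemma coor_le1 x i : `|coor x i| <= 1.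
Proof.
by rewrite -(@ler_pXn2r _ 2) ?nnegrE// expr1n -normrX ger0_norm ?sqr_ge0// sqr_coor_le1.
Qed.

Lemma dot_le1 x y : dot x y <= 1.
Proof.
have : \sum_i (coor x i - coor y i) ^+ 2 = dot x x + dot y y - 2 * dot x y.
  rewrite /dot mulr_sumr -big_split/= -sumrB; apply: eq_bigr => i _; ring.
have : 0 <= \sum_i (coor x i - coor y i) ^+ 2.
  by rewrite sumr_ge0// => i _; rewrite sqr_ge0.
by rewrite !dotxx; lra.
Qed.

Lemma dot_geN1 x y : -1 <= dot x y.
Proof.
have : \sum_i (coor x i + coor y i) ^+ 2 = dot x x + dot y y + 2 * dot x y.
  rewrite /dot mulr_sumr -!big_split/=; apply: eq_bigr => i _; ring.
have : 0 <= \sum_i (coor x i + coor y i) ^+ 2.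
  by rewrite sumr_ge0// => i _; rewrite sqr_ge0.
by rewrite !dotxx; lra.
Qed.

Lemma sphere_of_subproof (u : 'I_d.+1 -> R) : \sum_i u i ^+ 2 = 1 ->
  \row_i u i \in unit_sphere R d.
Proof.
by move=> u1; rewrite inE /unit_sphere/= -u1; apply: eq_bigr => i _; rewrite mxE.
Qed.

Definition sphere_of (u : 'I_d.+1 -> R) (u1 : \sum_i u i ^+ 2 = 1) : S :=
  exist (fun v : 'rV[R]_d.+1 => v \in unit_sphere R d) _ (sphere_of_subproof u1).

Lemma coor_sphere_of u (u1 : \sum_i u i ^+ 2 = 1) i : coor (sphere_of u1) i = u i.
Proof. by rewrite /coor/= mxE. Qed.

End spoly.

(** * Spherical harmonics and decomposition of polynomials on the sphere *)

Section harmonic.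
Context {R : realType} {d : nat}.
Local Notation S := (sphere R d).
Local Notation P := (mpoly d.+1 R).
Local Notation homog l p := (p \is ishomog1 l mdeg).
Implicit Types (p q : P).

Local Notation Xv i := (mpolyX R (mnm1 (i : 'I_d.+1))).
Local Notation r2 := (\sum_(i < d.+1) Xv i * Xv i : P).

Lemma mderivXU i j : mderiv i (Xv j) = (i == j)%:R%:A :> P.
Proof.
rewrite mderivX mnm1E eq_sym; have [->|_] := eqVneq i j; last by rewrite !scale0r.
by rewrite -(mpolyX0 _ R); congr (_ *: mpolyX _ _); apply/mnmP => k; rewrite mnmBE subnn mnm0E.
Qed.

Lemma laplacianZ (c : R) p : laplacian (c *: p) = c *: laplacian p.
Proof.
by rewrite /laplacian scaler_sumr; apply: eq_bigr => i _; rewrite !mderivZ.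
Qed.

Lemma laplacianD p q : laplacian (p + q) = laplacian p + laplacian q.
Proof.
by rewrite /laplacian -big_split/=; apply: eq_bigr => i _; rewrite !mderivD.
Qed.

Lemma laplacian_mderiv i p : laplacian (mderiv i p) = mderiv i (laplacian p).
Proof.
rewrite /laplacian raddf_sum/=; apply: eq_bigr => j _.
by rewrite (mderiv_comm i j p) (mderiv_comm i j).
Qed.

Lemma laplacianXM i p : laplacian (Xv i * p) = Xv i * laplacian p + 2%:R *: mderiv i p.
Proof.
have E j : mderiv j (mderiv j (Xv i * p)) = Xv i * mderiv j (mderiv j p) +
    (if j == i then 2%:R *: mderiv i p else 0).
  rewrite mderivM mderivXU; case: eqVneq => [->|ji]; last first.
    by rewrite scale0r mul0r add0r mderivM mderivXU (negPf ji) scale0r mul0r add0r addr0.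
  rewrite scale1r mul1r mderivD mderivM mderivXU eqxx scale1r mul1r.
  by rewrite scaler_nat mulr2n addrCA addrA addrC addrA.
rewrite /laplacian (eq_bigr _ (fun j _ => E j)) big_split/= -mulr_sumr.
by rewrite -big_mkcond/= big_pred1_eq.
Qed.

Lemma euler_homog l p : homog l p -> \sum_(i < d.+1) Xv i * mderiv i p = l%:R *: p.
Proof.
move=> /dhomogP hp.
rewrite [p in RHS]mpolyE scaler_sumr.
under eq_bigr do rewrite {1}[p]mpolyE raddf_sum/= mulr_sumr.
rewrite exchange_big/= !big_seq; apply: eq_bigr => m mp.
have <- : mdeg m = l := hp m mp.
rewrite mdegE natr_sum scaler_suml; apply: eq_bigr => i _.
rewrite mderivZ mderivX -!scalerAr scalerA [RHS]scalerA -mpolyXD mulrC.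
have [->|mi] := eqVneq (m i) 0%N; first by rewrite mulr0n mul0r !scale0r.
congr (_ *: mpolyX _ _); apply/mnmP => k; rewrite mnmDE mnmBE mnm1E.
by case: eqVneq => [<-|_]; rewrite ?add0n ?subn0//= subnKC// lt0n.
Qed.

(** The cross terms are [4 x_i d_i p], which Euler's identity sums to [4 l p]; the resulting factor
    is the one that [spherical_harmonic_mulX] divides by. *)
Lemma laplacian_r2M l p : homog l p -> laplacian p = 0 ->
  laplacian (r2 * p) = (2 * (d.+1)%:R + 4 * l%:R) *: p.
Proof.
move=> hp p0; rewrite mulr_suml.
have -> : laplacian (\sum_(i < d.+1) Xv i * Xv i * p) =
    \sum_(i < d.+1) laplacian (Xv i * (Xv i * p)).
  elim/big_ind2 : _ => [|p1 q1 p2 q2 <- <-|i _]; last by rewrite mulrA.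
    by rewrite -(scale0r 0) laplacianZ !scale0r.
  by rewrite laplacianD.
have E i : laplacian (Xv i * (Xv i * p)) = 4%:R *: (Xv i * mderiv i p) + 2%:R *: p.
  rewrite laplacianXM laplacianXM p0 mulr0 add0r mderivM mderivXU eqxx scale1r mul1r.
  rewrite -scalerAr !scaler_nat; ring.
rewrite (eq_bigr _ (fun i _ => E i)) big_split/= -scaler_sumr (euler_homog hp).
rewrite sumr_const card_ord -[_ *+ d.+1]scaler_nat !scalerA -scalerDl; congr (_ *: _); ring.
Qed.

Lemma homog_mulX l i p : homog l p -> homog l.+1 (Xv i * p).
Proof.
move=> hp; rewrite -[l.+1]add1n; apply: dhomogM => //.
by rewrite dhomogX; apply/eqP; exact: mdeg1.
Qed.

Lemma homog_mderiv l i p : homog l.+1 p -> homog l (mderiv i p).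
Proof.
move=> /dhomogP hp; apply/dhomogP => m.
rewrite mcoeff_msupp mcoeff_deriv => mp.
have /hp/eqP/= : mnm_add m (mnm1 i) \in msupp p.
  by rewrite mcoeff_msupp; apply: contraNneq mp => ->; rewrite mul0rn.
by rewrite mdegD mdeg1 addn1 eqSS => /eqP.
Qed.

Lemma spoly_monomial (e : 'I_d.+1 -> nat) r :
  spoly (\sum_(i <- r) e i) (fun x : S => \prod_(i <- r) coor x i ^+ e i).
Proof.
elim: r => [|i r IHr].
  by apply: spoly_ext (spoly_cst _ 1) => x; rewrite big_nil.
rewrite big_cons -[X in (X + _)%N]muln1.
apply: spoly_ext (spoly_mul (spoly_exp (e i) (spoly_coor i)) IHr) => x.
by rewrite big_cons.
Qed.

Lemma spoly_meval l p : homog l p ->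
  spoly l (fun x : S => meval (fun i => val x ord0 i) p).
Proof.
move=> /dhomogP hp.
(* The guard gives monomials outside the support the value 0, since [spoly_sum] asks for the degree
   bound at every index. *)
apply: (@spoly_ext _ _ _ (fun x => \sum_(m <- msupp p)
    if m \in msupp p then mcoeff m p * \prod_i coor x i ^+ m i else 0)).
  by move=> x; rewrite mevalE; apply: eq_big_seq => m ->.
apply: spoly_sum => m; case: (boolP (m \in msupp p)) => [mp|_]; last exact: spoly_cst.
have <- : mdeg m = l by exact: hp.
by apply: spoly_scale; rewrite mdegE; exact: spoly_monomial.
Qed.

Local Notation C := (csphere R d).

Lemma csphere_of_spoly n (f : S -> R) : spoly n f -> exists g : C, forall x, g x = f x.
Proof. by move=> /spoly_continuous cf; exists (mkcts cf). Qed.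

Lemma csphere_sumE (I : Type) (r : seq I) (Q : pred I) (F : I -> C) x :
  (\sum_(i <- r | Q i) F i) x = \sum_(i <- r | Q i) F i x.
Proof. by elim/big_rec2 : _ => [//|i a b _ <-]. Qed.

Lemma spherical_poly_spoly n (f : C) : spherical_poly n f -> spoly n f.
Proof.
move=> [h hh ->].
apply: (@spoly_ext _ _ _ (fun x => \sum_(l < n.+1) h l x)).
  by move=> x; rewrite csphere_sumE.
apply: spoly_sum => l; have [p [hp _ hlp]] := hh l.
apply: (@spoly_le _ _ l); first by rewrite -ltnS.
by apply: spoly_ext (spoly_meval hp) => x; rewrite hlp.
Qed.

Lemma spherical_harmonicD l (f g : C) : spherical_harmonic l f ->
  spherical_harmonic l g -> spherical_harmonic l (f + g).
Proof.
move=> [p [hp p0 fp]] [q [hq q0 gq]]; exists (p + q); split.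
- exact: rpredD.
- by rewrite laplacianD p0 q0 addr0.
- by move=> x; rewrite csphere_addE fp gq mevalD.
Qed.

Lemma spherical_harmonic0 l : spherical_harmonic l (0 : C).
Proof.
exists 0; split; first exact: rpred0.
- by rewrite -(scale0r 0) laplacianZ !scale0r.
- by move=> x; rewrite csphere_zeroE meval0.
Qed.

Lemma spherical_polyD n (f g : C) :
  spherical_poly n f -> spherical_poly n g -> spherical_poly n (f + g).
Proof.
move=> [h hh ->] [k kk ->]; exists (fun l => h l + k l); last by rewrite big_split.
by move=> l; exact: spherical_harmonicD.
Qed.

Lemma spherical_harmonic_poly l n (f : C) : (l <= n)%N ->
  spherical_harmonic l f -> spherical_poly n f.
Proof.
rewrite -ltnS => ln hf; exists (fun k : 'I_n.+1 => if k == Ordinal ln then f else 0).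
  by move=> k; case: eqP => [->//|_]; exact: spherical_harmonic0.
by rewrite -big_mkcond/= big_pred1_eq.
Qed.

(* On the sphere, [x_i h = (x_i h - c r^2 d_i h) + c d_i h], and the choice of
   [c] makes the bracket harmonic. *)
Lemma spherical_harmonic_mulX l i (f g : C) : (1 <= d)%N ->
  spherical_harmonic l f -> (forall x, g x = f x * coor x i) ->
  spherical_poly l.+1 g.
Proof.
move=> d1 [p [hp p0 fp]] gE.
(* In degree 0 the derivative vanishes and [x_i p] is already harmonic; otherwise the derivative is
   harmonic of degree one less. *)
case: l hp => [|l] hp.
  have pi : mderiv i p = 0.
    have [c ->] : exists c, p = mpolyC _ c.
      exists (mcoeff (@mnm0 _) p); apply: msize1_polyC.
      rewrite msizeE; apply/bigmax_leqP_seq => m mp _.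
      by move/dhomogP : hp => /(_ m mp)/= ->.
    by rewrite mderivC.
  apply: (@spherical_harmonic_poly 1) => //; exists (Xv i * p); split.
  - exact: homog_mulX.
  - by rewrite laplacianXM p0 pi mulr0 scaler0 addr0.
  - by move=> x; rewrite gE fp mevalM mevalXU mulrC.
have hi := homog_mderiv i hp.
(* The quotient of the coefficients of [d_i p] in the Laplacians of [x_i p] and of [r^2 d_i p]. *)
pose c : R := 2 * (2 * (d.+1)%:R + 4 * l%:R)^-1.
have K0 : 2 * (d.+1)%:R + 4 * l%:R != 0 :> R.
  by rewrite gt_eqF// ltr_pwDl// ?mulr_gt0 ?ltr0n// mulr_ge0.
have lap0 : laplacian (mderiv i p) = 0 by rewrite laplacian_mderiv p0 mderiv0.
have [g2 g2E] := csphere_of_spoly (spoly_scale c (spoly_meval hi)).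
have -> : g = (g - g2) + g2 by rewrite subrK.
apply: spherical_polyD; last first.
  apply: (@spherical_harmonic_poly l); first by rewrite (leq_trans (leqnSn _)).
  exists (c *: mderiv i p); split; first exact: rpredZ.
    by rewrite laplacianZ lap0 scaler0.
  by move=> x; rewrite g2E mevalZ.
apply: (@spherical_harmonic_poly l.+2) => //.
exists (Xv i * p - c *: (r2 * mderiv i p)); split.
- apply: rpredB; first exact: homog_mulX.
  apply: rpredZ; rewrite mulr_suml; apply: rpred_sum => j _.
  by rewrite -mulrA; do 2 apply: homog_mulX.
- rewrite -scaleNr laplacianD laplacianZ (laplacian_r2M hi lap0) laplacianXM p0 mulr0 add0r.
  by rewrite scalerA mulNr -mulrA mulVf// mulr1 -scalerDl subrr scale0r.
- move=> x; rewrite csphere_addE.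
  have -> : (- g2) x = - g2 x by [].
  rewrite gE fp g2E mevalB mevalZ !mevalM mevalXU mulrC; congr (_ - c * _).
  rewrite -[LHS]mul1r; congr (_ * _).
  transitivity (dot x x); first by rewrite dotxx.
  rewrite (big_morph _ (mevalD _) (meval0 _)).
  by apply: eq_bigr => j _; rewrite mevalM mevalXU.
Qed.

(** By induction on [spoly]; the case with content is multiplication by a coordinate, which
    [spherical_harmonic_mulX] treats one harmonic component at a time. *)
Lemma spoly_spherical_poly n (f : C) : (1 <= d)%N -> spoly n f -> spherical_poly n f.
Proof.
(* The induction runs over bare functions, so [f], which carries its continuity, is tied to [g] by
   an equation. *)
move=> d1; move: {-1}(f : S -> R) (erefl (f : S -> R)) => g fg sg.
elim: sg f fg => {}n.
- move=> c f fg; apply: (@spherical_harmonic_poly 0) => //.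
  exists (mpolyC _ c); split.
  + by apply/dhomogP => m; rewrite msuppC; case: eqP => // _; rewrite inE => /eqP ->; exact: mdeg0.
  + by rewrite /laplacian big1// => i _; rewrite !mderivC.
  + by move=> x; rewrite mevalC fg.
- move=> g1 g2 s1 IH1 s2 IH2 f fg.
  have [f1 f1E] := csphere_of_spoly s1; have [f2 f2E] := csphere_of_spoly s2.
  have -> : f = f1 + f2.
    by apply: csphereP => x; rewrite csphere_addE f1E f2E fg.
  by apply: spherical_polyD; [apply: IH1|apply: IH2]; apply/funext.
- move=> i g1 s1 IH1 f fg; have [f1 f1E] := csphere_of_spoly s1.
  have [|h hh f1h] := IH1 f1; first exact/funext.
  have H (l : 'I_n.+1) : exists k : C, forall x, k x = h l x * coor x i.
    have [p [hp _ hlp]] := hh l.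
    apply: (csphere_of_spoly (n := l.+1)); apply: spoly_mulX.
    by apply: spoly_ext (spoly_meval hp) => x; rewrite hlp.
  have [k kE] := choice H.
  have -> : f = \sum_(l < n.+1) k l.
    apply: csphereP => x; rewrite fg csphere_sumE -f1E f1h csphere_sumE mulr_suml.
    by apply: eq_bigr => l _; rewrite kE.
  have K l : spherical_poly n.+1 (k l).
    have [h' hh' ->] := spherical_harmonic_mulX d1 (hh l) (kE l).
    elim/big_ind : _ => [||l' _].
    + exact: spherical_harmonic_poly (leq0n _) (spherical_harmonic0 0).
    + by move=> *; exact: spherical_polyD.
    + apply: spherical_harmonic_poly (hh' l').
      exact: (leq_trans (leq_ord l') (ltn_ord l)).
  elim/big_ind : _ => [||//].
  + exact: spherical_harmonic_poly (leq0n _) (spherical_harmonic0 0).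
  + by move=> *; exact: spherical_polyD.
Qed.

End harmonic.

(** * Trigonometric polynomials *)

Section trig.
Context {R : realType}.
Implicit Types (f g : R -> R) (t x y : R).

Inductive trig : nat -> (R -> R) -> Prop :=
| trig_cos n l : (l <= n)%N -> trig n (fun t => cos (l%:R * t))
| trig_sin n l : (l <= n)%N -> trig n (fun t => sin (l%:R * t))
| trig_add n f g : trig n f -> trig n g -> trig n (fun t => f t + g t)
| trig_scale n c f : trig n f -> trig n (fun t => c * f t).

Lemma trig_ext n f g : f =1 g -> trig n f -> trig n g.
Proof. by move=> /funext ->. Qed.

Lemma trig_cst n c : trig n (fun=> c).
Proof.
apply: trig_ext (trig_scale c (trig_cos (leq0n n))) => t.
by rewrite mul0r cos0 mulr1.
Qed.

Lemma trig_mul_cos n f : trig n f -> trig n.+1 (fun t => f t * cos t).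
Proof.
elim=> {f}n.
- case=> [|l] ln.
    apply: trig_ext (@trig_cos n.+1 1 _) => // t.
    by rewrite mul0r cos0 !mul1r.
  have l1 : (l <= n.+1)%N by lia.
  have l2 : (l.+2 <= n.+1)%N by lia.
  apply: trig_ext (trig_scale 2^-1 (trig_add (trig_cos l1) (trig_cos l2))) => t.
  have -> : l%:R * t = l.+1%:R * t - t by rewrite -[l.+1]addn1 natrD; ring.
  have -> : l.+2%:R * t = l.+1%:R * t + t by rewrite -[l.+2]addn1 natrD; ring.
  by rewrite cosB cosD; field.
- case=> [|l] ln.
    by apply: trig_ext (trig_cst _ 0) => t; rewrite mul0r sin0 mul0r.
  have l1 : (l <= n.+1)%N by lia.
  have l2 : (l.+2 <= n.+1)%N by lia.
  apply: trig_ext (trig_scale 2^-1 (trig_add (trig_sin l1) (trig_sin l2))) => t.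
  have -> : l%:R * t = l.+1%:R * t - t by rewrite -[l.+1]addn1 natrD; ring.
  have -> : l.+2%:R * t = l.+1%:R * t + t by rewrite -[l.+2]addn1 natrD; ring.
  by rewrite sinB sinD; field.
- move=> f g _ IHf _ IHg; apply: trig_ext (trig_add IHf IHg) => t; ring.
- move=> c f _ IHf; apply: trig_ext (trig_scale c IHf) => t; ring.
Qed.

Lemma trig_mul_sin n f : trig n f -> trig n.+1 (fun t => f t * sin t).
Proof.
elim=> {f}n.
- case=> [|l] ln.
    apply: trig_ext (@trig_sin n.+1 1 _) => // t.
    by rewrite mul0r cos0 !mul1r.
  have l1 : (l <= n.+1)%N by lia.
  have l2 : (l.+2 <= n.+1)%N by lia.
  apply: trig_ext (trig_scale 2^-1
    (trig_add (trig_sin l2) (trig_scale (-1) (trig_sin l1)))) => t.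
  have -> : l%:R * t = l.+1%:R * t - t by rewrite -[l.+1]addn1 natrD; ring.
  have -> : l.+2%:R * t = l.+1%:R * t + t by rewrite -[l.+2]addn1 natrD; ring.
  by rewrite sinB sinD; field.
- case=> [|l] ln.
    by apply: trig_ext (trig_cst _ 0) => t; rewrite mul0r sin0 mul0r.
  have l1 : (l <= n.+1)%N by lia.
  have l2 : (l.+2 <= n.+1)%N by lia.
  apply: trig_ext (trig_scale 2^-1
    (trig_add (trig_cos l1) (trig_scale (-1) (trig_cos l2)))) => t.
  have -> : l%:R * t = l.+1%:R * t - t by rewrite -[l.+1]addn1 natrD; ring.
  have -> : l.+2%:R * t = l.+1%:R * t + t by rewrite -[l.+2]addn1 natrD; ring.
  by rewrite cosB cosD; field.
- move=> f g _ IHf _ IHg; apply: trig_ext (trig_add IHf IHg) => t; ring.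
- move=> c f _ IHf; apply: trig_ext (trig_scale c IHf) => t; ring.
Qed.

Lemma trig_shift n f h : trig n f -> trig n (fun t => f (t + h)).
Proof.
elim=> {f}n.
- move=> l ln; apply: trig_ext (trig_add (trig_scale (cos (l%:R * h)) (trig_cos ln))
    (trig_scale (- sin (l%:R * h)) (trig_sin ln))) => t.
  by rewrite mulrDr cosD; ring.
- move=> l ln; apply: trig_ext (trig_add (trig_scale (cos (l%:R * h)) (trig_sin ln))
    (trig_scale (sin (l%:R * h)) (trig_cos ln))) => t.
  by rewrite mulrDr sinD; ring.
- by move=> f g _ IHf _ IHg; exact: trig_add IHf IHg.
- by move=> c f _ IHf; exact: (trig_scale c IHf).
Qed.

(** Averages over these equispaced points replace integrals over the circle: they are exact for
    frequencies below [m]. *)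
Definition node (m j : nat) : R := j%:R * (pi *+ 2 / m%:R).

(* The sums over the nodes are fixed by the rotation by [2 pi l / m], which has
   no nonzero fixed point. *)
Lemma node_sum m l : (0 < l < m)%N ->
  \sum_(j < m) cos (l%:R * node m j) = 0 /\ \sum_(j < m) sin (l%:R * node m j) = 0.
Proof.
move=> /andP[l0 lm]; have m0 : (0 < m)%N by lia.
pose a : R := l%:R * (pi *+ 2 / m%:R).
pose A := \sum_(0 <= j < m) cos (j%:R * a); pose B := \sum_(0 <= j < m) sin (j%:R * a).
have AE : \sum_(j < m) cos (l%:R * node m j) = A.
  by rewrite /A big_mkord; apply: eq_bigr => j _; rewrite /node /a mulrCA.
have BE : \sum_(j < m) sin (l%:R * node m j) = B.
  by rewrite /B big_mkord; apply: eq_bigr => j _; rewrite /node /a mulrCA.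
have ma : m%:R * a = 0 + (pi *+ 2) *+ l.
  by rewrite /a add0r -[RHS]mulr_natl; field; rewrite pnatr_eq0; lia.
have cma : cos (m%:R * a) = 1.
  by rewrite ma (periodicn (@cosD2pi R)) cos0.
have sma : sin (m%:R * a) = 0.
  by rewrite ma (periodicn (@sinD2pi R)) sin0.
have A1 : A = A * cos a - B * sin a.
  rewrite {2}/A /B !mulr_suml -sumrB.
  transitivity (\sum_(0 <= j < m) cos (j.+1%:R * a)).
    rewrite /A; case: (m) m0 cma => // k _ ck.
    by rewrite big_nat_recl// big_nat_recr//= ck mul0r cos0 addrC.
  by apply: eq_bigr => j _; rewrite -natr1 mulrDl mul1r cosD.
have B1 : B = B * cos a + A * sin a.
  rewrite {2}/B /A !mulr_suml -big_split/=.
  transitivity (\sum_(0 <= j < m) sin (j.+1%:R * a)).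
    rewrite /B; case: (m) m0 sma => // k _ ck.
    by rewrite big_nat_recl// big_nat_recr//= ck mul0r sin0 addrC.
  by apply: eq_bigr => j _; rewrite -natr1 mulrDl mul1r sinD.
clearbody A B.
(* [a / 2 = pi l / m] lies strictly between 0 and pi, so [sin (a / 2) > 0]: the rotation by [a] is
   not the identity. *)
have ca : cos a < 1.
  have aE : a = (a / 2) *+ 2 by rewrite -mulr_natr divfK.
  have : 0 < sin (a / 2).
    apply: sin_gt0_pi; rewrite /a !(mulr_gt0, divr_gt0, invr_gt0)/= ?ltr0n//; last first.
    - by rewrite -mulr_natl mulr_gt0 ?pi_gt0.
    - have -> : l%:R * (pi *+ 2 / m%:R) / 2 = (l%:R / m%:R) * pi :> R.
        by rewrite -mulr_natl; field; rewrite pnatr_eq0; lia.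
      by rewrite -[ltRHS]mul1r ltr_pM2r ?pi_gt0// ltr_pdivrMr ?ltr0n// mul1r ltr_nat.
  rewrite [in cos a]aE cos_mulr2n cos2sin2 => s0; have := mulr_gt0 s0 s0.
  by rewrite -mulr_natl expr2; lra.
have cs := cos2Dsin2 a.
rewrite AE BE.
have E1 : A * (1 - cos a) = - (B * sin a) by lra.
have E2 : B * (1 - cos a) = A * sin a by lra.
(* The determinant [(1 - cos a)^2 + (sin a)^2] of the two equations equals [2 (1 - cos a)]. *)
have key u v : u * (1 - cos a) * (1 - cos a) + u * sin a * sin a = 2 * v ->
    u * (1 - cos a) = v.
  have -> : u * (1 - cos a) * (1 - cos a) + u * sin a * sin a =
    u * (cos a ^+ 2 + sin a ^+ 2) + u - 2 * u * cos a by ring.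
  rewrite cs => uv; have two : 2 != 0 :> R by rewrite pnatr_eq0.
  by apply: (mulfI two); rewrite -uv; ring.
have AA : A * (1 - cos a) = 0.
  apply: key; rewrite E1.
  have -> : - (B * sin a) * (1 - cos a) = - (B * (1 - cos a)) * sin a by ring.
  by rewrite E2; ring.
have BB : B * (1 - cos a) = 0.
  apply: key; rewrite E2.
  have -> : A * sin a * (1 - cos a) = A * (1 - cos a) * sin a by ring.
  by rewrite E1; ring.
have nz : 1 - cos a != 0 by rewrite subr_eq0 gt_eqF.
by split; apply: (mulIf nz); rewrite mul0r.
Qed.

Lemma node_orth m a b : (a < m)%N -> (b < m)%N ->
  \sum_(j < m) cos ((a%:R - b%:R) * node m j) = (m * (a == b))%:R /\
  \sum_(j < m) sin ((a%:R - b%:R) * node m j) = 0.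
Proof.
move=> am bm; case: (ltngtP a b) => [ab|ba|->].
- have -> : a%:R - b%:R = - (b - a)%:R :> R by rewrite natrB 1?ltnW//; ring.
  under eq_bigr do rewrite mulNr cosN.
  under [X in _ /\ X = _]eq_bigr do rewrite mulNr sinN.
  rewrite sumrN; have [|-> ->] := @node_sum m (b - a); first by lia.
  by rewrite muln0 oppr0.
- rewrite -natrB 1?ltnW//; have [|-> ->] := @node_sum m (a - b); first by lia.
  by rewrite muln0.
- rewrite subrr muln1; split.
    under eq_bigr do rewrite mul0r cos0.
    by rewrite sumr_const card_ord.
  by rewrite big1// => j _; rewrite mul0r sin0.
Qed.

(** Product formulas leave the frequencies [M + l] and [M - l] with [l <= n]: [n < M] keeps them
    positive, [M + n < m] excludes aliasing. *)
Lemma trig_node_orth m M n f : trig n f -> (n < M)%N -> (M + n < m)%N ->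
  \sum_(j < m) cos (M%:R * node m j) * f (node m j) = 0 /\
  \sum_(j < m) sin (M%:R * node m j) * f (node m j) = 0.
Proof.
move=> tf nM Mnm; elim: tf nM Mnm => {f}n.
- move=> l ln nM Mnm.
  have [|c1 s1] := @node_sum m (M + l); first by lia.
  have [|c2 s2] := @node_sum m (M - l); first by lia.
  split.
    transitivity (2^-1 * (\sum_(j < m) cos ((M + l)%:R * node m j) +
      \sum_(j < m) cos ((M - l)%:R * node m j))); last by rewrite c1 c2 addr0 mulr0.
    rewrite -big_split/= mulr_sumr.
    apply: eq_bigr => j _; rewrite natrD natrB ?mulrDl ?mulNr; last by lia.
    by rewrite cosB cosD; field.
  transitivity (2^-1 * (\sum_(j < m) sin ((M + l)%:R * node m j) +
      \sum_(j < m) sin ((M - l)%:R * node m j))); last by rewrite s1 s2 addr0 mulr0.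
    rewrite -big_split/= mulr_sumr.
  apply: eq_bigr => j _; rewrite natrD natrB ?mulrDl ?mulNr; last by lia.
  by rewrite sinB sinD; field.
- move=> l ln nM Mnm.
  have [|c1 s1] := @node_sum m (M + l); first by lia.
  have [|c2 s2] := @node_sum m (M - l); first by lia.
  split.
    transitivity (2^-1 * (\sum_(j < m) sin ((M + l)%:R * node m j) -
      \sum_(j < m) sin ((M - l)%:R * node m j))); last by rewrite s1 s2 subr0 mulr0.
    rewrite -sumrB mulr_sumr.
    apply: eq_bigr => j _; rewrite natrD natrB ?mulrDl ?mulNr; last by lia.
    by rewrite sinB sinD; field.
  transitivity (2^-1 * (\sum_(j < m) cos ((M - l)%:R * node m j) -
      \sum_(j < m) cos ((M + l)%:R * node m j))); last by rewrite c2 c1 subr0 mulr0.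
    rewrite -sumrB mulr_sumr.
  apply: eq_bigr => j _; rewrite natrD natrB ?mulrDl ?mulNr; last by lia.
  by rewrite cosB cosD; field.
- move=> f g _ IHf _ IHg nM Mnm; have [cf sf] := IHf nM Mnm; have [cg sg] := IHg nM Mnm.
  split; under eq_bigr do rewrite mulrDr.
    by rewrite big_split/= cf cg addr0.
  by rewrite big_split/= sf sg addr0.
- move=> c f _ IHf nM Mnm; have [cf sf] := IHf nM Mnm.
  split; under eq_bigr do rewrite mulrCA.
    by rewrite -mulr_sumr cf mulr0.
  by rewrite -mulr_sumr sf mulr0.
Qed.

(** * Fejer's kernel and Bernstein's inequality *)

Lemma sum_ltn_ord n q : (\sum_(i < n) (i < q)%N = minn q n)%N.
Proof.
elim: n => [|n IHn]; first by rewrite big_ord0 minn0.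
by rewrite big_ord_recr/= IHn; lia.
Qed.

(** This is the Fejer coefficient of frequency [p]; truncated subtraction makes it 0 from [p = n]
    on. *)
Lemma count_diff n p : (\sum_(i < n) \sum_(k < n) (p + i == k)%N = n - p)%N.
Proof.
transitivity (\sum_(i < n) (i < n - p)%N)%N; last by rewrite sum_ltn_ord; lia.
apply: eq_bigr => i _; have [pin|pin] := ltnP (p + i) n.
  rewrite (bigD1 (Ordinal pin))//= eqxx big1 => [|k]; first by lia.
  by rewrite -val_eqE/= eq_sym => /negPf ->.
rewrite big1 => [|k _]; first by lia.
by apply/eqP; rewrite eqb0; have := ltn_ord k; lia.
Qed.

(** The unnormalised Fejer kernel, of mean [n]: the squared modulus of the exponential sum over the
    frequencies below [n]. *)
Definition fejer n t : R := \sum_(i < n) \sum_(k < n) cos ((i%:R - k%:R) * t).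

Lemma fejer_ge0 n t : 0 <= fejer n t.
Proof.
have -> : fejer n t = (\sum_(i < n) cos (i%:R * t)) ^+ 2 + (\sum_(i < n) sin (i%:R * t)) ^+ 2.
  rewrite !expr2 !mulr_suml -big_split/=; apply: eq_bigr => i _.
  rewrite !mulr_sumr -big_split/=; apply: eq_bigr => k _.
  by rewrite mulrBl cosB.
by rewrite addr_ge0// sqr_ge0.
Qed.

(** Product formulas count, with weight one half each, the pairs of indices at difference [p] and at
    difference [-p], equally many by exchange; [p + n <= m] excludes aliasing. *)
Lemma fejer_cos_sum n p m : (0 < n)%N -> (p + n <= m)%N ->
  \sum_(j < m) cos (p%:R * node m j) * fejer n (node m j) = (m * (n - p))%:R.
Proof.
move=> n0 pnm; rewrite /fejer.
under eq_bigr => j _.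
  rewrite mulr_sumr; under eq_bigr do rewrite mulr_sumr; over.
rewrite exchange_big/=; under eq_bigr do rewrite exchange_big/=.
have E (i k : 'I_n) : \sum_(j < m) cos (p%:R * node m j) * cos ((i%:R - k%:R) * node m j) =
    2^-1 * (m * (p + i == k))%:R + 2^-1 * (m * (p + k == i))%:R.
  have i_n := ltn_ord i; have k_n := ltn_ord k.
  have ki : (p + i < m)%N by lia.
  have km : (k < m)%N by lia.
  have kk : (p + k < m)%N by lia.
  have im : (i < m)%N by lia.
  have [e1 _] := node_orth ki km.
  have [e2 _] := node_orth kk im.
  rewrite -e1 -e2 !mulr_sumr -big_split/=; apply: eq_bigr => j _.
  rewrite (_ : ((p + i)%:R - k%:R) * node m j = p%:R * node m j + (i%:R - k%:R) * node m j).
    rewrite (_ : ((p + k)%:R - i%:R) * node m j = p%:R * node m j - (i%:R - k%:R) * node m j).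
      by rewrite cosB cosD; field.
    by rewrite natrD; ring.
  by rewrite natrD; ring.
under eq_bigr do rewrite (eq_bigr _ (fun k _ => E _ k)) big_split/=.
rewrite big_split/= [X in _ + X]exchange_big/= -!big_split/=.
transitivity (\sum_(i < n) \sum_(k < n) (m * (p + i == k))%:R : R).
  by apply: eq_bigr => i _; rewrite -big_split/=; apply: eq_bigr => k _; field.
rewrite -(count_diff n p) big_distrr natr_sum/=; apply: eq_bigr => i _.
by rewrite big_distrr natr_sum.
Qed.

Lemma fejer_sin_sum n p m : (0 < n)%N -> (p + n <= m)%N ->
  \sum_(j < m) sin (p%:R * node m j) * fejer n (node m j) = 0.
Proof.
move=> n0 pnm; rewrite /fejer.
under eq_bigr => j _.
  rewrite mulr_sumr; under eq_bigr do rewrite mulr_sumr; over.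
rewrite exchange_big/=; under eq_bigr do rewrite exchange_big/=.
rewrite big1// => i _; rewrite big1// => k _.
have i_n := ltn_ord i; have k_n := ltn_ord k.
have ki : (p + i < m)%N by lia.
have km : (k < m)%N by lia.
have kk : (p + k < m)%N by lia.
have im : (i < m)%N by lia.
have [_ s1] := node_orth ki km.
have [_ s2] := node_orth kk im.
transitivity (2^-1 * (\sum_(j < m) sin (((p + i)%:R - k%:R) * node m j) +
  \sum_(j < m) sin (((p + k)%:R - i%:R) * node m j))); last by rewrite s1 s2 addr0 mulr0.
rewrite -big_split/= mulr_sumr; apply: eq_bigr => j _.
rewrite (_ : ((p + i)%:R - k%:R) * node m j = p%:R * node m j + (i%:R - k%:R) * node m j).
  rewrite (_ : ((p + k)%:R - i%:R) * node m j = p%:R * node m j - (i%:R - k%:R) * node m j).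
    by rewrite sinB sinD; field.
  by rewrite natrD; ring.
by rewrite natrD; ring.
Qed.

(* Its Fourier coefficients of order at most [n] are proportional to the
   frequency, so that averaging against it differentiates. *)
Definition bernstein_kernel n t : R := 2 * sin (n%:R * t) * fejer n t.

(** The sine moment is the difference of the Fejer coefficients at [n - l] and [n + l], namely [l]
    and 0. *)
Lemma bernstein_kernel_moments n l m : (0 < n)%N -> (l <= n)%N -> (3 * n <= m)%N ->
  \sum_(j < m) cos (l%:R * node m j) * bernstein_kernel n (node m j) = 0 /\
  \sum_(j < m) sin (l%:R * node m j) * bernstein_kernel n (node m j) = m%:R * l%:R.
Proof.
move=> n0 ln nm; have m1 : (n - l + n <= m)%N by lia.
have m2 : (n + l + n <= m)%N by lia.
split.
  transitivity (\sum_(j < m) sin ((n - l)%:R * node m j) * fejer n (node m j) +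
      \sum_(j < m) sin ((n + l)%:R * node m j) * fejer n (node m j)).
    rewrite -big_split/=; apply: eq_bigr => j _.
    rewrite natrD natrB// !mulrDl mulNr sinB sinD /bernstein_kernel; ring.
  by rewrite (fejer_sin_sum n0 m1) (fejer_sin_sum n0 m2) addr0.
have -> : m%:R * l%:R = (m * (n - (n - l)))%:R - (m * (n - (n + l)))%:R :> R.
  by rewrite (_ : n - (n + l) = 0)%N ?muln0 ?subr0 ?subKn ?natrM//; lia.
rewrite -(fejer_cos_sum n0 m1) -(fejer_cos_sum n0 m2) -sumrB.
apply: eq_bigr => j _; rewrite natrD natrB// !mulrDl mulNr cosB cosD /bernstein_kernel; ring.
Qed.

Lemma is_derive_mull (a x : R) : is_derive x 1 (fun t => a * t) a.
Proof. by apply: (is_derive_eq (is_deriveZ a (is_derive_id x 1))); rewrite -[RHS]mulr1. Qed.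

Lemma is_derive_cosM (a x : R) : is_derive x 1 (fun t => cos (a * t)) (- a * sin (a * x)).
Proof.
apply: (is_derive_eq (is_derive1_comp (is_derive_cos (a * x)) (is_derive_mull a x))).
ring.
Qed.

Lemma is_derive_sinM (a x : R) : is_derive x 1 (fun t => sin (a * t)) (a * cos (a * x)).
Proof.
apply: (is_derive_eq (is_derive1_comp (is_derive_sin (a * x)) (is_derive_mull a x))).
ring.
Qed.

(** An interpolation formula in the style of M. Riesz: differentiation is a weighted average of
    translates. By linearity it is checked on cosines and sines, where it amounts to the two moments
    of the kernel. *)
Lemma trig_derive n m f : (0 < n)%N -> (3 * n <= m)%N -> trig n f ->
  forall x, is_derive x 1 f
    (m%:R^-1 * \sum_(j < m) f (x + node m j) * bernstein_kernel n (node m j)).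
Proof.
move=> n0 nm tf; have m0 : m%:R != 0 :> R by rewrite pnatr_eq0; lia.
elim: tf n0 nm => {f}n.
- move=> l ln n0 nm x; have [kc ks] := bernstein_kernel_moments n0 ln nm.
  under eq_bigr do rewrite mulrDr cosD mulrBl -!mulrA.
  rewrite sumrB -!mulr_sumr kc ks mulr0 sub0r mulrN mulrCA (mulrA m%:R^-1) mulVf// mul1r mulrC.
  by rewrite -mulNr; exact: is_derive_cosM.
- move=> l ln n0 nm x; have [kc ks] := bernstein_kernel_moments n0 ln nm.
  under eq_bigr do rewrite mulrDr sinD mulrDl -!mulrA.
  rewrite big_split/= -!mulr_sumr kc ks mulr0 add0r mulrCA (mulrA m%:R^-1) mulVf// mul1r mulrC.
  exact: is_derive_sinM.
- move=> f g _ IHf _ IHg n0 nm x.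
  under eq_bigr do rewrite mulrDl.
  rewrite big_split/= mulrDr; apply: is_deriveD; [exact: IHf|exact: IHg].
- move=> c f _ IHf n0 nm x.
  under eq_bigr do rewrite -mulrA.
  rewrite -mulr_sumr mulrCA; apply: is_deriveZ; exact: IHf.
Qed.

(** Bernstein's inequality in integrated form. The constant is [2 n] instead of the sharp [n],
    because the kernel is bounded by twice Fejer's, whose mean is [n]. *)
Lemma trig_lipschitz n f (B : R) : (0 < n)%N -> trig n f -> (forall x, `|f x| <= B) ->
  forall x h, `|f (x + h) - f x| <= 2 * n%:R * B * `|h|.
Proof.
move=> n0 tf fB.
have B0 : 0 <= B by rewrite (le_trans (normr_ge0 _) (fB 0)).
pose m := (3 * n)%N; have m0 : 0 < m%:R :> R by rewrite ltr0n /m; lia.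
have df := trig_derive n0 (leqnn m) tf.
set D := fun x => m%:R^-1 * \sum_(j < m) f (x + node m j) * bernstein_kernel n (node m j).
have DB x : `|D x| <= 2 * n%:R * B.
  rewrite /D normrM gtr0_norm ?invr_gt0// ler_pdivrMl//.
  apply: (le_trans (ler_norm_sum _ _ _)).
  have -> : m%:R * (2 * n%:R * B) = 2 * B * (m * (n - 0))%:R by rewrite subn0 natrM; ring.
  rewrite -(@fejer_cos_sum n 0 m)//; last by rewrite /m; lia.
  rewrite mulr_sumr; apply: ler_sum => j _.
  rewrite mul0r cos0 mul1r normrM mulrC -mulrA.
  have -> : 2 * (B * fejer n (node m j)) = 2 * fejer n (node m j) * B by ring.
  apply: ler_pM => //; rewrite /bernstein_kernel !normrM gtr0_norm// (ger0_norm (fejer_ge0 _ _)).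
  by rewrite ler_wpM2r ?fejer_ge0// ler_piMr// sin_max.
have cf x y : {within `[x, y], continuous f}.
  apply: continuous_subspaceT => z; apply: differentiable_continuous.
  by apply/derivable1_diffP; case: (df z).
have main x y : x <= y -> `|f y - f x| <= 2 * n%:R * B * (y - x).
  move=> xy; have [c _ ->] := MVT_segment xy (fun z _ => df z) (@cf x y).
  by rewrite normrM [`|y - x|]ger0_norm ?subr_ge0// ler_wpM2r ?subr_ge0// DB.
move=> x h; have [h0|h0] := leP 0 h.
  have xh : x <= x + h by rewrite lerDl.
  have := main _ _ xh; have -> : x + h - x = h by ring.
  by rewrite (ger0_norm h0).
have xh : x + h <= x by rewrite gerDl ltW.
have := main _ _ xh; have -> : x - (x + h) = - h by ring.
by rewrite distrC (ltr0_norm h0).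
Qed.

(** [trig_lipschitz] is applied twice, the second time to the first difference of [f], again
    trigonometric of degree [n]. *)
Lemma trig_second_difference n f (B : R) : (0 < n)%N -> trig n f -> (forall x, `|f x| <= B) ->
  forall x h, `|(f (x + h) + f (x - h)) / 2 - f x| <= 2 * (n%:R * h) ^+ 2 * B.
Proof.
move=> n0 tf fB x h.
have tg : trig n (fun t => f (t + h) - f t).
  by apply: trig_ext (trig_add (trig_shift h tf) (trig_scale (-1) tf)) => t; rewrite mulN1r.
have gB t := trig_lipschitz n0 tf fB t h.
have := trig_lipschitz n0 tg gB (x - h) h; rewrite subrK.
have -> : f (x + h) - f x - (f x - f (x - h)) = 2 * ((f (x + h) + f (x - h)) / 2 - f x) by field.
rewrite normrM gtr0_norm// => H.
have -> : 2 * (n%:R * h) ^+ 2 * B = 2^-1 * (2 * n%:R * (2 * n%:R * B * `|h|) * `|h|).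
  by rewrite exprMn -(real_normK (num_real h)); field.
by rewrite ler_pdivlMl.
Qed.

(** With [u = t / 4], [sin u >= u cos u] by the mean value theorem, so [sin (t / 2) >= 2 u (cos u)^2
    = u (1 + cos (t / 2)) >= t / 4]; then [1 - cos t = 2 (sin (t / 2))^2]. *)
Lemma sqr_le_cos t : 0 <= t <= pi -> t ^+ 2 <= 8 * (1 - cos t).
Proof.
move=> /andP[t0 tpi].
pose u : R := t / 4.
have pi2 := @pihalf_lt2 R; have pi0 := @pi_gt0 R.
have u0 : 0 <= u by rewrite /u; lra.
have [c cu E] := MVT_segment u0 (fun z _ => is_derive_sin z)
  (continuous_subspaceT (@continuous_sin R)).
move: E; rewrite sin0 !subr0 => E.
have cosu : cos u <= cos c.
  move: cu; rewrite in_itv/= => /andP[c0 cu].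
  have upi : u <= pi by rewrite /u; lra.
  by rewrite leNgt ltr_cos ?in_itv/= -?leNgt// ?u0 ?c0 ?upi// (le_trans cu).
have cu0 : 0 <= cos u by apply: cos_ge0_pihalf; rewrite /u; apply/andP; split; lra.
have su : u * cos u <= sin u by rewrite E mulrC ler_wpM2r.
have s2 : sin (t / 2) = 2 * (cos u * sin u).
  by rewrite mulr_natl -sin_mulr2n; congr sin; rewrite /u -mulr_natl; field.
have c2 : cos u ^+ 2 = (1 + cos (t / 2)) / 2.
  have -> : t / 2 = u *+ 2 by rewrite /u -mulr_natl; field.
  by rewrite cos_mulr2n -mulr_natl; field.
have ct : 0 <= cos (t / 2) by apply: cos_ge0_pihalf; apply/andP; split; lra.
have s3 : t / 4 <= sin (t / 2).
  rewrite s2; have := ler_wpM2l cu0 su; rewrite mulrCA -expr2 c2 => H.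
  have : u * 1 <= u * (1 + cos (t / 2)) by rewrite ler_wpM2l// lerDl.
  rewrite /u in H *; lra.
have -> : cos t = 1 - 2 * sin (t / 2) ^+ 2.
  rewrite {1}(_ : t = (t / 2) *+ 2); last by rewrite -mulr_natl; field.
  by rewrite cos_mulr2n cos2sin2; ring.
have h : (t / 4) ^+ 2 <= sin (t / 2) ^+ 2.
  have t40 : 0 <= t / 4 by lra.
  by rewrite lerXn2r// nnegrE// (le_trans t40).
by move: h; rewrite exprMn; lra.
Qed.

End trig.

(** * Reflections and half-turns of the sphere *)

Section isometries.
Context {R : realType} {d : nat}.
Local Notation S := (sphere R d).
Implicit Types (x y v : S).

Lemma sum_sqr_comb (a b : R) x y :
  \sum_i (a * coor x i + b * coor y i) ^+ 2 = a ^+ 2 + 2 * a * b * dot x y + b ^+ 2.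
Proof.
transitivity (a ^+ 2 * dot x x + 2 * a * b * dot x y + b ^+ 2 * dot y y).
  by rewrite /dot !mulr_sumr -!big_split/=; apply: eq_bigr => i _; ring.
by rewrite !dotxx !mulr1.
Qed.

Lemma dot_comb z (a b : R) x y w : (forall i, coor z i = a * coor x i + b * coor y i) ->
  dot z w = a * dot x w + b * dot y w.
Proof.
move=> zE; rewrite /dot !mulr_sumr -!big_split/=; apply: eq_bigr => i _.
by rewrite zE; ring.
Qed.

Lemma refl_subproof (b : bool) v x :
  \sum_i ((-1) ^+ b * coor x i + (- (-1) ^+ b * 2 * dot v x) * coor v i) ^+ 2 = 1.
Proof.
rewrite sum_sqr_comb [dot x v]dotC.
transitivity (((-1) ^+ b) ^+ 2 : R); last by rewrite sqrr_sign.
ring.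
Qed.

(* The reflection in the hyperplane orthogonal to [v] for [b = false], and its
   opposite, the half-turn about the axis [v], for [b = true]. *)
Definition refl b v x : S := sphere_of (refl_subproof b v x).

Lemma coor_refl b v x i :
  coor (refl b v x) i = (-1) ^+ b * coor x i + (- (-1) ^+ b * 2 * dot v x) * coor v i.
Proof. exact: coor_sphere_of. Qed.

Lemma dot_refl b v x y : dot (refl b v x) (refl b v y) = dot x y.
Proof.
rewrite (dot_comb _ (coor_refl b v x)) ![dot _ (refl b v y)]dotC.
rewrite !(dot_comb _ (coor_refl b v y)) dotxx (dotC y x) (dotC y v).
transitivity ((((-1) ^+ b) ^+ 2 : R) * dot x y); last by rewrite sqrr_sign mul1r.
ring.
Qed.

Lemma reflK b v : involutive (refl b v).
Proof.
move=> x; apply: coor_inj => i; rewrite !coor_refl.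
rewrite (dotC v (refl b v x)) (dot_comb _ (coor_refl b v x)) dotxx (dotC x v).
transitivity ((((-1) ^+ b) ^+ 2 : R) * coor x i); last by rewrite sqrr_sign mul1r.
ring.
Qed.

Lemma spoly_refl n f b v : spoly n f -> spoly n (f \o refl b v).
Proof.
have c1 i : spoly 1 (fun x => coor (refl b v x) i).
  apply: (@spoly_ext _ _ _ (fun x => (-1) ^+ b * (coor x i - 2 * coor v i * dot v x))).
    by move=> x; rewrite coor_refl; ring.
  by apply/spoly_scale/spoly_sub; [exact: spoly_coor|exact/spoly_scale/spoly_dot].
elim=> {f}n => [c|f g _ IHf _ IHg|i f _ IHf].
- exact: spoly_cst.
- exact: spoly_add IHf IHg.
- by rewrite -addn1; exact: spoly_mul IHf (c1 i).
Qed.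

Lemma dot_eq1 x y : dot x y = 1 -> x = y.
Proof.
move=> xy; apply: coor_inj => i.
have : \sum_i (1 * coor x i + (-1) * coor y i) ^+ 2 = 0.
  by rewrite sum_sqr_comb xy; ring.
move=> /eqP; rewrite psumr_eq0 => [/allP h|j _]; last exact: sqr_ge0.
have := h i (mem_index_enum _).
by rewrite sqrf_eq0 mul1r mulN1r subr_eq0 => /eqP.
Qed.

Lemma dot_eqN1 x y i : dot x y = -1 -> coor y i = - coor x i.
Proof.
move=> xy.
have : \sum_i (1 * coor x i + 1 * coor y i) ^+ 2 = 0.
  by rewrite sum_sqr_comb xy; ring.
move=> /eqP; rewrite psumr_eq0 => [/allP h|j _]; last exact: sqr_ge0.
have := h i (mem_index_enum _).
by rewrite sqrf_eq0 !mul1r addr_eq0 => /eqP ->; rewrite opprK.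
Qed.

Lemma refl_trans x y : x != y -> exists v, refl false v x = y.
Proof.
move=> xy; have s0 : 0 < 2 * (1 - dot x y).
  rewrite mulr_gt0// subr_gt0 lt_neqAle dot_le1 andbT.
  by apply: contraNneq xy => /dot_eq1 ->.
(* The distance from [x] to [y]; the mirror is orthogonal to [(x - y) / s]. *)
pose s := Num.sqrt (2 * (1 - dot x y)).
have s2 : s ^+ 2 = 2 * (1 - dot x y) by rewrite sqr_sqrtr// ltW.
have sn0 : s != 0 by rewrite gt_eqF// sqrtr_gt0.
have v1 : \sum_i (s^-1 * coor x i + (- s^-1) * coor y i) ^+ 2 = 1.
  rewrite sum_sqr_comb.
  transitivity (2 * (1 - dot x y) / s ^+ 2); last by rewrite s2 divff ?gt_eqF.
  by field.
exists (sphere_of v1); apply: coor_inj => i; rewrite coor_refl coor_sphere_of expr0 mul1r.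
rewrite (dot_comb _ (coor_sphere_of v1)) dotxx (dotC y x).
transitivity (coor x i - (2 * (1 - dot x y)) / s ^+ 2 * (coor x i - coor y i)); first by field.
by rewrite s2 divff ?gt_eqF//; ring.
Qed.

End isometries.

(** * Restriction of polynomials to great circles *)

Section circles.
Context {R : realType} {d : nat}.
Local Notation S := (sphere R d).
Implicit Types (x y v : S).

Lemma circle_subproof x v t : dot x v = 0 ->
  \sum_i (cos t * coor x i + sin t * coor v i) ^+ 2 = 1.
Proof. by move=> xv; rewrite sum_sqr_comb xv mulr0 addr0 cos2Dsin2. Qed.

Definition circle x v (xv : dot x v = 0) t : S := sphere_of (circle_subproof t xv).

Lemma trig_circle n (f : S -> R) x v (xv : dot x v = 0) :
  spoly n f -> trig n (f \o circle xv).
Proof.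
elim=> {f}n => [c|f g _ IHf _ IHg|i f _ IHf].
- exact: trig_cst.
- exact: trig_add IHf IHg.
- apply: trig_ext (trig_add (trig_scale (coor x i) (trig_mul_cos IHf))
    (trig_scale (coor v i) (trig_mul_sin IHf))) => t /=.
  by rewrite coor_sphere_of; ring.
Qed.

(** On the great circle through [x] and [y] the half-turn about [x] sends the angle [t] to [-t], so
    this is a second difference with [cos t = x.y]; the 16 is 2 times the 8 of [sqr_le_cos]. If [y]
    is [x] or its antipode no circle is determined, but the half-turn fixes [y] and the crude bound
    [2 B] is enough. *)
Lemma spoly_second_difference n (f : S -> R) (B : R) x y : (0 < n)%N -> spoly n f ->
  (forall z, `|f z| <= B) ->
  `|(f y + f (refl true x y)) / 2 - f x| <= 16 * n%:R ^+ 2 * B * (1 - dot x y).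
Proof.
move=> n0 sf fB.
have B0 : 0 <= B by rewrite (le_trans (normr_ge0 _) (fB x)).
have n1 : 1 <= n%:R ^+ 2 :> R by rewrite -natrX ler1n expn_gt0 n0.
have cxy : -1 <= dot x y <= 1 by rewrite dot_geN1 dot_le1.
have rE i : coor (refl true x y) i = 2 * dot x y * coor x i - coor y i.
  by rewrite coor_refl expr1; ring.
have [xy|xy] := eqVneq (dot x y ^+ 2) 1; last first.
  have s0 : 0 < 1 - dot x y ^+ 2.
    have h : 0 <= (1 - dot x y) * (1 + dot x y).
      by apply: mulr_ge0; move: cxy => /andP[]; lra.
    by rewrite subr_gt0 lt_neqAle xy/=; lra.
  pose s := Num.sqrt (1 - dot x y ^+ 2).
  have s2 : s ^+ 2 = 1 - dot x y ^+ 2 by rewrite sqr_sqrtr// ltW.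
  have sn0 : s != 0 by rewrite gt_eqF// sqrtr_gt0.
  have v1 : \sum_i (s^-1 * coor y i + (- (dot x y / s)) * coor x i) ^+ 2 = 1.
    rewrite sum_sqr_comb (dotC y x).
    transitivity ((1 - dot x y ^+ 2) / s ^+ 2); last by rewrite s2 divff ?gt_eqF.
    by field.
  have xv : dot x (sphere_of v1) = 0.
    by rewrite dotC (dot_comb _ (coor_sphere_of v1)) dotxx (dotC y x); ring.
  pose t := acos (dot x y).
  have ct : cos t = dot x y by rewrite acosK ?in_itv.
  have st : sin t = s by rewrite sin_acos.
  have yE : circle xv (0 + t) = y.
    rewrite add0r; apply: coor_inj => i; rewrite !coor_sphere_of ct st.
    by field.
  have rE' : circle xv (0 - t) = refl true x y.
    rewrite sub0r; apply: coor_inj => i; rewrite rE !coor_sphere_of cosN sinN ct st.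
    by field.
  have xE : circle xv 0 = x.
    by apply: coor_inj => i; rewrite !coor_sphere_of cos0 sin0; ring.
  have := trig_second_difference n0 (trig_circle xv sf) (fun t => fB (circle xv t)) 0 t.
  rewrite /= yE rE' xE => /le_trans; apply.
  have : t ^+ 2 <= 8 * (1 - cos t) by apply: sqr_le_cos; rewrite acos_ge0//= acos_lepi.
  rewrite ct exprMn => t8.
  have -> : 16 * n%:R ^+ 2 * B * (1 - dot x y) =
    2 * (n%:R ^+ 2 * (8 * (1 - dot x y))) * B by ring.
  by rewrite ler_wpM2r// ler_wpM2l// ler_wpM2l// sqr_ge0.
move/eqP: xy; rewrite sqrf_eq1 => /orP[]/eqP xy.
  have yx := dot_eq1 xy; subst y.
  have -> : refl true x x = x by apply: coor_inj => i; rewrite rE dotxx; ring.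
  by rewrite (_ : (f x + f x) / 2 - f x = 0) ?normr0 ?dotxx ?subrr ?mulr0//; field.
have -> : refl true x y = y.
  by apply: coor_inj => i; rewrite rE xy (dot_eqN1 i xy); ring.
have -> : (f y + f y) / 2 = f y by field.
rewrite xy (le_trans (ler_normB _ _))// (le_trans (lerD (fB _) (fB _)))//.
have : 32 * (1 * B) <= 32 * (n%:R ^+ 2 * B) by rewrite ler_wpM2l// ler_wpM2r.
by lra.
Qed.

End circles.

(** * The lower bound *)

Section lower_bound.
Context {R : realType} {d : nat}.
Local Notation S := (sphere R d).
Local Notation C := (csphere R d).
Local Notation Rc := (complex R).

Let sqn (w : Rc) : R := Re w ^+ 2 + Im w ^+ 2.

Let sqnM w z : sqn (w * z) = sqn w * sqn z.
Proof. by case: w => a b; case: z => c e; rewrite /sqn/=; ring. Qed.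

Let sqn_expn w k : sqn w <= 1 -> sqn (w ^+ k) <= 1.
Proof.
move=> w1; elim: k => [|k IHk]; first by rewrite /sqn/= expr1n expr0n/= addr0.
by rewrite exprS sqnM mulr_ile1// addr_ge0// sqr_ge0.
Qed.

(* The square root of [1 - Re w] is subadditive on the unit disc. *)
Lemma subadditive_re (w z : Rc) (a b : R) : 0 <= a -> 0 <= b -> sqn w <= 1 -> sqn z <= 1 ->
  1 - Re w <= a ^+ 2 -> 1 - Re z <= b ^+ 2 -> 1 - Re (w * z) <= (a + b) ^+ 2.
Proof.
case: w => p q; case: z => r s; rewrite /sqn/= => a0 b0 w1 z1 pa rb.
(* [1 - Re (w z) = (1 - Re w) + (1 - Re z) + X], where [|X| <= |1 - w| |1 - z|] by Cauchy-Schwarz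
   and [|1 - w|^2 <= 2 (1 - Re w)] on the disc. *)
pose X := q * s - (1 - p) * (1 - r).
have p1 : 0 <= 1 - p by nra.
have r1 : 0 <= 1 - r by nra.
have X2 : X ^+ 2 <= (2 * a * b) ^+ 2.
  have h1 : X ^+ 2 <= ((1 - p) ^+ 2 + q ^+ 2) * ((1 - r) ^+ 2 + s ^+ 2).
    have := sqr_ge0 ((1 - p) * s + q * (1 - r)); rewrite /X; lra.
  have h2 : (1 - p) ^+ 2 + q ^+ 2 <= 2 * a ^+ 2 by lra.
  have h3 : (1 - r) ^+ 2 + s ^+ 2 <= 2 * b ^+ 2 by lra.
  apply: (le_trans h1); apply: (le_trans (ler_pM _ _ h2 h3)).
  - by rewrite addr_ge0// sqr_ge0.
  - by rewrite addr_ge0// sqr_ge0.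
  - by rewrite !exprMn; lra.
have : X <= 2 * a * b.
  have ab : 0 <= 2 * a * b by rewrite !mulr_ge0.
  have [X0|X0] := leP X 0; first exact: le_trans ab.
  by rewrite -(@ler_pXn2r _ 2) ?nnegrE// ltW.
by rewrite /X; lra.
Qed.

(** By subadditivity the square root of the left side grows at most linearly in [k]; on the circle
    this is [1 - cos (k t) <= k^2 (1 - cos t)]. *)
Lemma re_expn (w : Rc) k : sqn w <= 1 -> 1 - Re (w ^+ k) <= k%:R ^+ 2 * (1 - Re w).
Proof.
move=> w1; have w0 : 0 <= 1 - Re w by case: w w1 => p q; rewrite /sqn/=; nra.
pose a := Num.sqrt (1 - Re w).
have a2 : 1 - Re w = a ^+ 2 by rewrite sqr_sqrtr.
rewrite a2 -exprMn; elim: k => [|k IHk]; first by rewrite /= subrr mul0r expr0n.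
rewrite exprSr -natr1 mulrDl mul1r; apply: subadditive_re => //.
- by rewrite mulr_ge0// sqrtr_ge0.
- by rewrite sqrtr_ge0.
- exact: sqn_expn.
- by rewrite a2.
Qed.

(** For odd [k] the expression is odd in [w], so the upper bound suffices. With [a = k^-2] it is at
    most [Re w + a (1 - Re w^k)], and [re_expn] bounds the last term by [1 - Re w]. *)
Lemma odd_expn_bound (w : Rc) k : odd k -> sqn w <= 1 ->
  `|(1 + k%:R ^- 2) * Re w - k%:R ^- 2 * Re (w ^+ k)| <= 1.
Proof.
move=> ok; wlog: w / 0 <= (1 + k%:R ^- 2) * Re w - k%:R ^- 2 * Re (w ^+ k) => [hw w1|].
  have [h|h] := leP 0 ((1 + k%:R ^- 2) * Re w - k%:R ^- 2 * Re (w ^+ k)); first exact: hw.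
  have wN : (1 + k%:R ^- 2) * Re (- w) - k%:R ^- 2 * Re ((- w) ^+ k) =
      - ((1 + k%:R ^- 2) * Re w - k%:R ^- 2 * Re (w ^+ k)).
    by rewrite exprNn -signr_odd ok expr1 mulN1r; case: (w ^+ k) => a b; case: w {h} w1 => p q _ /=; ring.
  have := hw (- w); rewrite wN normrN; apply; first by rewrite oppr_ge0 ltW.
  by case: w w1 {h wN} => p q; rewrite /sqn/= !sqrrN.
move=> h w1; rewrite ger0_norm//.
have k0 : k%:R ^+ 2 != 0 :> R by rewrite expf_neq0// pnatr_eq0 -lt0n odd_gt0.
have kV : 0 <= k%:R ^- 2 :> R by rewrite invr_ge0 sqr_ge0.
have w0 : Re w <= 1 by case: w w1 {h} => p q; rewrite /sqn/=; nra.
have := ler_wpM2l kV (re_expn k w1); rewrite mulrA mulVf// mul1r.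
have := ler_wpM2l kV w0; lra.
Qed.

Context (d1 : (1 <= d)%N).

Let zc (x : S) : Rc := Complex (coor x ord0) (coor x (inord 1)).

Let zc_le1 x : sqn (zc x) <= 1.
Proof.
rewrite /sqn/= -(dotxx x) /dot (bigD1 ord0)//= (bigD1 (inord 1))/=; last first.
  by rewrite -val_eqE/= inordK.
by rewrite !expr2 lerD2l lerDl sumr_ge0// => i _; rewrite -expr2 sqr_ge0.
Qed.

Let zc_spoly m : spoly m (fun x => Re (zc x ^+ m)) /\ spoly m (fun x => Im (zc x ^+ m)).
Proof.
elim: m => [|m [IH1 IH2]]; first by split; exact: spoly_cst.
have zE (w : Rc) (p q : R) : w * Complex p q = Complex (Re w * p - Im w * q) (Re w * q + Im w * p).
  by case: w.
split.
  apply: spoly_ext (spoly_sub (spoly_mulX ord0 IH1) (spoly_mulX (inord 1) IH2)) => x.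
  by rewrite exprSr zE.
apply: spoly_ext (spoly_add (spoly_mulX (inord 1) IH1) (spoly_mulX ord0 IH2)) => x.
by rewrite exprSr zE.
Qed.

Let cis t : Rc := Complex (cos t) (sin t).

Let cis_expn t m : cis t ^+ m = cis (m%:R * t).
Proof.
elim: m => [|m IHm]; first by rewrite mul0r /cis cos0 sin0.
by rewrite exprSr IHm -natr1 mulrDl mul1r /cis cosD sinD; congr Complex; rewrite addrC.
Qed.

Let re_rot (w : Rc) t m :
  Re ((w * cis (- t)) ^+ m) = cos (m%:R * t) * Re (w ^+ m) + sin (m%:R * t) * Im (w ^+ m).
Proof.
rewrite exprMn cis_expn mulrN /cis cosN sinN; case: (w ^+ m) => a b /=; ring.
Qed.

(* [A] applied to the trial functions [g t], and evaluated at the points [x t] of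
   a great circle where [g t] is extremal, is averaged over equispaced [t].  The
   part of degree [M > N] averages to zero because [A] maps it into degree [N]. *)
Lemma admissible_lower (A : {linear C -> C}) L N : (1 <= L <= N)%N ->
  (forall p, spherical_poly L p -> A p = p) -> range A `<=` spherical_poly N ->
  exists (g : C) (x : S), (forall y, `|g y| <= 1) /\
    1 + 9^-1 * (L%:R / N.+1%:R) ^+ 2 <= A g x.
Proof.
move=> /andP[L1 LN] AL AN.
(* [N %/ L + 1] is the least [k] with [k L > N]; if it is even the next integer is taken, at the
   cost of one more [L]. *)
have [k ok /andP[kN kL]] : exists2 k, odd k & (N < k * L <= N + 2 * L)%N.
  have h1 := ltn_ceil N L1; have h2 := leq_trunc_div N L.
  have [qo|qo] := boolP (odd (N %/ L).+1).
    by exists (N %/ L).+1 => //; rewrite h1/= mulSn; lia.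
  by exists (N %/ L).+2; [rewrite oddS qo|move: h1; rewrite !mulSn; lia].
have k0 : (0 < k)%N by rewrite odd_gt0.
pose a : R := k%:R ^- 2; pose M := (k * L)%N.
have [U UE] := csphere_of_spoly (zc_spoly L).1.
have [V VE] := csphere_of_spoly (zc_spoly L).2.
have [U' UE'] := csphere_of_spoly (zc_spoly M).1.
have [V' VE'] := csphere_of_spoly (zc_spoly M).2.
have AU : A U = U.
  by apply/AL/spoly_spherical_poly => //; rewrite (funext UE); exact: (zc_spoly L).1.
have AV : A V = V.
  by apply/AL/spoly_spherical_poly => //; rewrite (funext VE); exact: (zc_spoly L).2.
(* The trial function is expanded in four fixed functions, so that [A (g t)] depends on [t] through
   cosines and sines only. *)
pose g t : C := (1 + a) *: (cos (L%:R * t) *: U + sin (L%:R * t) *: V) -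
   a *: (cos (M%:R * t) *: U' + sin (M%:R * t) *: V').
have gE t x : g t x = (1 + a) * Re ((zc x * cis (- t)) ^+ L) - a * Re (((zc x * cis (- t)) ^+ L) ^+ k).
  by rewrite -exprM mulnC !re_rot -UE -VE -UE' -VE'.
have g1 t x : `|g t x| <= 1.
  rewrite gE; apply: odd_expn_bound => //; apply: sqn_expn.
  rewrite sqnM {2}/sqn/= cosN sinN sqrrN cos2Dsin2 mulr1; exact: zc_le1.
have b1 (i : 'I_d.+1) : \sum_j ((j == i)%:R : R) ^+ 2 = 1.
  by rewrite (bigD1 i)//= eqxx expr1n big1 ?addr0// => j /negPf ->; rewrite expr0n.
have i01 : (inord 1 == ord0 :> 'I_d.+1) = false by rewrite -val_eqE/= inordK.
have xv : dot (sphere_of (b1 ord0)) (sphere_of (b1 (inord 1))) = 0.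
  rewrite /dot big1// => i _; rewrite !coor_sphere_of.
  by have [->|_] := eqVneq i ord0; rewrite ?mul0r// eq_sym i01 mulr0.
pose x t := circle xv t.
have zx t : zc (x t) = cis t.
  by rewrite /zc !coor_sphere_of eqxx i01 eq_sym i01 eqxx !mulr0 !mulr1 addr0 add0r.
have AgE t : A (g t) (x t) = (1 + a) -
    a * (cos (M%:R * t) * A U' (x t) + sin (M%:R * t) * A V' (x t)).
  have -> : A (g t) = (1 + a) *: (cos (L%:R * t) *: U + sin (L%:R * t) *: V) -
      a *: (cos (M%:R * t) *: A U' + sin (M%:R * t) *: A V').
    have AZ c u : A (c *: u) = c *: A u by rewrite linearZ.
    have AD u v : A (u + v) = A u + A v by rewrite raddfD.
    have AB u v : A (u - v) = A u - A v by rewrite raddfB.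
    by rewrite /g AB !AZ !AD !AZ AU AV.
  transitivity ((1 + a) * (cos (L%:R * t) * U (x t) + sin (L%:R * t) * V (x t)) -
    a * (cos (M%:R * t) * A U' (x t) + sin (M%:R * t) * A V' (x t))); first by [].
  rewrite UE VE -re_rot zx (_ : cis t * cis (- t) = 1) ?expr1n/= ?mulr1//.
  rewrite /cis cosN sinN -[1]/(Complex 1 0); congr Complex.
    by rewrite -(cos2Dsin2 t); ring.
  by ring.
have NM : (N < M)%N by [].
(* Enough nodes to average exactly the products of frequency [M] with trigonometric polynomials of
   degree [N]. *)
pose m := (M + N).+1.
have tA (W : C) : trig N (A W \o x).
  by apply/trig_circle/spherical_poly_spoly/AN; exists W.
have [c1 _] := trig_node_orth (tA U') NM (ltnSn (M + N)).
have [_ c2] := trig_node_orth (tA V') NM (ltnSn (M + N)).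
have sumE : \sum_(j < m) A (g (node m j)) (x (node m j)) = m%:R * (1 + a).
  under eq_bigr do rewrite AgE.
  rewrite /= -/m in c1 c2.
  rewrite sumrB sumr_const card_ord -mulr_sumr big_split/= c1 c2 addr0 mulr0 subr0.
  by rewrite mulr_natl.
have [j hj] : exists j : 'I_m, 1 + a <= A (g (node m j)) (x (node m j)).
  apply: contrapT => /forallNP h.
  have : \sum_(j < m) A (g (node m j)) (x (node m j)) < \sum_(j < m) (1 + a).
    apply: ltr_sum => [|j _]; last by rewrite ltNge; apply/negP/h.
    by apply/hasP; exists ord0; rewrite ?mem_index_enum.
  by rewrite sumE sumr_const card_ord mulr_natl ltxx.
exists (g (node m j)), (x (node m j)); split=> //; apply: le_trans hj.
(* [k L <= N + 2 L <= 3 N] gives [L / (N + 1) <= 3 / k]; the 9 is the square of this 3. *)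
rewrite lerD2l /a -exprVn -[9^-1](_ : 3^-1 ^+ 2 = _); last by field.
rewrite -exprMn lerXn2r ?nnegrE//.
rewrite mulrA -[leLHS]mulrC mulrA -invfM -natrM mulrC.
rewrite ler_pdivrMr ?ltr0n// mulrC ler_pdivlMr ?ltr0n// -natrM ler_nat; lia.
Qed.

End lower_bound.

(** * Invariant means and reproducing kernels *)

Section invariant_state.
Context {R : realType} {d : nat}.
Local Notation S := (sphere R d).
Implicit Types (f g : S -> R) (x y : S) (I J : (S -> R) -> R).

Lemma sphere_compact : compact [set: S].
Proof.
pose g (v : 'rV[R]_d.+1) : S := insubd (point : S) v.
have gK : cancel (fun x : S => val x) g by move=> x; exact: valKd.
have -> : [set: S] = g @` unit_sphere R d.
  by apply/seteqP; split=> // x _; exists (val x) => //; exact/set_mem/(valP x).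
apply: continuous_compact (@compact_unit_sphere R d).
apply/subspace_sigL_continuousP.
have -> : sigL (unit_sphere R d) g = id by apply/funext => x; exact: gK.
by move=> x; exact: cvg_id.
Qed.

Definition bnd f := exists M, forall x, `|f x| <= M.

Lemma bnd_cst c : bnd (fun=> c).
Proof. by exists `|c|. Qed.

Lemma bndD f g : bnd f -> bnd g -> bnd (fun x => f x + g x).
Proof.
by move=> [M fM] [K gK]; exists (M + K) => x; rewrite (le_trans (ler_normD _ _))// lerD.
Qed.

Lemma bndM f g : bnd f -> bnd g -> bnd (fun x => f x * g x).
Proof. by move=> [M fM] [K gK]; exists (M * K) => x; rewrite normrM ler_pM. Qed.

Lemma bndZ c f : bnd f -> bnd (fun x => c * f x).
Proof. by apply: bndM; exact: bnd_cst. Qed.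

Lemma bnd_comp f (h : S -> S) : bnd f -> bnd (f \o h).
Proof. by move=> [M fM]; exists M => x; exact: fM. Qed.

(* Finitely additive means on all bounded functions: one that is invariant on
   polynomials of a given degree will do the work of the surface measure. *)
Definition state I : Prop :=
  [/\ I (fun=> 1) = 1,
      forall f g, bnd f -> bnd g -> I (fun x => f x + g x) = I f + I g,
      forall c f, bnd f -> I (fun x => c * f x) = c * I f &
      forall f, bnd f -> (forall x, 0 <= f x) -> 0 <= I f].

Section theory.
Variables (I : (S -> R) -> R) (sI : state I).

Lemma stateD f g : bnd f -> bnd g -> I (fun x => f x + g x) = I f + I g.
Proof. by have [_ h _ _] := sI; exact: h. Qed.

Lemma stateZ c f : bnd f -> I (fun x => c * f x) = c * I f.
Proof. by have [_ _ h _] := sI; exact: h. Qed.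

Lemma state_ge0 f : bnd f -> (forall x, 0 <= f x) -> 0 <= I f.
Proof. by have [_ _ _ h] := sI; exact: h. Qed.

Lemma state_cst c : I (fun=> c) = c.
Proof.
have [I1 _ _ _] := sI.
by rewrite -[RHS](mulr1 c) -I1 -stateZ; [congr I; apply/funext => x; rewrite mulr1|exact: bnd_cst].
Qed.

Lemma stateB f g : bnd f -> bnd g -> I (fun x => f x - g x) = I f - I g.
Proof.
move=> bf bg; rewrite -mulN1r -stateZ// -stateD//; last exact: bndZ.
by congr I; apply/funext => x; rewrite mulN1r.
Qed.

Lemma state_le f g : bnd f -> bnd g -> (forall x, f x <= g x) -> I f <= I g.
Proof.
move=> bf bg fg; rewrite -subr_ge0 -stateB//; apply: state_ge0 => [|x].
  apply: bndD => //; have := bndZ (-1) bf.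
  by congr bnd; apply/funext => x; rewrite mulN1r.
by rewrite subr_ge0.
Qed.

Lemma bnd_sum (T : Type) (r : seq T) (F : T -> S -> R) :
  (forall i, bnd (F i)) -> bnd (fun x => \sum_(i <- r) F i x).
Proof.
move=> bF; elim: r => [|i r IHr].
  rewrite (_ : (fun x => _) = fun=> 0); first exact: bnd_cst.
  by apply/funext => x; rewrite big_nil.
rewrite (_ : (fun x => _) = fun x => F i x + \sum_(j <- r) F j x); first exact: bndD.
by apply/funext => x; rewrite big_cons.
Qed.

Lemma state_sum (T : Type) (r : seq T) (F : T -> S -> R) : (forall i, bnd (F i)) ->
  I (fun x => \sum_(i <- r) F i x) = \sum_(i <- r) I (F i).
Proof.
move=> bF; elim: r => [|i r IHr].
  by rewrite big_nil -[RHS](state_cst 0); congr I; apply/funext => x; rewrite big_nil.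
rewrite big_cons -IHr -stateD//; last exact: bnd_sum.
by congr I; apply/funext => x; rewrite big_cons.
Qed.

Lemma state_norm_le f (M : R) : (forall x, `|f x| <= M) -> `|I f| <= M.
Proof.
move=> fM; have bf : bnd f by exists M.
rewrite ler_norml; apply/andP; split.
  rewrite -(state_cst (- M)); apply: state_le => //; first exact: bnd_cst.
  by move=> x; have := fM x; rewrite ler_norml => /andP[].
rewrite -[leRHS]state_cst; apply: state_le => //; first exact: bnd_cst.
by move=> x; have := fM x; rewrite ler_norml => /andP[].
Qed.

Lemma state_comp (h : S -> S) : state (fun f => I (f \o h)).
Proof.
split.
- exact: state_cst.
- by move=> f g bf bg; apply: (@stateD (f \o h) (g \o h)); exact: bnd_comp.
- by move=> c f bf; apply: (@stateZ c (f \o h)); exact: bnd_comp.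
- by move=> f bf f0; apply: state_ge0 => [|x]; [exact: bnd_comp|exact: f0].
Qed.

End theory.

Lemma state_eval x : state (fun f => f x).
Proof. by split. Qed.

Lemma state_mid I J : state I -> state J -> state (fun f => (I f + J f) / 2).
Proof.
move=> sI sJ; split.
- by rewrite (state_cst sI) (state_cst sJ); field.
- by move=> f g bf bg; rewrite (stateD sI)// (stateD sJ)//; field.
- by move=> c f bf; rewrite (stateZ sI)// (stateZ sJ)//; field.
- move=> f bf f0; have := state_ge0 sI bf f0; have := state_ge0 sJ bf f0; lra.
Qed.

Lemma ultra_cvg (U : set_system nat) (u : nat -> R) (M : R) : UltraFilter U ->
  (forall k, `|u k| <= M) -> exists l : R, u @ U --> l.
Proof.
move=> UU uM.
have UA : (u @ U) `[- M, M]%classic.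
  by apply: (@filterS _ U _ setT); [move=> k _ /=; rewrite in_itv/= -ler_norml|exact: filterT].
have [l [_ cl]] := @segment_compact R (- M) M (u @ U) _ UA.
exists l => B lB; have [//|nB] := @in_ultra_setVsetC _ U (u @^-1` B) UU.
by have [z []] := cl (~` B) B nB lB.
Qed.

(* A minimising sequence is closed up along an ultrafilter finer than [\oo]. *)
Lemma state_minimizer (T : finType) (F : T -> S -> R) : (forall i, bnd (F i)) ->
  exists2 I, state I &
    forall J, state J -> \sum_i I (F i) ^+ 2 <= \sum_i J (F i) ^+ 2.
Proof.
move=> bF; pose N I := \sum_i I (F i) ^+ 2.
have hN : has_inf [set N J | J in state].
  split; first by exists (N (fun f => f point)); exists (fun f => f point) => //; exact: state_eval.
  by exists 0 => _ [J _ <-]; apply: sumr_ge0 => i _; exact: sqr_ge0.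
pose m := inf [set N J | J in state].
have H (k : nat) : exists J, state J /\ N J <= m + k.+1%:R^-1.
  have k0 : 0 < k.+1%:R^-1 :> R by rewrite invr_gt0.
  have [_ [J sJ <-] Jm] := inf_adherent k0 hN.
  by exists J; split=> //; exact: ltW.
have [J_ HJ] := choice H.
have sJ k : state (J_ k) by case: (HJ k).
have [U [UU ooU]] := @ultraFilterLemma _ (\oo : set_system nat) _.
(* The limit functional must be total; on unbounded functions, where [state] demands nothing, it
   takes the default 0. *)
have HI f : exists l : R, bnd f -> (J_ ^~ f) @ U --> l.
  have [[M fM]|nb] := pselect (bnd f); last by exists 0.
  have [|l lP] := @ultra_cvg U (J_ ^~ f) M UU; last by exists l.
  by move=> k; exact: state_norm_le.
have [I HI'] := choice HI.
have UF : ProperFilter U by case: UU.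
have uniq (u : nat -> R) (a b : R) : u @ U --> a -> u @ U --> b -> a = b.
  by move=> ua ub; apply: (cvg_unique _ ua ub); exact: norm_hausdorff.
have sI : state I.
  split.
  - apply: (uniq (fun k => J_ k (fun=> 1))); first exact/HI'/bnd_cst.
    rewrite (_ : (fun k => _) = fun=> 1); first exact: cvg_cst.
    by apply/funext => k; rewrite (state_cst (sJ k)).
  - move=> f g bf bg; apply: (uniq (fun k => J_ k (fun x => f x + g x))); first exact/HI'/bndD.
    rewrite (_ : (fun k => _) = fun k => J_ k f + J_ k g); first by apply: cvgD; exact: HI'.
    by apply/funext => k; rewrite (stateD (sJ k)).
  - move=> c f bf; apply: (uniq (fun k => J_ k (fun x => c * f x))); first exact/HI'/bndZ.
    rewrite (_ : (fun k => _) = fun k => c * J_ k f); first by apply: cvgMr; exact: HI'.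
    by apply/funext => k; rewrite (stateZ (sJ k)).
  - move=> f bf f0; have cf := HI' f bf.
    apply: (cvgr_to_ge cf); apply: (@filterS _ U _ setT); last exact: filterT.
    by move=> k _; exact: (state_ge0 (sJ k)).
exists I => // J sJ'.
have Nm : N I <= m.
  apply/ler_addgt0Pr => e e0.
  have cN : N \o J_ @ U --> N I.
    apply: cvg_big => [|i _]; first exact: add_continuous.
    apply: (@cvg_comp _ _ _ (J_ ^~ (F i)) (fun y : R => y ^+ 2)); first exact: HI'.
    exact: exprn_continuous.
  apply: (cvgr_to_le cN); apply: ooU; near=> k.
  have [_ /le_trans] := HJ k; apply; rewrite lerD2l ltW//.
  near: k; exact: near_infty_natSinv_lt (PosNum e0).
apply: (le_trans Nm); apply: ge_inf; first exact: hN.2.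
by exists J.
Unshelve. all: end_near.
Qed.

Definition refl_invariant n I := forall b v f, spoly n f -> I (f \o refl b v) = I f.

(** With the constant 1 as a letter, words of length exactly [n] give all monomials of degree at
    most [n], and their kernel is the power [(1 + x.y)^n]. *)
Definition letter (a : 'I_d.+2) x : R :=
  if unlift ord0 a is Some i then coor x i else 1.

Definition word n (w : {ffun 'I_n -> 'I_d.+2}) x : R := \prod_(i < n) letter (w i) x.

Definition wordl (s : seq 'I_d.+2) x : R := \prod_(a <- s) letter a x.

Lemma spoly_wordl s : spoly (size s) (wordl s).
Proof.
elim: s => [|a s IHs]; first by apply: spoly_ext (spoly_cst 0 1) => x; rewrite /wordl big_nil.
have sa : spoly 1 (letter a).
  by rewrite /letter; case: unlift => [i|]; [exact: spoly_coor|exact: spoly_cst].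
by apply: spoly_ext (spoly_mul sa IHs) => x; rewrite /wordl big_cons.
Qed.

Lemma wordl_word n (s : seq 'I_d.+2) : size s = n ->
  wordl s = word [ffun i : 'I_n => nth ord0 s i].
Proof.
move=> sn; apply/funext => x; rewrite /wordl /word (big_nth ord0) sn big_mkord.
by apply: eq_bigr => i _; rewrite ffunE.
Qed.

Lemma word_kernel n x y : \sum_(w : {ffun 'I_n -> 'I_d.+2}) word w x * word w y = (1 + dot x y) ^+ n.
Proof.
have E : 1 + dot x y = \sum_(a < d.+2) letter a x * letter a y.
  rewrite big_ord_recl /letter unlift_none mulr1; congr (1 + _).
  by apply: eq_bigr => i _; rewrite liftK.
rewrite -[n in RHS]card_ord -prodr_const E (bigA_distr_bigA (fun _ a => letter a x * letter a y)).
by apply: eq_bigr => w _; rewrite -big_split.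
Qed.

Lemma spoly_bnd n f : spoly n f -> bnd f.
Proof.
elim=> [k c|k g h _ bg _ bh|k i g _ bg]; [exact: bnd_cst|exact: bndD|apply: bndM => //].
by exists 1 => x; exact: coor_le1.
Qed.

Lemma word_bnd n (w : {ffun 'I_n -> 'I_d.+2}) : bnd (word w).
Proof.
have -> : word w = wordl [seq w i | i <- enum 'I_n].
  by apply/funext => x; rewrite /word /wordl big_map big_enum.
by apply: spoly_bnd; exact: spoly_wordl.
Qed.

(** Coordinates are moved one at a time from the polynomial to the word [s], the bound on the degree
    and the length of [s] adding up to [n]; the letter 1 pads the word when a constant is
    reached. *)
Lemma eq_state_words n I J : state I -> state J ->
  (forall w : {ffun 'I_n -> 'I_d.+2}, I (word w) = J (word w)) ->
  forall f, spoly n f -> I f = J f.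
Proof.
move=> sI sJ IJ f sf.
have IJs s : size s = n -> I (wordl s) = J (wordl s) by move=> /wordl_word ->.
suff H : forall k g, spoly k g -> forall s, (k + size s = n)%N ->
    I (fun x => g x * wordl s x) = J (fun x => g x * wordl s x).
  have := H n f sf [::]; rewrite addn0 => /(_ erefl).
  by rewrite (_ : (fun x => _) = f)//; apply/funext => x; rewrite /wordl big_nil mulr1.
move=> k g; elim=> {k g}.
- move=> k c s ks.
  have bs := spoly_bnd (spoly_wordl s).
  rewrite (stateZ sI c bs) (stateZ sJ c bs); congr (_ * _).
  have -> : wordl s = wordl (nseq k ord0 ++ s).
    apply/funext => x; rewrite /wordl big_cat/= [X in X * _]big1_seq ?mul1r// => a /=.
    by move=> /nseqP[-> _]; rewrite /letter unlift_none.
  by apply: IJs; rewrite size_cat size_nseq.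
- move=> k g h sg IHg sh IHh s ks.
  have bg : bnd (fun x => g x * wordl s x).
    by apply: bndM; [exact: spoly_bnd sg|exact: spoly_bnd (spoly_wordl s)].
  have bh : bnd (fun x => h x * wordl s x).
    by apply: bndM; [exact: spoly_bnd sh|exact: spoly_bnd (spoly_wordl s)].
  have -> : (fun x => (g x + h x) * wordl s x) = fun x => g x * wordl s x + h x * wordl s x.
    by apply/funext => x; rewrite mulrDl.
  by rewrite (stateD sI)// (stateD sJ)// IHg// IHh.
- move=> k i g sg IHg s ks.
  have := IHg (lift ord0 i :: s); rewrite /= addnS => /(_ ks).
  rewrite (_ : (fun x => _) = fun x => g x * coor x i * wordl s x)//.
  by apply/funext => x; rewrite /wordl big_cons {1}/letter liftK mulrA.
Qed.

(* The energy [sum_w I(f_w)^2] is the double integral of [(1 + x.y)^n], hence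
   invariant; as it is strictly convex, so is its minimiser. *)
Lemma invariant_state n : exists2 I, state I & refl_invariant n I.
Proof.
have [I sI Imin] := @state_minimizer _ (@word n) (@word_bnd n).
exists I => // b v f sf.
pose J g := I (g \o refl b v).
have sJ : state J by exact: state_comp.
have bw (w : {ffun 'I_n -> 'I_d.+2}) : bnd (word w) by exact: word_bnd.
have energy K : state K -> \sum_w K (@word n w) ^+ 2 =
    K (fun x => K (fun y => (1 + dot x y) ^+ n)).
  move=> sK.
  have -> : (fun x => K (fun y => (1 + dot x y) ^+ n)) =
      fun x => \sum_w K (@word n w) * word w x.
    apply/funext => x.
    have -> : (fun y => (1 + dot x y) ^+ n) = fun y => \sum_w word w x * @word n w y.
      by apply/funext => y; rewrite word_kernel.
    rewrite (state_sum sK) => [|w]; last exact: bndZ.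
    by apply: eq_bigr => w _; rewrite (stateZ sK _ (bw w)) mulrC.
  rewrite (state_sum sK) => [|w]; last exact: bndZ.
  by apply: eq_bigr => w _; rewrite (stateZ sK _ (bw w)) expr2.
have EJ : \sum_w J (@word n w) ^+ 2 = \sum_w I (@word n w) ^+ 2.
  rewrite (energy J sJ) (energy I sI) /J; congr I; apply/funext => x /=.
  by congr I; apply/funext => y /=; rewrite dot_refl.
apply/esym; apply: (eq_state_words sI sJ) sf => w.
(* By the parallelogram identity, as [I] and [J] have equal energy, their midpoint has strictly less
   unless they agree on all words. *)
have := Imin _ (state_mid sI sJ).
have -> : \sum_i ((I (@word n i) + J (word i)) / 2) ^+ 2 =
  \sum_i I (@word n i) ^+ 2 - 4^-1 * \sum_i (I (word i) - J (@word n i)) ^+ 2.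
  have -> : \sum_i I (@word n i) ^+ 2 = 2^-1 * \sum_i I (@word n i) ^+ 2 + 2^-1 * \sum_i J (@word n i) ^+ 2.
    by rewrite EJ; field.
  by rewrite !mulr_sumr -!big_split/= -sumrB; apply: eq_bigr => i _; field.
rewrite -subr_ge0 addrAC subrr add0r oppr_ge0 pmulr_rle0 ?invr_gt0// => h.
have : \sum_i (I (word i) - J (@word n i)) ^+ 2 = 0.
  by apply/eqP; rewrite eq_le h sumr_ge0// => i _; exact: sqr_ge0.
move=> /eqP; rewrite psumr_eq0 => [/allP/(_ w (mem_index_enum _))|i _]; last exact: sqr_ge0.
by rewrite sqrf_eq0 subr_eq0 => /eqP.
Qed.

End invariant_state.

(** * A monomial basis of the polynomials on the sphere *)

Section basis.
Context {R : realType} {d : nat}.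
Local Notation S := (sphere R d).
Implicit Types (f g : S -> R) (x y : S).

Definition mono (a : nat) (e : 'I_d -> nat) x : R :=
  coor x ord0 ^+ a * \prod_(i < d) coor x (lift ord0 i) ^+ e i.

(* Powers of the coordinate [0] above the first are redundant, as the squares of
   the coordinates sum to 1. *)
Definition exponent n : finType :=
  {e : 'I_2 * {ffun 'I_d -> 'I_n.+1} | (e.1 + \sum_i e.2 i <= n)%N}.

Definition sbasis n (al : exponent n) : S -> R := mono (val al).1 (fun i => (val al).2 i).

Definition spanned n f := exists c : exponent n -> R, forall x, f x = \sum_al c al * sbasis al x.

Lemma spoly_basis n (al : exponent n) : spoly n (sbasis al).
Proof.
have H : spoly ((val al).1 + \sum_i (val al).2 i)%N (sbasis al).
  apply: spoly_mul; first by rewrite -[X in spoly X]muln1; exact/spoly_exp/spoly_coor.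
  have -> : (\sum_i (val al).2 i = \sum_(i <- enum 'I_d) (val al).2 i)%N by rewrite big_enum.
  rewrite (_ : (fun x => _) = fun x : S => \prod_(i <- enum 'I_d) coor x (lift ord0 i) ^+ (val al).2 i); last first.
    by apply/funext => x; rewrite big_enum.
  elim: (enum 'I_d) => [|i r IHr].
    by apply: spoly_ext (spoly_cst _ 1) => x; rewrite big_nil.
  rewrite big_cons -[X in (X + _)%N]muln1.
  apply: spoly_ext (spoly_mul (spoly_exp ((val al).2 i) (spoly_coor (lift ord0 i))) IHr) => x.
  by rewrite big_cons.
exact: spoly_le (valP al) H.
Qed.

Lemma spannedD n f g : spanned n f -> spanned n g -> spanned n (fun x => f x + g x).
Proof.
move=> [c cE] [b bE]; exists (fun al => c al + b al) => x.
by rewrite cE bE -big_split/=; apply: eq_bigr => al _; rewrite mulrDl.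
Qed.

Lemma spannedZ n c f : spanned n f -> spanned n (fun x => c * f x).
Proof.
move=> [b bE]; exists (fun al => c * b al) => x.
by rewrite bE mulr_sumr; apply: eq_bigr => al _; rewrite mulrA.
Qed.

Lemma spanned_ext n f g : f =1 g -> spanned n f -> spanned n g.
Proof. by move=> /funext ->. Qed.

Lemma spanned_sum n (T : Type) (r : seq T) (F : T -> S -> R) :
  (forall i, spanned n (F i)) -> spanned n (fun x => \sum_(i <- r) F i x).
Proof.
move=> sF; elim: r => [|i r IHr].
  exists (fun=> 0) => x; rewrite big_nil big1// => al _; exact: mul0r.
by apply: spanned_ext (spannedD (sF i) IHr) => x; rewrite big_cons.
Qed.

Lemma spanned_mono n a (e : 'I_d -> nat) : (a <= 1)%N -> (a + \sum_i e i <= n)%N ->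
  spanned n (mono a e).
Proof.
move=> a1 aen.
have en i : (e i < n.+1)%N.
  by rewrite ltnS (leq_trans _ aen)// (bigD1 i)//= addnA (addnC a) -addnA leq_addr.
pose al0 := (Ordinal (a1 : (a < 2)%N), [ffun i => Ordinal (en i)]).
have h : (al0.1 + \sum_i al0.2 i <= n)%N.
  by rewrite /= (eq_bigr e)// => i _; rewrite ffunE.
exists (fun al => (al == exist (fun al : 'I_2 * _ => _) al0 h)%:R) => x.
rewrite (bigD1 (exist _ al0 h))//= eqxx mul1r big1 ?addr0 => [|al /negPf ->]; last by rewrite mul0r.
rewrite /sbasis /mono /=; congr (_ * _); apply: eq_bigr => i _; by rewrite ffunE.
Qed.

Lemma spanned_basis_mulX n (al : exponent n) i : spanned n.+1 (fun x => sbasis al x * coor x i).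
Proof.
have := valP al; rewrite /sbasis; move: (val al) => [a e] /= ae.
pose up (e : 'I_d -> nat) j k := (e k + (k == j))%N.
have upE (e' : 'I_d -> nat) j x b : mono b (up e' j) x = mono b e' x * coor x (lift ord0 j).
  rewrite /mono -mulrA; congr (_ * _).
  rewrite (bigD1 j)//= [in RHS](bigD1 j)//= /up eqxx addn1 exprSr -!mulrA; congr (_ * _).
  by rewrite mulrC; congr (_ * _); apply: eq_bigr => k /negPf ->; rewrite addn0.
have sum_up (e' : 'I_d -> nat) j : (\sum_k up e' j k = (\sum_k e' k).+1)%N.
  rewrite big_split/= -addn1; congr (_ + _)%N.
  by rewrite (bigD1 j)//= eqxx big1// => k /negPf ->.
have [->|[j ->]] : i = ord0 \/ exists j, i = lift ord0 j.
  by have [j ->|->] := unliftP ord0 i; [right; exists j|left].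
  have [a0|a0] := eqVneq (a : nat) 0%N.
    apply: (@spanned_ext _ (mono 1 (fun i => e i))) => [x|].
      by rewrite /mono a0 expr0 expr1 mul1r mulrC.
    by apply: spanned_mono => //; rewrite add1n ltnS; move: ae; rewrite a0.
  (* The product contains [x_0^2], replaced by [1 - sum_j x_j^2], which does not raise the
     degree. *)
  have a1 : (a : nat) = 1%N by have := ltn_ord a; lia.
  apply: (@spanned_ext _ (fun x => mono 0 (fun i => e i) x +
      (-1) * \sum_j mono 0 (up (up (fun i => e i) j) j) x)) => [x|].
    under eq_bigr do rewrite !upE -mulrA -expr2.
    rewrite -mulr_sumr /mono a1 expr0 expr1 !mul1r.
    have -> : \sum_(j < d) coor x (lift ord0 j) ^+ 2 = 1 - coor x ord0 ^+ 2.
      apply/eqP; rewrite eq_sym subr_eq eq_sym -(dotxx x) /dot big_ord_recl expr2 addrC.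
      by apply/eqP; congr (_ + _); apply: eq_bigr => j _; rewrite expr2.
    ring.
  rewrite a1 add1n in ae.
  apply: spannedD; first by apply: spanned_mono => //; rewrite add0n ltnW// ltnW.
  apply/spannedZ/spanned_sum => j; apply: spanned_mono => //.
  by rewrite !sum_up add0n ltnS.
apply: (@spanned_ext _ (mono a (up (fun i => e i) j))) => [x|]; first by rewrite upE.
by apply: spanned_mono; rewrite ?sum_up ?addnS// -ltnS; exact: ltn_ord.
Qed.

Lemma spoly_spanned n f : spoly n f -> spanned n f.
Proof.
elim=> {f}n => [c|f g _ IHf _ IHg|i f _ [c cE]].
- apply: (@spanned_ext _ (fun x => c * mono 0 (fun=> 0%N) x)) => [x|].
    by rewrite /mono expr0 mul1r big1 ?mulr1.
  by apply/spannedZ/spanned_mono => //; rewrite big1.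
- exact: spannedD.
- apply: (@spanned_ext _ (fun x => \sum_al c al * (sbasis al x * coor x i))) => [x|].
    by rewrite cE mulr_suml; apply: eq_bigr => al _; rewrite mulrA.
  by apply: spanned_sum => al; apply/spannedZ/spanned_basis_mulX.
Qed.

Lemma digits_inj K m (e e' : nat -> nat) : (forall j, e j < K)%N -> (forall j, e' j < K)%N ->
  (\sum_(j < m) e j * K ^ j = \sum_(j < m) e' j * K ^ j)%N ->
  forall j, (j < m)%N -> e j = e' j.
Proof.
elim: m e e' => [//|m IHm] e e' eK eK'.
have K0 : (0 < K)%N by exact: leq_ltn_trans (eK 0%N).
rewrite !big_ord_recl !expn0 !muln1.
have E (u : nat -> nat) : (\sum_(i < m) u (bump 0 i) * K ^ (bump 0 i) =
    (\sum_(i < m) u i.+1 * K ^ i) * K)%N.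
  by rewrite big_distrl/=; apply: eq_bigr => i _; rewrite /bump add1n expnSr mulnA.
rewrite !E => h.
have e0 : e 0%N = e' 0%N.
  have := congr1 (modn^~ K) h.
  by rewrite ![(_ + _ * K)%N]addnC !modnMDl !modn_small.
have hA : (\sum_(i < m) e i.+1 * K ^ i = \sum_(i < m) e' i.+1 * K ^ i)%N.
  by apply/eqP; rewrite -(eqn_pmul2r K0) -(eqn_add2l (e 0%N)) {2}e0 h.
case=> [//|j]; rewrite ltnS => jm.
exact: (IHm (fun j => e j.+1) (fun j => e' j.+1)).
Qed.

Lemma poly_eq0_roots (P : {poly R}) (e : R) : 0 < e ->
  (forall t, 0 < t < e -> P.[t] = 0) -> P = 0.
Proof.
move=> e0 h; apply/eqP; apply: contraT => P0.
pose t (i : nat) : R := e / i.+2%:R.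
have := max_poly_roots P0 (rs := [seq t i | i <- iota 0 (size P)]).
rewrite size_map size_iota ltnn => /(_ _ _) ->//.
- apply/allP => _ /mapP[i _ ->]; apply/rootP/h.
  rewrite divr_gt0// ltr_pdivrMr// ltr_pMr// ltr1n//.
- rewrite map_inj_uniq ?iota_uniq// => i j /(mulfI (lt0r_neq0 e0))/invr_inj/eqP.
  by rewrite eqr_nat => /eqP[].
Qed.

(* Kronecker substitution: at the points with coordinates [t ^ (K ^ j)], and
   either sign for the coordinate [0], distinct exponents give distinct powers
   of [t]. *)
Lemma sbasis_free n (c : exponent n -> R) :
  (forall x, \sum_al c al * sbasis al x = 0) -> forall al, c al = 0.
Proof.
(* Larger than every exponent, so that exponents are digits in base [K]. *)
move=> c0; pose K := n.+1.
pose k (al : exponent n) := (\sum_(j < d) (val al).2 j * K ^ j)%N.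
pose P (b : bool) : {poly R} := \sum_(al : exponent n | ((val al).1 == 0 :> nat) == b) c al *: 'X^(k al).
have P0 b : P b = 0.
  have e0 : 0 < d.+1%:R^-1 :> R by rewrite invr_gt0.
  apply: (poly_eq0_roots e0) => t /andP[t0 td].
  have t1 : t <= 1 by rewrite (le_trans (ltW td))// invf_le1// ler1n.
  (* For [t < 1 / (d + 1)] the prescribed coordinates leave room for a nonzero coordinate 0, of
     either sign. *)
  have u1 : \sum_(j < d) (t ^+ (K ^ j)) ^+ 2 < 1.
    apply: (@le_lt_trans _ _ (\sum_(j < d) t)).
      apply: ler_sum => j _; rewrite -exprM -[leRHS]expr1 ler_wiXn2l ?t1 ?(ltW t0)//.
      by rewrite muln_gt0 expn_gt0.
    rewrite sumr_const card_ord -[t *+ d]mulr_natr.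
    apply: (@le_lt_trans _ _ (t * d.+1%:R)); first by apply: ler_wpM2l; rewrite ?(ltW t0)// ler_nat.
    by rewrite -ltr_pdivlMr// div1r.
  pose r := Num.sqrt (1 - \sum_(j < d) (t ^+ (K ^ j)) ^+ 2).
  have r0 : 0 < r by rewrite sqrtr_gt0 subr_gt0.
  have r2 : r ^+ 2 = 1 - \sum_(j < d) (t ^+ (K ^ j)) ^+ 2 by rewrite sqr_sqrtr// subr_ge0 ltW.
  pose u (s : bool) (i : 'I_d.+1) : R := if unlift ord0 i is Some j then t ^+ (K ^ j) else (-1) ^+ s * r.
  have uE s : \sum_i u s i ^+ 2 = 1.
    rewrite big_ord_recl /u unlift_none; under eq_bigr do rewrite liftK.
    by rewrite exprMn sqrr_sign mul1r r2 subrK.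
  have basisE s al : sbasis al (sphere_of (uE s)) = ((-1) ^+ s * r) ^+ (val al).1 * t ^+ k al.
    rewrite /sbasis /mono coor_sphere_of /u unlift_none; congr (_ * _).
    rewrite /k -prodrXr; apply: eq_bigr => j _.
    by rewrite coor_sphere_of /u liftK -exprM mulnC.
  have PE b' : (P b').[t] = \sum_(al : exponent n | ((val al).1 == 0 :> nat) == b') c al * t ^+ k al.
    by rewrite horner_sum; apply: eq_bigr => al _; rewrite hornerZ hornerXn.
  (* [P true] and [P false] collect the basis functions without and with [x_0]; the two signs
     separate them. *)
  have main (s : bool) : (P true).[t] + (-1) ^+ s * r * (P false).[t] = 0.
    rewrite -[RHS](c0 (sphere_of (uE s))) (bigID (fun al : exponent n => ((val al).1 == 0 :> nat) == true))/=.
    rewrite !PE; congr (_ + _).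
      by apply: eq_bigr => al; rewrite eqb_id => /eqP a0; rewrite basisE a0 expr0 mul1r.
    rewrite mulr_sumr; apply: eq_big => [al|al a0]; first by case: ((val al).1 == 0%N :> nat).
    rewrite basisE (_ : ((val al).1 : nat) = 1%N) ?expr1; first by ring.
    by move: a0; case: ((val al).1) => -[|[|//]].
  have := main true; have := main false; rewrite expr1 expr0 mul1r mulN1r mulNr => m1 m2.
  case: b; first by lra.
  by apply/(mulfI (lt0r_neq0 r0)); rewrite mulr0; lra.
move=> al; have := congr1 (fun p : {poly R} => p`_(k al)) (P0 ((val al).1 == 0 :> nat)).
rewrite coef0 coef_sum (bigD1 al)//= coefZ coefXn eqxx mulr1 big1 ?addr0// => be /andP[/eqP ab ba].
rewrite coefZ coefXn; case: eqP => [kk|_]; last by rewrite mulr0.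
suff : be = al by move=> beal; rewrite beal eqxx in ba.
apply/val_inj.
have {}ab : ((val be).1 == 0 :> nat) = ((val al).1 == 0 :> nat) := ab.
move: ab kk; rewrite /k; move: (val al) (val be) => [a e] [a' e'] /= aa kk.
congr (_, _).
  apply/val_inj => /=; move: aa (ltn_ord a) (ltn_ord a'); clear.
  by case: (nat_of_ord a) (nat_of_ord a') => [|[|?]] [|[|?]].
apply/ffunP => j; apply/val_inj => /=.
pose ex (e : {ffun 'I_d -> 'I_n.+1}) (i : nat) : nat := if insub i is Some i' then e i' else 0%N.
have exE e1 (i : 'I_d) : ex e1 i = e1 i by rewrite /ex valK.
have exK e1 i : (ex e1 i < K)%N by rewrite /ex; case: insub.
rewrite -!exE; apply: (digits_inj (exK e') (exK e) _ (ltn_ord j)).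
by under eq_bigr do rewrite exE; under [RHS]eq_bigr do rewrite exE.
Qed.

End basis.

(** * Reproducing kernels from an invariant mean *)

Section kernel.
Context {R : realType} {d : nat}.
Local Notation S := (sphere R d).
Implicit Types (f g p : S -> R) (x y : S).

Lemma refl_transitive x y : exists b v, refl b v x = y.
Proof.
have [->|xy] := eqVneq x y; last by have [v vxy] := refl_trans xy; exists false, v.
exists true, y; apply: coor_inj => i; rewrite coor_refl dotxx expr1; ring.
Qed.

(** If [p x0] is nonzero, reflections carry [x0] everywhere, so by compactness finitely many
    reflected copies of [p^2] add up to at least a positive constant; all have the same mean, which
    therefore cannot vanish. Finite additivity suffices for this. *)
Lemma state_definite (I : (S -> R) -> R) n p : state I -> refl_invariant (2 * n) I ->
  spoly n p -> I (fun x => p x ^+ 2) = 0 -> forall x, p x = 0.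
Proof.
move=> sI invI sp Ip x0; apply/eqP; apply: contraT => px0.
have c0 : 0 < p x0 ^+ 2 by rewrite exprn_even_gt0.
have H y : exists bv : bool * S, refl bv.1 bv.2 y = x0.
  by have [b [v bv]] := refl_transitive y x0; exists (b, v).
have [h hE] := choice H.
pose q y x := p (refl (h y).1 (h y).2 x) ^+ 2.
have sq y : spoly (2 * n) (q y).
  by apply: spoly_exp; exact: (spoly_refl _ _ sp).
pose U y := [set x | p x0 ^+ 2 / 2 < q y x].
have oU y : open (U y).
  have /continuousP/(_ [set z : R | p x0 ^+ 2 / 2 < z]) := spoly_continuous (sq y).
  by apply; exact: open_gt.
have := @sphere_compact R d; rewrite compact_cover => /(_ S setT U) [//|x _|D _ cD].
  by exists x => //; rewrite /U /q /= hE ltr_pdivrMr// ltr_pMr// ltr1n.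
have : p x0 ^+ 2 / 2 <= I (fun x => \sum_(y <- finmap.enum_fset D) q y x).
  rewrite -(state_cst sI (p x0 ^+ 2 / 2)); apply: (state_le sI); first exact: bnd_cst.
    by apply: bnd_sum => y; exact: spoly_bnd (sq y).
  move=> x; have [y yD Uyx] := cD x Logic.I.
  rewrite (big_rem y)//= ler_wpDr ?(ltW Uyx)// sumr_ge0// => z _; exact: sqr_ge0.
rewrite (state_sum sI) => [|y]; last exact: spoly_bnd (sq y).
rewrite big1 => [|y _]; first by rewrite leNgt divr_gt0.
rewrite -[RHS]Ip; apply: (invI (h y).1 (h y).2 (fun x => p x ^+ 2)).
exact: spoly_exp.
Qed.

(** The dimension of the polynomials of degree at most [n] on the sphere, by [spoly_spanned] and
    [sbasis_free]. *)
Definition ndim n : nat := #|exponent (d := d) n|.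

(** The last clause, a finite sum of products, lets [D] serve as the kernel of an operator with
    polynomial range. *)
Definition reproducing (I : (S -> R) -> R) n (D : S -> S -> R) : Prop :=
  [/\ forall x, spoly n (D x),
      forall x p, spoly n p -> I (fun y => p y * D x y) = p x,
      forall x, D x x = (ndim n)%:R,
      forall b v x y, D (refl b v x) (refl b v y) = D x y &
      exists a e : 'I_(ndim n) -> S -> R,
        [/\ forall i, spoly n (a i), forall i, spoly n (e i) &
            forall x y, D x y = \sum_i a i x * e i y]].

(** The kernel is built from the inverse of the Gram matrix [G] of the monomial basis, invertible by
    [state_definite]. It is invariant because a reproducing kernel is unique; hence its diagonal is
    constant, equal to its mean, which is the trace of [G^-1 G]. *)
Lemma reproducing_kernel (I : (S -> R) -> R) n : state I -> refl_invariant (2 * n) I ->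
  exists D, reproducing I n D.
Proof.
move=> sI invI; pose m := ndim n.
pose e (i : 'I_m) : S -> R := sbasis (enum_val i).
have se i : spoly n (e i) by exact: spoly_basis.
have be i : bnd (e i) := spoly_bnd (se i).
have spE p : spoly n p -> exists c : 'I_m -> R, p = fun x => \sum_i c i * e i x.
  move=> /spoly_spanned[c cE]; exists (fun i => c (enum_val i)); apply/funext => x.
  by rewrite cE (reindex _ (onW_bij _ (@enum_val_bij (exponent n)))).
have free (c : 'I_m -> R) : (forall x, \sum_i c i * e i x = 0) -> forall i, c i = 0.
  move=> c0 i; have := @sbasis_free R d n (fun al => c (enum_rank al)) _ (enum_val i).
  rewrite enum_valK; apply => x; rewrite -[RHS](c0 x).
  rewrite (reindex _ (onW_bij _ (@enum_val_bij (exponent n)))).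
  by apply: eq_bigr => j _; rewrite enum_valK.
pose G : 'M[R]_m := \matrix_(i, j) I (fun x => e i x * e j x).
have bee i j : bnd (fun x => e i x * e j x) by exact: bndM.
have Gu : G \in unitmx.
  rewrite -row_free_unit -kermx_eq0; apply/eqP/row_matrixP => i; rewrite row0.
  set u := row i _; have uG : u *m G = 0.
    by apply/sub_kermxP; exact: row_sub.
  pose p x := \sum_j u 0 j * e j x.
  have sp : spoly n p by apply: spoly_sum => j; exact: spoly_scale.
  have p0 : forall x, p x = 0.
    apply: (state_definite sI invI sp).
    transitivity ((u *m G *m u^T) 0 0); last by rewrite uG mul0mx mxE.
    rewrite (_ : (fun x => p x ^+ 2) = fun x => \sum_j \sum_k (u 0 k * u 0 j) * (e k x * e j x)); last first.
      apply/funext => x; rewrite expr2 /p mulr_sumr; apply: eq_bigr => j _.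
      by rewrite mulr_suml; apply: eq_bigr => k _; ring.
    rewrite (state_sum sI) => [|j]; last by apply: bnd_sum => k; exact: bndZ.
    rewrite mxE; apply: eq_bigr => j _; rewrite (state_sum sI) => [|k]; last exact: bndZ.
    by rewrite !mxE mulr_suml; apply: eq_bigr => k _; rewrite (stateZ sI)// !mxE; ring.
  by apply/matrixP => a j; rewrite (ord1 a) [RHS]mxE; exact: (free (fun j => u 0 j)).
have VG j k : \sum_i invmx G j i * G i k = (j == k)%:R.
  by have /matrixP/(_ j k) := mulVmx Gu; rewrite !mxE.
pose D x y := \sum_i (\sum_j e j x * invmx G j i) * e i y.
have sa i : spoly n (fun x => \sum_j e j x * invmx G j i).
  apply: spoly_sum => j; apply: spoly_ext (spoly_scale (invmx G j i) (se j)) => x.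
  by rewrite mulrC.
have sD x : spoly n (D x) by apply: spoly_sum => i; exact: spoly_scale.
have rep x p : spoly n p -> I (fun y => p y * D x y) = p x.
  move=> /spE[c ->].
  have -> : (fun y => (\sum_i c i * e i y) * D x y) =
      fun y => \sum_i \sum_k (c k * (\sum_j e j x * invmx G j i)) * (e i y * e k y).
    apply/funext => y; rewrite mulr_sumr; apply: eq_bigr => i _.
    by rewrite mulr_suml; apply: eq_bigr => k _; ring.
  rewrite (state_sum sI) => [|i]; last by apply: bnd_sum => k; exact: bndZ.
  transitivity (\sum_i \sum_k (c k * (\sum_j e j x * invmx G j i)) * G i k).
    apply: eq_bigr => i _; rewrite (state_sum sI) => [|k]; last exact: bndZ.
    by apply: eq_bigr => k _; rewrite (stateZ sI)// mxE.
  rewrite exchange_big/=; apply: eq_bigr => k _.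
  under eq_bigr do rewrite -mulrA mulr_suml.
  rewrite -mulr_sumr exchange_big/=; congr (_ * _).
  under eq_bigr do under eq_bigr do rewrite -mulrA.
  under eq_bigr do rewrite -mulr_sumr VG.
  by rewrite (bigD1 k)//= eqxx mulr1 big1 ?addr0// => j /negPf ->; rewrite mulr0.
have Dinv b v x y : D (refl b v x) (refl b v y) = D x y.
  apply/eqP; rewrite -subr_eq0; apply/eqP; move: y.
  pose F y := D (refl b v x) (refl b v y) - D x y.
  have sDr : spoly n (fun y => D (refl b v x) (refl b v y)).
    exact: (spoly_refl b v (sD (refl b v x))).
  have sF : spoly n F by exact: spoly_sub.
  apply: (state_definite sI invI sF).
  have -> : (fun y => F y ^+ 2) = fun y => F y * D (refl b v x) (refl b v y) - F y * D x y.
    by apply/funext => y; rewrite expr2 /F; ring.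
  have bF : bnd F := spoly_bnd sF.
  rewrite (stateB sI); [|exact: bndM (spoly_bnd sDr)|exact: bndM (spoly_bnd (sD x))].
  rewrite rep//; apply/eqP; rewrite subr_eq0; apply/eqP.
  have sFr : spoly n (F \o refl b v) by exact: spoly_refl.
  transitivity (I ((fun z => (F \o refl b v) z * D (refl b v x) z) \o refl b v)).
    by congr I; apply/funext => y /=; rewrite reflK.
  rewrite invI ?rep//= ?reflK//.
  by rewrite mul2n -addnn; exact: spoly_mul.
have Dxx x : D x x = m%:R.
  rewrite -(state_cst sI (D x x)).
  transitivity (I (fun y => D y y)).
    congr I; apply/funext => y; have [b [v <-]] := refl_transitive x y.
    by rewrite Dinv.
  have -> : (fun y => D y y) = fun y => \sum_i \sum_j invmx G j i * (e j y * e i y).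
    apply/funext => y; apply: eq_bigr => i _; rewrite mulr_suml.
    by apply: eq_bigr => j _; ring.
  rewrite (state_sum sI) => [|i]; last by apply: bnd_sum => k; exact: bndZ.
  transitivity (\sum_i \sum_j invmx G j i * G i j).
    apply: eq_bigr => i _; rewrite (state_sum sI) => [|k]; last exact: bndZ.
    apply: eq_bigr => k _; rewrite (stateZ sI)//; congr (_ * _); rewrite mxE.
    by congr I; apply/funext => y; exact: mulrC.
  rewrite exchange_big/=; under eq_bigr do rewrite VG eqxx.
  by rewrite sumr_const card_ord.
exists D; split=> //.
by exists (fun i x => \sum_j e j x * invmx G j i), e.
Qed.

End kernel.

(** * Comparison of dimensions *)

Section dimension.
Context {d : nat}.

Lemma ndim_gt0 n : (0 < ndim (d := d) n)%N.
Proof.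
pose z : 'I_2 * {ffun 'I_d -> 'I_n.+1} := (ord0, [ffun=> ord0]).
have h : (z.1 + \sum_i z.2 i <= n)%N by rewrite /= big1// => i _; rewrite ffunE.
by apply/card_gt0P; exists (exist (fun e : 'I_2 * {ffun 'I_d -> 'I_n.+1} =>
  (e.1 + \sum_i e.2 i <= n)%N) z h).
Qed.

(* An exponent is determined by its quotient and its remainder modulo [s]. *)
Lemma leq_ndim s a b : (a < s * b.+1)%N ->
  (ndim (d := d) a <= 2 * s ^ d * ndim (d := d) b)%N.
Proof.
move=> asb; have s0 : (0 < s)%N by case: s asb.
have small (al : exponent (d := d) a) : (\sum_i (val al).2 i %/ s <= b)%N.
  have h : (\sum_i (val al).2 i <= a)%N by exact: leq_trans (leq_addl _ _) (valP al).
  rewrite -ltnS -(ltn_pmul2l s0); apply: leq_ltn_trans asb; apply: leq_trans h.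
  by rewrite big_distrr/=; apply: leq_sum => i _; rewrite mulnC leq_trunc_div.
have small1 (al : exponent (d := d) a) i : ((val al).2 i %/ s < b.+1)%N.
  by rewrite ltnS (leq_trans _ (small al))// (bigD1 i)//= leq_addr.
pose quo al : 'I_2 * {ffun 'I_d -> 'I_b.+1} := (ord0, [ffun i => Ordinal (small1 al i)]).
have quoP al : ((quo al).1 + \sum_i (quo al).2 i <= b)%N.
  by rewrite /= (eq_bigr (fun i => (val al).2 i %/ s)%N) ?small// => i _; rewrite ffunE.
pose f (al : exponent (d := d) a) : ('I_2 * {ffun 'I_d -> 'I_s}) * exponent (d := d) b :=
  (((val al).1, [ffun i => Ordinal (ltn_pmod ((val al).2 i) s0)]),
   exist (fun e : 'I_2 * {ffun 'I_d -> 'I_b.+1} => (e.1 + \sum_i e.2 i <= b)%N) _ (quoP al)).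
have fi : injective f.
  move=> al be []; move=> h1 h2 h3; apply/val_inj.
  have {}h1 : (val al).1 = (val be).1 := h1.
  case E : (val al) h1 => [x e]; case E' : (val be) => [x' e'] /= ->; congr (_, _).
  apply/ffunP => i; apply/val_inj => /=.
  have := congr1 (fun g : {ffun 'I_d -> 'I_s} => g i : nat) h2.
  have := congr1 (fun g : {ffun 'I_d -> 'I_b.+1} => g i : nat) h3.
  rewrite !ffunE /= => q r.
  have Ei : (val al).2 i = e i by rewrite E.
  have Ei' : (val be).2 i = e' i by rewrite E'.
  by rewrite -Ei -Ei' (divn_eq ((val al).2 i) s) (divn_eq ((val be).2 i) s) q r.
by have := leq_card f fi; rewrite !card_prod card_ffun !card_ord.
Qed.

Lemma ndim_le m n : (m <= n)%N -> (ndim (d := d) m <= ndim (d := d) n)%N.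
Proof.
move=> mn; have mn1 : (m.+1 <= n.+1)%N by [].
pose up (e : 'I_2 * {ffun 'I_d -> 'I_m.+1}) : 'I_2 * {ffun 'I_d -> 'I_n.+1} :=
  (e.1, [ffun i => widen_ord mn1 (e.2 i)]).
have upP (al : exponent (d := d) m) : ((up (val al)).1 + \sum_i (up (val al)).2 i <= n)%N.
  apply: leq_trans (leq_trans (valP al) mn).
  by rewrite leq_add2l (eq_bigr (fun i => (val al).2 i : nat))// => i _; rewrite ffunE.
pose f al : exponent (d := d) n := exist (fun e : 'I_2 * {ffun 'I_d -> 'I_n.+1} => (e.1 + \sum_i e.2 i <= n)%N) _ (upP al).
apply: (@leq_card _ _ f) => al be []; move=> h1 h2; apply/val_inj.
have {}h1 : (val al).1 = (val be).1 := h1.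
case E : (val al) h1 => [x e]; case E' : (val be) => [x' e'] /= ->; congr (_, _).
apply/ffunP => i; apply/val_inj => /=.
have := congr1 (fun g : {ffun 'I_d -> 'I_n.+1} => g i : nat) h2.
rewrite !ffunE /= => q.
have Ei : (val al).2 i = e i by rewrite E.
have Ei' : (val be).2 i = e' i by rewrite E'.
by rewrite -Ei -Ei'.
Qed.

End dimension.

(** * Operators with polynomial kernels *)

Section separable.
Context {R : realType} {d : nat}.
Local Notation S := (sphere R d).
Local Notation C := (csphere R d).
Implicit Types (f g : S -> R) (K : S -> S -> R) (x y : S).

(** The degree concerns the first variable only, which governs the range of the operator; in the
    second, boundedness lets a [state] be applied. *)
Inductive sep : nat -> (S -> S -> R) -> Prop :=
| sep_prod n f g : spoly n f -> bnd g -> sep n (fun x y => f x * g y)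
| sep_add n K K' : sep n K -> sep n K' -> sep n (fun x y => K x y + K' x y).

Lemma sep_ext n K K' : (forall x y, K x y = K' x y) -> sep n K -> sep n K'.
Proof. by move=> KK; have -> : K = K' by apply/funext => x; apply/funext => y. Qed.

Lemma sep_le m n K : (m <= n)%N -> sep m K -> sep n K.
Proof.
move=> + sK; elim: sK n => {m K}[m f g sf bg n mn|m K K' _ IH _ IH' n mn].
  by apply: sep_prod => //; exact: spoly_le sf.
by apply: sep_add; [exact: IH|exact: IH'].
Qed.

Lemma sep_sum n (T : Type) (r : seq T) (F : T -> S -> S -> R) :
  (forall i, sep n (F i)) -> sep n (fun x y => \sum_(i <- r) F i x y).
Proof.
move=> sF; elim: r => [|i r IHr].
  apply: sep_ext (sep_prod (spoly_cst n 0) (bnd_cst 0)) => x y.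
  by rewrite big_nil mul0r.
by apply: sep_ext (sep_add (sF i) IHr) => x y; rewrite big_cons.
Qed.

Lemma sep_scale n c K : sep n K -> sep n (fun x y => c * K x y).
Proof.
elim=> {n K}[n f g sf bg|n K K' _ IH _ IH'].
  by apply: sep_ext (sep_prod (spoly_scale c sf) bg) => x y; rewrite mulrA.
by apply: sep_ext (sep_add IH IH') => x y; rewrite mulrDr.
Qed.

Lemma sep_mul m n K K' : sep m K -> sep n K' -> sep (m + n) (fun x y => K x y * K' x y).
Proof.
move=> sK sK'; elim: sK => {m K}[m f g sf bg|m K1 K2 _ IH1 _ IH2]; last first.
  by apply: sep_ext (sep_add IH1 IH2) => x y; rewrite mulrDl.
elim: sK' => {n K'}[n f' g' sf' bg'|n K1 K2 _ IH1 _ IH2]; last first.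
  by apply: sep_ext (sep_add IH1 IH2) => x y; rewrite mulrDr.
apply: sep_ext (sep_prod (spoly_mul sf sf') (bndM bg bg')) => x y; ring.
Qed.

Lemma sep_bnd n K x : sep n K -> bnd (K x).
Proof.
elim=> {n K}[n f g sf bg|n K K' _ IH _ IH']; first exact: bndZ.
exact: bndD.
Qed.

Lemma csphere_bnd (f : C) : bnd f.
Proof. by exists (unif_norm f) => x; exact: ler_unif_norm. Qed.

(** For a finitely additive mean, continuity in [x] of the averaged kernel is not automatic; taking
    the polynomial factors out of the mean shows that the result is a polynomial. *)
Lemma sep_operator (I : (S -> R) -> R) n K : state I -> sep n K ->
  exists A : {linear C -> C}, (forall (f : C) x, A f x = I (fun y => f y * K x y)) /\
    forall f : C, spoly n (A f).
Proof.
move=> sI sK; have [F [FE sF]] : exists F : C -> C,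
    (forall (f : C) x, F f x = I (fun y => f y * K x y)) /\ forall f : C, spoly n (F f).
  elim: sK => {n K}[n a e sa be|n K K' sK [F [FE sF]] sK' [F' [FE' sF']]].
    have [g gE] := csphere_of_spoly sa.
    exists (fun f : C => I (fun y => f y * e y) *: g); split=> [f x|f].
      rewrite csphere_scaleE gE mulrC -(stateZ sI); last by apply: bndM => //; exact: csphere_bnd.
      by congr I; apply/funext => y; ring.
    by apply: spoly_ext (spoly_scale (I (fun y => f y * e y)) sa) => x; rewrite csphere_scaleE gE.
  exists (fun f : C => F f + F' f); split=> [f x|f].
    rewrite csphere_addE FE FE' -(stateD sI).
    - by congr I; apply/funext => y; ring.
    - by apply: bndM (csphere_bnd f) _; exact: sep_bnd sK.
    - by apply: bndM (csphere_bnd f) _; exact: sep_bnd sK'.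
  exact: spoly_add (sF f) (sF' f).
have linF : linear F.
  move=> c f g; apply: csphereP => x; rewrite csphere_addE csphere_scaleE !FE.
  have bK := sep_bnd x sK.
  have bfK := bndM (csphere_bnd f) bK; have bgK := bndM (csphere_bnd g) bK.
  rewrite -(stateZ sI)// -(stateD sI)//; last exact: bndZ.
  by congr I; apply/funext => y; rewrite csphere_addE csphere_scaleE; ring.
pose A : {linear C -> C} := HB.pack F (GRing.isLinear.Build R C C *:%R F linF).
by exists A.
Qed.

End separable.

(** * De la Vallee Poussin and Jackson operators *)

Section operators.
Context {R : realType} {d : nat}.
Local Notation S := (sphere R d).
Local Notation C := (csphere R d).
Implicit Types (x y : S).
Local Notation delta n := ((ndim (d := d) n)%:R : R).

Variables (I : (S -> R) -> R) (sI : state I).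

Lemma reproducing_sep n (D : S -> S -> R) : reproducing I n D -> sep n D.
Proof.
move=> [_ _ _ _ [a [e [sa se DE]]]].
apply: (@sep_ext _ _ _ (fun x y => \sum_i a i x * e i y)) => [x y|]; first by rewrite DE.
by apply: sep_sum => i; apply: sep_prod (sa i) (spoly_bnd (se i)).
Qed.

Lemma delta_gt0 n : 0 < delta n.
Proof. by rewrite ltr0n ndim_gt0. Qed.

Lemma state_abs_le f g : bnd f -> bnd g -> (forall x : S, `|f x| <= g x) -> `|I f| <= I g.
Proof.
move=> bf bg fg; rewrite ler_norml; apply/andP; split.
  rewrite lerNl -mulN1r -(stateZ sI)//; apply: (state_le sI) => // [|y]; first exact: bndZ.
  by rewrite mulN1r; have := fg y; rewrite ler_norml => /andP[+ _]; rewrite lerNl.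
by apply: (state_le sI) => // y; have := fg y; rewrite ler_norml => /andP[].
Qed.

Lemma sum_geq_ord n h : (\sum_(i < n) (h <= i)%N = n - h)%N.
Proof.
elim: n => [|n IHn]; first by rewrite big_ord0.
by rewrite big_ord_recr/= IHn; lia.
Qed.

(* The operator has kernel [Da Db / Db(x,x)], bounded via
   [2 |Da Db| <= Da^2 + Db^2]. *)
Lemma vallee_poussin (L a b : nat) (Da Db : S -> S -> R) : (L + b <= a)%N ->
  reproducing I a Da -> reproducing I b Db ->
  exists V : {linear C -> C},
    [/\ forall f : C, spoly (a + b) (V f),
        forall p : C, spoly L p -> V p = p &
        forall (f : C) (F : R) x, (forall y, `|f y| <= F) ->
          `|V f x| <= F * ((delta a / delta b + 1) / 2)].
Proof.
move=> Lba rDa rDb; have [sDa repa Daa _ _] := rDa; have [sDb repb Dbb _ _] := rDb.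
have b0 := delta_gt0 b; have bn0 : delta b != 0 by rewrite gt_eqF.
have sK := sep_scale (delta b)^-1 (sep_mul (reproducing_sep rDa) (reproducing_sep rDb)).
have [V [VE sV]] := sep_operator sI sK.
exists V; split=> // [p sp|f F x fF].
  apply: csphereP => x; rewrite VE.
  (* The degree is at most [L + b <= a], so [Da] reproduces this function, whose value at [x] is
     [p x]. *)
  have sq : spoly a (fun y => p y * ((delta b)^-1 * Db x y)).
    by apply: spoly_le Lba _; apply: spoly_mul => //; exact: spoly_scale.
  transitivity (I (fun y => p y * ((delta b)^-1 * Db x y) * Da x y)).
    by congr I; apply/funext => y; ring.
  by rewrite (repa _ _ sq) Dbb mulVf ?mulr1.
have F0 : 0 <= F by rewrite (le_trans (normr_ge0 _) (fF x)).
have bDa : bnd (Da x) := spoly_bnd (sDa x); have bDb : bnd (Db x) := spoly_bnd (sDb x).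
have bf := csphere_bnd f.
pose G y := F * (delta b)^-1 / 2 * (Da x y * Da x y + Db x y * Db x y).
have bG : bnd G by apply/bndZ/bndD; exact: bndM.
have IG : I G = F * ((delta a / delta b + 1) / 2).
  rewrite (stateZ sI); last by apply: bndD; exact: bndM.
  by rewrite (stateD sI) ?(repa _ _ (sDa x)) ?(repb _ _ (sDb x)) ?Daa ?Dbb; [field|exact: bndM..].
have fG y : `|f y * ((delta b)^-1 * (Da x y * Db x y))| <= G y.
  rewrite normrM normrM (gtr0_norm (_ : 0 < (delta b)^-1)) ?invr_gt0//.
  have h : `|Da x y * Db x y| <= (Da x y * Da x y + Db x y * Db x y) / 2.
    rewrite ler_norml; have := sqr_ge0 (Da x y - Db x y); have := sqr_ge0 (Da x y + Db x y).
    by move=> h1 h2; apply/andP; split; lra.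
  have -> : G y = F * ((delta b)^-1 * ((Da x y * Da x y + Db x y * Db x y) / 2)).
    by rewrite /G; ring.
  have V0 : 0 <= (delta b)^-1 by rewrite invr_ge0 ltW.
  by apply: ler_pM; rewrite ?mulr_ge0 ?ler_wpM2l.
have bK : bnd (fun y => f y * ((delta b)^-1 * (Da x y * Db x y))).
  by apply/bndM => //; apply/bndZ/bndM.
by rewrite VE -IG; exact: state_abs_le.
Qed.

(* The operator averages against [q^2] for [q] the sum of the reproducing kernels
   [D_j].  Since [(1 - x.y) D_i] has degree [i + 1], only the diagonal terms of
   the first moment of [q^2] survive, and they telescope. *)
Lemma jackson (m n : nat) (D : nat -> S -> S -> R) :
  (forall j, (j <= n)%N -> reproducing I j (D j)) -> refl_invariant m I ->
  exists J : {linear C -> C},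
    [/\ forall f : C, spoly (n + n) (J f),
        forall (f : C) (F : R) x, (forall y, `|f y| <= F) -> `|J f x| <= F &
        forall (p : C) M (B : R) x, (0 < M)%N -> (M + (n + n) <= m)%N -> spoly M p ->
          (forall y, `|p y| <= B) ->
          `|J p x - p x| <= 16 * M%:R ^+ 2 * B *
              (8 * delta n / (n.+1%:R ^+ 2 * delta n./2))].
Proof.
move=> rD invI.
pose q x y := \sum_(j < n.+1) D j x y.
have lej (j : 'I_n.+1) : (j <= n)%N by rewrite -ltnS.
have rDj (j : 'I_n.+1) : reproducing I j (D j) by exact: rD.
have sDn (j : 'I_n.+1) x : spoly n (D j x) by have [s _ _ _ _] := rDj j; exact: spoly_le (s x).
have sq x : spoly n (q x) by apply: spoly_sum => j.
have sepq : sep n q.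
  by apply: sep_sum => j; exact: sep_le (lej j) (reproducing_sep (rDj j)).
have bD (j : 'I_n.+1) x : bnd (D j x) := spoly_bnd (sDn j x).
have bq x : bnd (q x) := spoly_bnd (sq x).
have bq2 x : bnd (fun y => q x y * q x y) by exact: bndM.
have IDD (i j : 'I_n.+1) x : I (fun y => D i x y * D j x y) = delta (minn i j).
  wlog ij : i j / (i <= j)%N => [hw|].
    have /orP[ij|ji] := leq_total i j; first exact: hw.
    by rewrite minnC -(hw _ _ ji); congr I; apply/funext => y; exact: mulrC.
  rewrite (minn_idPl ij); have [_ rep _ _ _] := rDj j; have [si _ Dii _ _] := rDj i.
  by rewrite rep ?Dii//; exact: spoly_le ij (si x).
pose Q : R := \sum_(i < n.+1) \sum_(j < n.+1) delta (minn i j).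
have sum_qq (w : S -> R) x : bnd w -> I (fun y => w y * (q x y * q x y)) =
    \sum_(i < n.+1) \sum_(j < n.+1) I (fun y => w y * (D i x y * D j x y)).
  move=> bw.
  have -> : (fun y => w y * (q x y * q x y)) =
      fun y => \sum_(i < n.+1) \sum_(j < n.+1) w y * (D i x y * D j x y).
    apply/funext => y; rewrite mulr_suml mulr_sumr; apply: eq_bigr => i _.
    by rewrite !mulr_sumr.
  rewrite (state_sum sI) => [|i]; last by apply: bnd_sum => j; exact/bndM/bndM.
  by apply: eq_bigr => i _; rewrite (state_sum sI)// => j; exact/bndM/bndM.
have IQ x : I (fun y => q x y * q x y) = Q.
  have -> : (fun y => q x y * q x y) = fun y => 1 * (q x y * q x y).
    by apply/funext => y; rewrite mul1r.
  rewrite sum_qq; last exact: bnd_cst.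
  apply: eq_bigr => i _; apply: eq_bigr => j _; rewrite -(IDD i j x).
  by congr I; apply/funext => y; rewrite mul1r.
(* At least half of the indices are at least [n./2], and [delta] is nondecreasing. *)
have Qge : n.+1%:R ^+ 2 * delta n./2 <= 4 * Q.
  pose c : R := (\sum_(i < n.+1) (n./2 <= i)%N)%:R.
  have cn : n.+1%:R <= 2 * c.
    by rewrite /c -natrM ler_nat sum_geq_ord; have := odd_double_half n; lia.
  have cQ : c * c * delta n./2 <= Q.
    rewrite /c natr_sum !mulr_suml; apply: ler_sum => i _.
    rewrite mulr_sumr mulr_suml; apply: ler_sum => j _.
    have [hi|hi] := leqP n./2 i; last by rewrite !mul0r ltW ?delta_gt0.
    have [hj|hj] := leqP n./2 j; last by rewrite mulr0 mul0r ltW ?delta_gt0.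
    by rewrite !mul1r ler_nat ndim_le// leq_min hi.
  apply: (@le_trans _ _ (4 * (c * c * delta n./2))); last by rewrite ler_wpM2l.
  have -> : 4 * (c * c * delta n./2) = (2 * c) ^+ 2 * delta n./2 by ring.
  by rewrite ler_wpM2r ?(ltW (delta_gt0 _))// lerXn2r ?nnegrE// mulr_ge0 ?ler0n.
have Q0 : 0 < Q.
  rewrite -(pmulr_rgt0 _ (_ : 0 < 4))//; apply: lt_le_trans Qge.
  by rewrite mulr_gt0 ?exprn_gt0 ?delta_gt0.
have E x : I (fun y => (1 - dot x y) * (q x y * q x y)) <= 2 * delta n.
  pose w y := 1 - dot x y.
  have sw : spoly 1 w by exact: spoly_sub (spoly_cst _ _) (spoly_dot x).
  have bw : bnd w := spoly_bnd sw.
  have w0 y : 0 <= w y by rewrite subr_ge0 dot_le1.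
  have w2 y : w y <= 2 by rewrite /w; have := dot_geN1 x y; lra.
  rewrite (sum_qq w x bw).
  have off (i j : 'I_n.+1) : (i < j)%N -> I (fun y => w y * (D i x y * D j x y)) = 0.
    move=> ij; have [_ rep _ _ _] := rDj j; have [si _ _ _ _] := rDj i.
    have swD : spoly j (fun y => w y * D i x y).
      by apply: (@spoly_le _ _ (1 + i)) => //; exact: spoly_mul sw (si x).
    transitivity (I (fun y => w y * D i x y * D j x y)).
      by congr I; apply/funext => y; rewrite mulrA.
    by rewrite (rep _ _ swD) /w dotxx subrr mul0r.
  have -> : \sum_(i < n.+1) \sum_(j < n.+1) I (fun y => w y * (D i x y * D j x y)) =
      \sum_(i < n.+1) I (fun y => w y * (D i x y * D i x y)).
    apply: eq_bigr => i _; rewrite (bigD1 i)//= big1 ?addr0// => j ji.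
    have [ij|ij] : (i < j)%N \/ (j < i)%N.
      by apply/orP; rewrite -neq_ltn eq_sym.
    - exact: off.
    - by rewrite -(off j i ij); congr I; apply/funext => y; congr (_ * _); exact: mulrC.
  pose g j := I (fun y => w y * (D j x y * D j x y)).
  have bwD (i j : 'I_n.+1) : bnd (fun y => w y * (D i x y * D j x y)) by exact/bndM/bndM.
  have g2 (Z : S -> R) : bnd Z -> I (fun y => w y * (Z y * Z y)) <= 2 * I (fun y => Z y * Z y).
    move=> bZ; rewrite -(stateZ sI); last exact: bndM.
    apply: (state_le sI) => [||y]; [exact/bndM/bndM|exact/bndZ/bndM|].
    by rewrite ler_wpM2r// -expr2 sqr_ge0.
  have g_ge0 (i : 'I_n.+1) : 0 <= g i.
    by apply: (state_ge0 sI) => // y; rewrite mulr_ge0// -expr2 sqr_ge0.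
  suff H k : (k <= n)%N -> \sum_(i < k.+1) g i <= 2 * delta k by exact: H.
  elim: k => [_|k IHk kn].
    rewrite big_ord_recl big_ord0 addr0; apply: le_trans (g2 _ (bD ord0 x)) _.
    by rewrite (IDD ord0 ord0 x).
  rewrite big_ord_recr/=.
  have kn1 : (k.+1 < n.+1)%N by []. have kn0 : (k < n.+1)%N by exact: ltnW.
  pose i := Ordinal kn0; pose j := Ordinal kn1.
  (* The cross term vanishes, so [g i + g j] is the moment of [(D_j - D_i)^2], at most
     [2 (delta_j - delta_i)] because [1 - x.y <= 2]; these bounds telescope. *)
  have gj : g j = I (fun y => w y * ((D j x y - D i x y) * (D j x y - D i x y))) - g i.
    have ij : (i < j)%N by rewrite /=.
    have -> : (fun y => w y * ((D j x y - D i x y) * (D j x y - D i x y))) =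
       fun y => w y * (D j x y * D j x y) + w y * (D i x y * D i x y)
         - 2 * (w y * (D i x y * D j x y)) by apply/funext => y; ring.
    rewrite (stateB sI) ?(stateD sI) ?(stateZ sI)//; [|exact: bndD|exact: bndZ].
    by rewrite (off i j ij) -/(g j) -/(g i); ring.
  have bZ : bnd (fun y => D j x y - D i x y) by apply: spoly_bnd; exact: spoly_sub (sDn j x) (sDn i x).
  have IZ : I (fun y => (D j x y - D i x y) * (D j x y - D i x y)) = delta k.+1 - delta k.
    have bDD (i' j' : 'I_n.+1) : bnd (fun y => D i' x y * D j' x y) by exact: bndM.
    have -> : (fun y => (D j x y - D i x y) * (D j x y - D i x y)) =
       fun y => D j x y * D j x y + D i x y * D i x y - 2 * (D i x y * D j x y).
       by apply/funext => y; ring.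
    rewrite (stateB sI) ?(stateD sI) ?(stateZ sI)//; [|exact: bndD|exact: bndZ].
    by rewrite !IDD !minnn (minn_idPl (leqnSn k)); ring.
  have := g2 _ bZ; rewrite IZ => gZ.
  have := IHk (ltnW kn); have := g_ge0 i; move: gj; rewrite /= => gj.
  rewrite -/(g k.+1) gj; lra.
(* The half-turn about [x] fixes [x], so invariance makes the kernel symmetric about [x]. *)
have Dinv (j : 'I_n.+1) x y : D j x (refl true x y) = D j x y.
  have [_ _ _ inv _] := rDj j; rewrite -[RHS](inv true x).
  by congr D; apply: coor_inj => i; rewrite coor_refl dotxx expr1; ring.
have qinv x y : q x (refl true x y) = q x y by apply: eq_bigr => j _; exact: Dinv.
have [J [JE sJ]] := sep_operator sI (sep_scale Q^-1 (sep_mul sepq sepq)).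
have qq0 x y : 0 <= Q^-1 * (q x y * q x y).
  by rewrite mulr_ge0 ?invr_ge0 ?(ltW Q0)// -expr2 sqr_ge0.
have IK x : I (fun y => Q^-1 * (q x y * q x y)) = 1.
  by rewrite (stateZ sI)// IQ mulVf// gt_eqF.
have bK x : bnd (fun y => Q^-1 * (q x y * q x y)) by exact: bndZ.
exists J; split=> // [f F x fF|p M B x M0 Mm sp pB].
  have bf := csphere_bnd f.
  have -> : F = I (fun y => F * (Q^-1 * (q x y * q x y))) by rewrite (stateZ sI)// IK mulr1.
  rewrite JE ler_norml; apply/andP; split.
    rewrite lerNl -mulN1r -(stateZ sI); last exact: bndM.
    apply: (state_le sI); [exact/bndZ/bndM|exact: bndZ|move=> y].
    rewrite mulrA ler_wpM2r// mulN1r; have := fF y; rewrite ler_norml => /andP[+ _].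
    by rewrite lerNl.
  apply: (state_le sI); [exact: bndM|exact: bndZ|move=> y].
  by rewrite ler_wpM2r//; have := fF y; rewrite ler_norml => /andP[].
have bp : bnd p := spoly_bnd sp.
have spr := spoly_refl true x sp.
have bpr : bnd (p \o refl true x) := spoly_bnd spr.
(* By this symmetry [p] may be averaged with its half-turned copy, after which
   [spoly_second_difference] applies. *)
have JpE : J p x = I (fun y => (p y + p (refl true x y)) / 2 * (Q^-1 * (q x y * q x y))).
  have h : I (fun y => p (refl true x y) * (Q^-1 * (q x y * q x y))) = J p x.
    rewrite JE -(invI true x (fun y => p y * (Q^-1 * (q x y * q x y)))).
      by congr I; apply/funext => y /=; rewrite !qinv.
    apply: spoly_le Mm _; apply: spoly_mul => //; apply: spoly_scale.
    by apply: spoly_mul.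
  have -> : (fun y => (p y + p (refl true x y)) / 2 * (Q^-1 * (q x y * q x y))) =
     fun y => 2^-1 * (p y * (Q^-1 * (q x y * q x y))) +
       2^-1 * (p (refl true x y) * (Q^-1 * (q x y * q x y))).
    by apply/funext => y; field; rewrite gt_eqF.
  have b1 : bnd (fun y => p y * (Q^-1 * (q x y * q x y))) by exact: bndM.
  have b2 : bnd (fun y => p (refl true x y) * (Q^-1 * (q x y * q x y))) by exact: bndM bpr (bK x).
  rewrite (stateD sI); [|exact: bndZ|exact: bndZ].
  by rewrite !(stateZ sI)// h -JE; field.
pose A := 16 * M%:R ^+ 2 * B.
have B0 : 0 <= B by rewrite (le_trans (normr_ge0 _) (pB x)).
have A0 : 0 <= A by rewrite !mulr_ge0// sqr_ge0.
pose w y := (p y + p (refl true x y)) / 2 - p x.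
have bw : bnd w.
  have -> : w = fun y => 2^-1 * (p y + p (refl true x y)) + - p x.
    by apply/funext => y; rewrite /w; field.
  by apply: bndD (bnd_cst _); apply/bndZ/bndD.
have wA y : `|w y| <= A * (1 - dot x y) by exact: spoly_second_difference.
have bdot : bnd (fun y => 1 - dot x y).
  by apply: (spoly_bnd (n := 1)); apply: spoly_sub (spoly_cst _ _) (spoly_dot x).
have -> : J p x - p x = I (fun y => w y * (Q^-1 * (q x y * q x y))).
  have pxE : p x = I (fun y => p x * (Q^-1 * (q x y * q x y))).
    by rewrite (stateZ sI)// IK mulr1.
  rewrite JpE [X in _ - X]pxE -(stateB sI); last exact: bndZ.
    by congr I; apply/funext => y; rewrite /w mulrBl.
  by apply: bndM (bK x); under eq_fun do rewrite mulrC; exact/bndZ/bndD.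
apply: (@le_trans _ _ (I (fun y => A * Q^-1 * ((1 - dot x y) * (q x y * q x y))))).
  apply: state_abs_le => [||y]; [exact: bndM|exact/bndZ/bndM|].
  rewrite normrM (ger0_norm (qq0 x y)).
  have -> : A * Q^-1 * ((1 - dot x y) * (q x y * q x y)) =
    A * (1 - dot x y) * (Q^-1 * (q x y * q x y)) by ring.
  by rewrite ler_wpM2r.
rewrite (stateZ sI); last exact: bndM.
have -> : 16 * M%:R ^+ 2 * B * (8 * delta n / (n.+1%:R ^+ 2 * delta n./2)) =
  A * ((8 * delta n / (n.+1%:R ^+ 2 * delta n./2))) by [].
(* The first moment is at most [2 delta_n], and it is divided by [Q >= (n + 1)^2 delta_(n/2) / 4];
   hence the 8. *)
rewrite -mulrA ler_wpM2l// ler_pdivlMr; last by rewrite mulr_gt0 ?exprn_gt0 ?delta_gt0.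
apply: (@le_trans _ _ (Q^-1 * (2 * delta n) * (4 * Q))).
  apply: ler_pM => //.
  - rewrite mulr_ge0 ?invr_ge0 ?(ltW Q0)//; apply: (state_ge0 sI); first exact: bndM.
    by move=> y; rewrite mulr_ge0 ?subr_ge0 ?dot_le1// -expr2 sqr_ge0.
  - by rewrite ler_wpM2l ?invr_ge0 ?(ltW Q0).
by rewrite le_eqVlt; apply/orP; left; apply/eqP; field; rewrite gt_eqF.
Qed.

End operators.

(** * An admissible operator of norm close to 1 *)

Section upper_bound.
Context {R : realType} {d : nat}.
Local Notation S := (sphere R d).
Local Notation C := (csphere R d).
Local Notation delta n := ((ndim (d := d) n)%:R : R).

Lemma refl_invariant_le (I : (S -> R) -> R) m n : (m <= n)%N ->
  refl_invariant n I -> refl_invariant m I.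
Proof. by move=> mn h b v f sf; apply: h; exact: spoly_le sf. Qed.

Lemma linear_bounded_near (A : {linear C -> C}) (K : R) :
  (forall (f : C) (F : R) x, (forall y, `|f y| <= F) -> `|A f x| <= F * K) ->
  bounded_near A (nbhs (0 : C)).
Proof.
move=> AK; apply/linear_boundedP; near=> r => f.
apply: (@le_trans _ _ (`|f| * K)).
  by apply: unif_norm_le => x; apply: AK => y; exact: ler_unif_norm.
by rewrite mulrC ler_wpM2r// ltW//; near: r; exact: nbhs_pinfty_gt.
Unshelve. all: end_near.
Qed.

Lemma ratio_bound s a b : (a < s * b.+1)%N -> delta a <= 2 * s%:R ^+ d * delta b.
Proof. by move=> /leq_ndim h; rewrite -natrX -!natrM ler_nat. Qed.

(* The operator is [J + V - J V], which equals [J] up to the error of [J] on the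
   range of [V]. *)
Lemma upper_operator (kappa : R) : (1 <= d)%N -> 0 < kappa -> kappa < 1 ->
  exists K : R, forall L N : nat, (1 <= L)%N -> L%:R <= kappa * N%:R ->
    exists A : {linear C -> C}, admissible L N A /\
      forall (f : C) (F : R) x, (forall y, `|f y| <= F) ->
        `|A f x| <= F * (1 + K * (L%:R / N.+1%:R) ^+ 2).
Proof.
move=> d1 k0 k1.
(* Chosen to have [a < s (b + 1)] below: either [b = L], or [b + 1 >= (1 - kappa) N / 2] and so
   [L < t (b + 1)]. Through [ratio_bound] this bounds the norm of [V] by [V0]. *)
pose t := Num.bound (2 / (1 - kappa)); pose s := t.+2.
have k1' : 0 < 1 - kappa by rewrite subr_gt0.
have tP : 2 / (1 - kappa) < t%:R by apply: archi_boundP; rewrite divr_ge0// ltW.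
pose V0 : R := (2 * s%:R ^+ d + 1) / 2.
(* The 16 comes from the second difference, the 9 from [a + b <= 3 L], and [64 * 2 ^+ d] from the
   Jackson moment with [n = N./2]. *)
exists (16 * 9 * 64 * 2 ^+ d * V0) => L N L1 LN.
have N0 : (0 < N)%N.
  rewrite lt0n; apply: contraTN LN => /eqP ->.
  by rewrite mulr0 -ltNge ltr0n.
have LltN : (L < N)%N.
  by rewrite -(ltr_nat R) (le_lt_trans LN)// gtr_pMl ?ltr0n.
(* As [V] has degree [a + b = L + 2 b], the bound [b <= (N - L) / 2] keeps it below [N] or equal,
   and [b <= L] makes it [O(L)]; otherwise [b] is as large as possible, for the norm of [V]. *)
pose n := N./2; pose b := minn L ((N - L)./2); pose a := (L + b)%N.
have hN := odd_double_half N; have hNL := odd_double_half (N - L).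
have bL : (b <= L)%N by exact: geq_minl.
have bNL : (b <= (N - L)./2)%N by exact: geq_minr.
have abN : (a + b <= N)%N by rewrite /a; lia.
have ab3 : (a + b <= 3 * L)%N by rewrite /a; lia.
have asb : (a < s * b.+1)%N.
  have [bE|bE] : b = L \/ b = ((N - L)./2)%N by rewrite /b; lia.
    by rewrite /a bE /s; nia.
  have : (L < t * b.+1)%N.
    rewrite -(ltr_nat R) natrM.
    have h1 : (N - L)%:R <= 2 * b.+1%:R :> R by rewrite -natrM ler_nat; lia.
    have h2 : (1 - kappa) * N%:R <= (N - L)%:R by rewrite natrB 1?ltnW// ; lra.
    apply: (@le_lt_trans _ _ (2 / (1 - kappa) * b.+1%:R)); last by rewrite ltr_pM2r ?ltr0n.
    rewrite mulrAC ler_pdivlMr//; apply: le_trans h1; apply: le_trans h2.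
    by rewrite mulrC ler_wpM2l ?(ltW k1')// ler_nat ltnW.
  by rewrite /a /s; nia.
(* Degree [4 N] covers the products of two polynomials behind the kernels up to degree [N], and
   [V f] times the Jackson kernel. *)
have [I sI inv] := @invariant_state R d (4 * N).
have rk j : (j <= N)%N -> exists D, reproducing I j D.
  move=> jN; apply: (reproducing_kernel sI); apply: refl_invariant_le inv; lia.
(* The kernels must form a total sequence; above [N] it takes the default 0. *)
have H j : exists D, (j <= N)%N -> reproducing I j D.
  have [/rk[D rD]|jN] := leqP j N; first by exists D.
  by exists (fun _ _ => 0).
have [D rD] := choice H.
have nN : (n <= N)%N by rewrite /n; lia.
have aN : (a <= N)%N by lia.
have bN : (b <= N)%N by lia.
have [V [sV VL Vb]] := vallee_poussin sI (leqnn a) (rD a aN) (rD b bN).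
have [J [sJ Jb JM]] := jackson sI (fun j jn => rD j (leq_trans jn nN)) inv.
pose G f : C := J f + V f - J (V f).
have linG : linear G.
  move=> c f g; rewrite /G !linearP; apply: csphereP => x.
  have E (h k : C) : (h - k) x = h x - k x by [].
  rewrite !(csphere_addE, csphere_scaleE, E); ring.
pose A : {linear C -> C} := HB.pack G (GRing.isLinear.Build R C C *:%R G linG).
have V0b : (delta a / delta b + 1) / 2 <= V0.
  by rewrite ler_wpM2r// lerD2r ler_pdivrMr ?delta_gt0// ratio_bound.
have AK (f : C) (F : R) x : (forall y, `|f y| <= F) ->
    `|A f x| <= F * (1 + 16 * 9 * 64 * 2 ^+ d * V0 * (L%:R / N.+1%:R) ^+ 2).
  move=> fF; have F0 : 0 <= F by rewrite (le_trans (normr_ge0 _) (fF x)).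
  have Vf y : `|V f y| <= F * V0.
    by apply: le_trans (Vb f F y fF) _; rewrite ler_wpM2l.
  have FV0 : 0 <= F * V0 by rewrite (le_trans (normr_ge0 _) (Vf x)).
  have -> : A f x = J f x - (J (V f) x - V f x).
    transitivity (J f x + V f x - J (V f) x) => //; ring.
  rewrite mulrDr mulr1 (le_trans (ler_normB _ _))// lerD//; first exact: Jb.
  have M0 : (0 < a + b)%N by rewrite /a; lia.
  have Mm : (a + b + (n + n) <= 4 * N)%N by rewrite /n; lia.
  apply: le_trans (JM _ _ _ x M0 Mm (sV f) Vf) _.
  have h1 : (a + b)%:R ^+ 2 <= 9 * L%:R ^+ 2 :> R.
    by rewrite -!natrX -natrM ler_nat; nia.
  have h2 : 8 * delta n / (n.+1%:R ^+ 2 * delta n./2) <= 64 * 2 ^+ d / N.+1%:R ^+ 2.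
    rewrite ler_pdivrMr ?mulr_gt0 ?exprn_gt0 ?delta_gt0//.
    rewrite mulrAC ler_pdivlMr ?exprn_gt0//.
    have r1 : delta n <= 2 * 2 ^+ d * delta n./2.
      by apply: ratio_bound; have := odd_double_half n; lia.
    have r2 : N.+1%:R ^+ 2 <= 4 * n.+1%:R ^+ 2 :> R.
      by rewrite -!natrX -natrM ler_nat /n; nia.
    apply: (@le_trans _ _ (8 * (2 * 2 ^+ d * delta n./2) * (4 * n.+1%:R ^+ 2))).
      by apply: ler_pM; rewrite ?mulr_ge0 ?exprn_ge0 ?ler_wpM2l.
    by rewrite le_eqVlt; apply/orP; left; apply/eqP; ring.
  have -> : F * (16 * 9 * 64 * 2 ^+ d * V0 * (L%:R / N.+1%:R) ^+ 2) =
      16 * (9 * L%:R ^+ 2) * (F * V0) * (64 * 2 ^+ d / N.+1%:R ^+ 2).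
    by rewrite expr_div_n; ring.
  apply: ler_pM => //.
  - by rewrite !mulr_ge0// exprn_ge0.
  - by rewrite ler_wpM2r// ler_wpM2l.
exists A; split=> //; split.
- exact: linear_bounded_near AK.
- move=> p /spherical_poly_spoly sp; transitivity (G p) => //.
  by rewrite /G (VL p sp) addrAC subrr add0r.
- move=> _ [f _ <-]; apply: spoly_spherical_poly => //.
  have nn : (n + n <= N)%N by rewrite /n; lia.
  apply: (@spoly_sub _ _ N); last exact: spoly_le nn (sJ _).
  by apply: spoly_add; [exact: spoly_le nn (sJ _)|exact: spoly_le abN (sV _)].
Qed.

End upper_bound.

(** * Riesz representation *)

Section cutoffs.
Context {R : realType} {d : nat}.
Local Notation S := (sphere R d).
Local Notation C := (csphere R d).
Implicit Types (x y z : S) (F : set S).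

Definition dist_set F x : R := inf [set `|val x - val z : 'rV[R]_d.+1| | z in F].

Lemma dist_set_has_inf F x : F !=set0 -> has_inf [set `|val x - val z : 'rV[R]_d.+1| | z in F].
Proof. by move=> [z Fz]; split; [exists `|val x - val z|, z|exists 0 => _ [w _ <-]]. Qed.

Lemma dist_set_lipschitz F x y : F !=set0 ->
  dist_set F x <= dist_set F y + `|val x - val y|.
Proof.
move=> F0; rewrite -lerBlDr; apply: lb_le_inf; first exact: (dist_set_has_inf y F0).1.
move=> _ [z Fz <-]; rewrite lerBlDr; apply: (@le_trans _ _ `|val x - val z|).
  by apply: ge_inf; [exact: (dist_set_has_inf x F0).2|exists z].
by rewrite [leRHS]addrC; exact: ler_distD.
Qed.

Lemma dist_set_continuous F : F !=set0 -> continuous (dist_set F).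
Proof.
move=> F0 x; apply/(@cvgrPdist_lt _ _ _ (nbhs (x : S)) (nbhs_filter x)) => e e0.
apply: filterS (nbhsx_ballx x e e0) => y.
move=> xye; have xy : ball (val x) e (val y) := xye.
rewrite -ball_normE /= in xy.
apply: le_lt_trans xy; rewrite ler_norml; apply/andP; split.
  by rewrite lerNl opprB lerBlDl distrC dist_set_lipschitz.
by rewrite lerBlDl dist_set_lipschitz.
Qed.

Lemma dist_set_eq0 F x : F x -> dist_set F x = 0.
Proof.
move=> Fx; have F0 : F !=set0 by exists x.
apply/eqP; rewrite eq_le; apply/andP; split.
  by apply: ge_inf; [exact: (dist_set_has_inf x F0).2|exists x => //; rewrite subrr normr0].
by apply: lb_le_inf; [exact: (dist_set_has_inf x F0).1|move=> _ [z _ <-]].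
Qed.

Lemma dist_set_gt0 F x : closed F -> F !=set0 -> ~ F x -> 0 < dist_set F x.
Proof.
move=> cF F0 nFx.
have : nbhs x (~` F) by apply: open_nbhs_nbhs; split=> //; exact: closed_openC.
move=> /nbhs_ballP[e /= e0 xF]; apply: (lt_le_trans e0).
apply: lb_le_inf; first exact: (dist_set_has_inf x F0).1.
move=> _ [z Fz <-]; rewrite leNgt; apply/negP => xz.
apply: (xF z) => //.
have : ball (val x) e (val z) by rewrite -ball_normE.
by [].
Qed.

Lemma closed_cutoffs F : closed F -> exists u : nat -> C,
  [/\ forall n x, 0 <= u n x <= 1, forall n x, u n.+1 x <= u n x,
      forall n x, F x -> u n x = 1 & forall x, ~ F x -> exists n, u n x = 0].
Proof.
(* For empty [F] the infimum defining the distance would take its default value 0, whence separate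
   cut-offs, equal to 0. *)
move=> cF; have [F0|F0] := pselect (F !=set0); last first.
  exists (fun=> 0); split=> [n x|//|n x Fx|x _].
  - by rewrite csphere_zeroE lexx ler01.
  - by exfalso; apply: F0; exists x.
  - by exists 0%N.
pose u (n : nat) x : R := Num.max 0 (1 - n%:R * dist_set F x).
have cu n : continuous (u n).
  move=> x; have := @continuous_comp S R R (dist_set F) (fun t => Num.max 0 (1 - n%:R * t)) x
    (@dist_set_continuous F F0 x).
  apply; apply: (@continuous_max _ _ (fun=> 0)); first exact: cst_continuous.
  by apply: continuousB; [exact: cst_continuous|exact: mulrl_continuous].
have d0 x : 0 <= dist_set F x.
  by apply: lb_le_inf; [exact: (dist_set_has_inf x F0).1|move=> _ [z _ <-]].
have uE n x : (mkcts (cu n) : C) x = u n x by [].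
exists (fun n => mkcts (cu n)); split=> [n x|n x|n x Fx|x nFx] /=.
- by rewrite uE /u le_max lexx/= ge_max ler01/= gerBl mulr_ge0.
- rewrite !uE /u ge_max le_max lexx/= le_max; apply/orP; right.
  by rewrite lerB// ler_wpM2r// ler_nat.
- by rewrite uE /u dist_set_eq0// mulr0 subr0 max_r.
- have dx := dist_set_gt0 cF F0 nFx.
  exists (Num.bound (dist_set F x)^-1); rewrite uE /u max_l// subr_le0.
  by rewrite -ler_pdivrMr// div1r ltW// archi_boundP// invr_ge0.
Qed.

End cutoffs.

(** * The measure of a positive functional *)

Section riesz_outer.
Context {R : realType} {d : nat}.
Local Notation S := (sphere R d).
Local Notation C := (csphere R d).
Implicit Types (f g : C) (x y z : S) (E F : set S).

Definition nonneg f := forall x, 0 <= f x.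

Lemma csphere_comp (h : R -> R) f : continuous h -> exists g, forall x, g x = h (f x).
Proof.
move=> ch; have c : continuous (fun x : S => h (f x)).
  move=> x; have := @continuous_comp S R R f h x (@cts_fun _ _ f x).
  by apply; exact: ch.
by exists (mkcts c).
Qed.

Fact cmul_cts f g : continuous (fun x => f x * g x).
Proof. by move=> x; exact: (cvgM (@cts_fun _ _ f x) (@cts_fun _ _ g x)). Qed.

Definition cmul f g : C := mkcts (@cmul_cts f g).

Lemma cmulE f g x : cmul f g x = f x * g x.
Proof. by []. Qed.

Definition ccst (c : R) : C := mkcts (@cst_continuous S R c).

Lemma csphere_subE f g x : (f - g) x = f x - g x.
Proof. by []. Qed.

(** Linearity is asked on nonnegative functions only, since the upper part of a signed functional is
    a supremum over [0 <= g <= f], meaningful only there. *)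
Definition cone_functional (P : C -> R) : Prop :=
  [/\ forall f, nonneg f -> 0 <= P f,
      forall f g, nonneg f -> nonneg g -> P (f + g) = P f + P g &
      forall c f, 0 <= c -> nonneg f -> P (c *: f) = c * P f].

Variables (P : C -> R) (hP : cone_functional P).

Lemma cone_ge0 f : nonneg f -> 0 <= P f.
Proof. by have [h _ _] := hP; exact: h. Qed.

Lemma coneD f g : nonneg f -> nonneg g -> P (f + g) = P f + P g.
Proof. by have [_ h _] := hP; exact: h. Qed.

Lemma coneZ c f : 0 <= c -> nonneg f -> P (c *: f) = c * P f.
Proof. by have [_ _ h] := hP; exact: h. Qed.

Lemma nonnegB f g : (forall x, f x <= g x) -> nonneg (g - f).
Proof. by move=> fg x; rewrite csphere_subE subr_ge0. Qed.

Lemma coneB f g : nonneg f -> (forall x, f x <= g x) -> P (g - f) = P g - P f.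
Proof.
move=> f0 fg; apply/eqP; rewrite eq_sym subr_eq -coneD//; last exact: nonnegB.
by rewrite subrK.
Qed.

Lemma cone_le f g : nonneg f -> (forall x, f x <= g x) -> P f <= P g.
Proof.
by move=> f0 fg; rewrite -subr_ge0 -coneB//; apply/cone_ge0/nonnegB.
Qed.

Lemma ccst_nonneg c : 0 <= c -> nonneg (ccst c).
Proof. by move=> c0 x. Qed.

Lemma cone_cst c : 0 <= c -> P (ccst c) = c * P (ccst 1).
Proof.
have n1 : nonneg (ccst 1) by apply: ccst_nonneg; exact: ler01.
move=> c0; rewrite -coneZ//.
by congr P; apply: csphereP => x; rewrite csphere_scaleE mulr1.
Qed.

(* Sequences instead of single functions make [outer] countably subadditive. *)
Definition covers E (f : nat -> C) : Prop :=
  [/\ forall n, nonneg (f n), forall n x, f n x <= f n.+1 x &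
      forall x, E x -> exists n, 1 <= f n x].

Lemma covers_mono E (f : nat -> C) m n x : covers E f -> (m <= n)%N -> f m x <= f n x.
Proof.
move=> [_ h _] /subnK <-; elim: (n - m)%N => [|k IHk]; first by rewrite add0n.
by rewrite (le_trans IHk)// addSn.
Qed.

Definition cover_bounds E := [set M | exists2 f, covers E f & forall n, P (f n) <= M].

Lemma cover_bounds_has_inf E : has_inf (cover_bounds E).
Proof.
split.
  exists (P (ccst 1)), (fun=> ccst 1) => //; split=> [n x|//|x _]; first exact: ler01.
  by exists 0%N => /=.
by exists 0 => M [f [f0 _ _] fM]; apply: le_trans (fM 0%N); exact: cone_ge0.
Qed.

(** A Daniell-type outer measure, defined for every set without a detour through open sets; it is
    finite because the constant 1 covers everything. *)
Definition outer E : R := inf (cover_bounds E).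

Lemma outer_le E (f : nat -> C) M : covers E f -> (forall n, P (f n) <= M) -> outer E <= M.
Proof. by move=> cf fM; apply: ge_inf; [exact: (cover_bounds_has_inf E).2|exists f]. Qed.

Lemma outer_adherent E (e : R) : 0 < e ->
  exists2 f, covers E f & forall n, P (f n) <= outer E + e.
Proof.
move=> e0; have [M [f cf fM] Me] := inf_adherent e0 (cover_bounds_has_inf E).
by exists f => // n; rewrite (le_trans (fM n))// ltW.
Qed.

Lemma outer_ge0 E : 0 <= outer E.
Proof.
apply: lb_le_inf; first exact: (cover_bounds_has_inf E).1.
by move=> M [f [f0 _ _] fM]; apply: le_trans (fM 0%N); exact: cone_ge0.
Qed.

Lemma outer_mono E F : E `<=` F -> outer E <= outer F.
Proof.
move=> EF; apply: lb_le_inf; first exact: (cover_bounds_has_inf F).1.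
move=> M [f [f0 fi cf] fM]; apply: outer_le fM; split=> // x /EF; exact: cf.
Qed.

Lemma cone0 : P 0 = 0.
Proof. by rewrite -[X in P X](scale0r 0) coneZ ?mul0r// => x; rewrite csphere_zeroE. Qed.

Lemma outer0 : outer set0 = 0.
Proof.
apply/eqP; rewrite eq_le outer_ge0 andbT; apply: (@outer_le _ (fun=> 0)).
  by split=> // n x; rewrite csphere_zeroE.
by move=> n; rewrite cone0.
Qed.

Definition eouter E : \bar R := (outer E)%:E.

Lemma sum_geometric_le (e : R) n : 0 <= e -> \sum_(i < n) e / 2 ^+ i.+1 <= e.
Proof.
move=> e0; suff -> : \sum_(i < n) e / 2 ^+ i.+1 = e - e / 2 ^+ n.
  by rewrite gerBl divr_ge0// exprn_ge0.
elim: n => [|n IHn]; first by rewrite big_ord0 expr0 divr1 subrr.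
rewrite big_ord_recr/= IHn exprS; have h : 0 < 2 ^+ n :> R by rewrite exprn_gt0.
by field; rewrite gt_eqF.
Qed.

(** For near-optimal covers [f_i] with slack [e / 2^(i+1)], the diagonal sums of [f_(i,n)] over
    [i <= n] increase with [n] and cover the union. *)
Lemma eouter_sigma_subadditive : sigma_subadditive eouter.
Proof.
move=> F.
have : (0 <= \sum_(i <oo) eouter (F i))%E.
  by apply: nneseries_ge0 => i _ _; rewrite lee_fin outer_ge0.
case sE : (\sum_(i <oo) eouter (F i))%E => [s| |//] _; last by rewrite leey.
apply/lee_addgt0Pr => e e0; rewrite -EFinD lee_fin.
have H i : exists f : nat -> C, covers (F i) f /\
    forall n, P (f n) <= outer (F i) + e / 2 ^+ i.+1.
  have ei : 0 < e / 2 ^+ i.+1 by rewrite divr_gt0// exprn_gt0.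
  by have [f cf fM] := outer_adherent (F i) ei; exists f.
have [f fP] := choice H.
have cf i : covers (F i) (f i) by case: (fP i).
have f0 i n : nonneg (f i n) by case: (cf i).
pose g n := \sum_(i < n.+1) f i n.
have gE n x : g n x = \sum_(i < n.+1) f i n x.
  by rewrite /g; elim/big_rec2 : _ => [//|i a b _ <-].
have PgE n (k : nat) : P (\sum_(i < k) f i n) = \sum_(i < k) P (f i n) /\ nonneg (\sum_(i < k) f i n).
  elim: k => [|k [IHk nk]]; first by rewrite !big_ord0 cone0; split=> // x; rewrite csphere_zeroE.
  rewrite !big_ord_recr/= coneD// IHk; split=> // x.
  by rewrite csphere_addE addr_ge0// f0.
apply: (@outer_le _ g); first split.
- by move=> n; exact: (PgE n n.+1).2.
- move=> n x; rewrite !gE [leRHS]big_ord_recr/= ler_wpDr ?f0//.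
  by apply: ler_sum => i _; have [_ h _] := cf i; exact: h.
- move=> x [i _ Fx]; have [_ _ /(_ x Fx)[n fn]] := cf i.
  exists (maxn i n); rewrite gE.
  have im : (i < (maxn i n).+1)%N by rewrite ltnS leq_maxl.
  rewrite (bigD1 (Ordinal im))//= ler_wpDr//; first by rewrite sumr_ge0// => j _; exact: f0.
  by apply: le_trans fn _; apply: covers_mono (cf i) _; exact: leq_maxr.
- move=> n; rewrite (PgE n n.+1).1.
  apply: (@le_trans _ _ (\sum_(i < n.+1) (outer (F i) + e / 2 ^+ i.+1))).
    by apply: ler_sum => i _; have [_ h] := fP i; exact: h.
  rewrite big_split/= lerD// ?sum_geometric_le ?(ltW e0)//.
  rewrite -lee_fin -sE -sumEFin -(big_mkord xpredT (fun i => eouter (F i))).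
  by apply: nneseries_lim_ge => i _ _; rewrite lee_fin outer_ge0.
Qed.

Lemma eouter_ge0 E : (0 <= eouter E)%E.
Proof. by rewrite lee_fin outer_ge0. Qed.

Lemma eouter_mono : {homo eouter : E F / E `<=` F >-> (E <= F)%E}.
Proof. by move=> E F EF; rewrite lee_fin outer_mono. Qed.

Lemma eouter0 : eouter set0 = 0%E.
Proof. by rewrite /eouter outer0. Qed.

HB.instance Definition _ := isOuterMeasure.Build R S eouter
  eouter0 eouter_ge0 eouter_mono eouter_sigma_subadditive.

(* With cut-offs [u_n] decreasing to the indicator of [F], the products
   [f_k u_n] cover [E & F] and the [f_n (1 - u_n)] cover the rest of [E]. *)
Lemma closed_caratheodory F : closed F -> caratheodory_measurable eouter F.
Proof.
move=> cF; apply: le_caratheodory_measurable => E.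
rewrite /eouter -EFinD lee_fin; apply/ler_addgt0Pr => e e0.
have [f cf fM] := outer_adherent E e0; have [f0 fi fE] := cf.
have [u [u01 ui uF uN]] := closed_cutoffs cF.
set M := outer E + e in fM *.
have fu0 k n : nonneg (cmul (f k) (u n)).
  by move=> x; rewrite mulr_ge0 ?f0//; have /andP[] := u01 n x.
have fule k n x : cmul (f k) (u n) x <= f k x.
  by rewrite ler_piMr ?f0//; have /andP[] := u01 n x.
pose g n := f n - cmul (f n) (u n).
have gE n x : g n x = f n x * (1 - u n x) by rewrite /g csphere_subE mulrBr mulr1.
have um m n x : (m <= n)%N -> u n x <= u m x.
  move=> /subnK <-; elim: (n - m)%N => [//|k IHk].
  by rewrite addSn (le_trans (ui _ _)).
rewrite -lerBrDl; apply: (@outer_le _ g); first split.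
- by move=> n; exact: nonnegB.
- move=> n x; rewrite !gE ler_pM ?f0// ?subr_ge0 ?lerB//; by have /andP[] := u01 n x.
- move=> x [Ex nFx]; have [k fk] := fE x Ex; have [n un] := uN x nFx.
  exists (maxn k n); rewrite gE.
  have -> : u (maxn k n) x = 0.
    apply/eqP; rewrite eq_le (le_trans (um _ _ x (leq_maxr k n))) ?un//=.
    by have /andP[] := u01 (maxn k n) x.
  by rewrite subr0 mulr1 (le_trans fk)// (covers_mono _ cf) ?leq_maxl.
- move=> n; rewrite lerBrDr -lerBrDl.
  apply: (@outer_le _ (fun k => cmul (f k) (u n))); first split.
  + by move=> k; exact: fu0.
  + by move=> k x; rewrite !cmulE ler_wpM2r//; have /andP[] := u01 n x.
  + move=> x [Ex Fx]; have [k fk] := fE x Ex; exists k.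
    by rewrite cmulE uF// mulr1.
  (* [f_k u_n] and [f_n (1 - u_n)] are dominated by [f_K u_n] and [f_K (1 - u_n)], which add up to
     [f_K]. *)
  + move=> k; rewrite lerBrDr; set K := maxn k n.
    apply: (@le_trans _ _ (P (cmul (f K) (u n)) + P (f K - cmul (f K) (u n)))); last first.
      by rewrite -coneD// ?subrKC//; [exact: nonnegB].
    apply: lerD; apply: cone_le => //.
    * by move=> x; rewrite !cmulE ler_wpM2r ?(covers_mono _ cf) ?leq_maxl//; have /andP[] := u01 n x.
    * exact: nonnegB.
    * move=> x; rewrite gE csphere_subE cmulE.
      rewrite (_ : f K x - f K x * u n x = f K x * (1 - u n x)); last by ring.
      by rewrite ler_wpM2r ?(covers_mono _ cf) ?leq_maxr// subr_ge0; have /andP[] := u01 n x.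
Qed.

Local Notation B := (borel_sphere R d).

Lemma borel_caratheodory (A : set B) : measurable A -> caratheodory_measurable eouter A.
Proof.
apply: smallest_sub (sigma_algebra_measurable (caratheodory_type eouter)) _ A => U oU.
rewrite -(setCK U); apply: caratheodory_measurable_setC.
by apply: closed_caratheodory; exact: open_closedC.
Qed.

Definition riesz_measure (A : set B) : \bar R := eouter A.

Lemma riesz_measure0 : riesz_measure set0 = 0%E.
Proof. exact: eouter0. Qed.

Lemma riesz_measure_ge0 A : (0 <= riesz_measure A)%E.
Proof. exact: eouter_ge0. Qed.

Lemma riesz_measure_sigma_additive : semi_sigma_additive riesz_measure.
Proof.
move=> F mF tF mUF; apply: (@caratheodory_measure_sigma_additive _ _ eouter F) => //.
- by move=> i; exact: borel_caratheodory.
- exact: borel_caratheodory.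
Qed.

HB.instance Definition _ := measure_function.isMeasure.Build _ _ _ riesz_measure
  riesz_measure0 riesz_measure_ge0 riesz_measure_sigma_additive.

Lemma riesz_measure_fin : fin_num_fun riesz_measure.
Proof. by []. Qed.

HB.instance Definition _ := @Measure_isFinite.Build _ _ _ riesz_measure riesz_measure_fin.

Lemma borel_measurable_fun f : measurable_fun [set: B] (f : B -> R).
Proof.
apply: (measurability _ (RGenOInfty.measurableE R)) => _ [_ [a ->] <-].
rewrite setTI; apply: sub_sigma_algebra.
have /continuousP/(_ [set z : R | a < z]) := @cts_fun _ _ f.
rewrite (_ : _ @^-1` _ = f @^-1` `]a, +oo[%classic); first by apply; exact: open_gt.
by apply/seteqP; split=> x /=; rewrite in_itv/= andbT.
Qed.

Lemma borel_integrable (mu : {finite_measure set B -> \bar R}) f :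
  mu.-integrable [set: B] (EFin \o (f : B -> R)).
Proof.
apply: measurable_bounded_integrable => //.
- by rewrite ltey_eq fin_num_measure.
- exact: borel_measurable_fun.
- exists (unif_norm f); split=> [|M fM x _]; first exact: num_real.
  exact: (le_trans (ler_unif_norm f x) (ltW fM)).
Qed.

(** For a near-optimal cover [f_n] of [A] and [c > 1], the open set where some [c f_n > 1] contains
    [A] and is covered by the [c f_n]; [c] is tuned so that [c (outer A + e / 2) = outer A + e]. *)
Lemma outer_regular (A : set B) (e : R) : 0 < e ->
  exists U : set S, [/\ open U, A `<=` U & outer U <= outer A + e].
Proof.
move=> e0; pose o := outer A; have o0 : 0 <= o by exact: outer_ge0.
have e2 : 0 < e / 2 by rewrite divr_gt0.
have [f cf fM] := outer_adherent A e2; have [f0 fi fE] := cf.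
pose c : R := 1 + e / 2 / (o + e / 2).
have oe : 0 < o + e / 2 by rewrite ltr_wpDl.
have c1 : 1 < c by rewrite ltrDl divr_gt0.
have cE : c * (o + e / 2) = o + e by rewrite /c mulrDl mul1r divfK ?gt_eqF//; field.
pose U := \bigcup_n [set x | 1 < c * f n x].
exists U; split.
- apply: bigcup_open => n _.
  have /continuousP/(_ [set z : R | 1 < z]) := @cts_fun _ _ (c *: f n).
  by apply; exact: open_gt.
- move=> x Ax; have [n fn] := fE x Ax; exists n => //=.
  by rewrite (lt_le_trans c1)// ler_peMr// (le_trans _ (ltW c1)).
- have c0 : 0 <= c by rewrite (le_trans _ (ltW c1)).
  apply: (@outer_le _ (fun n => c *: f n)); first split.
  + by move=> n x; rewrite csphere_scaleE mulr_ge0// f0.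
  + by move=> n x; rewrite !csphere_scaleE ler_wpM2l.
  + by move=> x [n _ /= fn]; exists n; rewrite csphere_scaleE ltW.
  + by move=> n; rewrite coneZ// -cE ler_wpM2l.
Qed.

(* By Dini's argument, [f - e <= f_n] for some [n]. *)
Lemma outer_ge E f : nonneg f -> (forall x, f x <= 1) -> (forall x, 0 < f x -> E x) ->
  P f <= outer E.
Proof.
move=> f0 f1 fE; apply/ler_addgt0Pr => e e0.
pose K : R := 2 * (P (ccst 1) + 1).
have P1 : 0 <= P (ccst 1) by apply/cone_ge0/ccst_nonneg.
have K0 : 0 < K by rewrite mulr_gt0// ltr_wpDl.
have e2 : 0 < e / 2 by rewrite divr_gt0.
have [g cg gM] := outer_adherent E e2; have [g0 gi gE] := cg.
have [n gn] : exists n, forall x, f x - e / K < g n x.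
  pose U n := [set x : S | f x - e / K < g n x].
  have oU n : open (U n).
    have /continuousP/(_ [set z : R | - (e / K) < z]) := @cts_fun _ _ (g n - f).
    rewrite (_ : _ @^-1` _ = U n); first by apply; exact: open_gt.
    apply/seteqP; split=> x /=; rewrite csphere_subE /U/=; lra.
  have := @sphere_compact R d; rewrite compact_cover => /(_ nat setT U) [//|x _|D _ cD].
    have [fx|fx] := leP (f x) 0.
      by exists 0%N => //; rewrite /U/=; apply: lt_le_trans (g0 _ x); rewrite subr_lt0 (le_lt_trans fx)// divr_gt0.
    have [n gn] := gE x (fE x fx); exists n => //; rewrite /U/=.
    by apply: lt_le_trans gn; rewrite ltrBlDr ltr_pwDr// divr_gt0.
  exists (\max_(i <- finmap.enum_fset D) i)%N => x; have [n nD Ux] := cD x Logic.I.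
  apply: lt_le_trans Ux _; apply: covers_mono cg _.
  exact: (@leq_bigmax_seq _ _ _ id).
apply: (@le_trans _ _ (P (g n + (e / K) *: ccst 1))).
  apply: cone_le => // x; rewrite csphere_addE csphere_scaleE.
  have -> : ccst 1 x = 1 by [].
  by rewrite mulr1 -lerBlDr ltW.
have n1 : nonneg (ccst 1) by exact: ccst_nonneg ler01.
rewrite coneD// ?coneZ ?divr_ge0 ?(ltW e0) ?(ltW K0)//; last first.
  by move=> x; rewrite csphere_scaleE mulr_ge0 ?divr_ge0 ?(ltW e0) ?(ltW K0)//; exact: n1.
have -> : outer E + e = outer E + e / 2 + e / 2 by field.
apply: lerD => //; rewrite mulrAC ler_pdivrMr// /K.
by rewrite mulrA divfK// ler_wpM2l ?(ltW e0)// lerDl.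
Qed.

Lemma csphere_integralD (nu : {finite_measure set B -> \bar R}) f g :
  (\int[nu]_x ((f + g) x : R) = \int[nu]_x (f x : R) + \int[nu]_x (g x : R))%R.
Proof. by rewrite -RintegralD//; exact: borel_integrable. Qed.

Lemma csphere_integralZ (nu : {finite_measure set B -> \bar R}) c f :
  (\int[nu]_x ((c *: f) x : R) = c * \int[nu]_x (f x : R))%R.
Proof. by rewrite -RintegralZl//; exact: borel_integrable. Qed.

Lemma csphere_integral_cst (nu : {finite_measure set B -> \bar R}) c :
  (\int[nu]_x (ccst c x : R) = c * fine (nu [set: B]))%R.
Proof. by rewrite -Rintegral_cst. Qed.

Lemma csphere_integral_ge (nu : {finite_measure set B -> \bar R}) f c (A : set B) :
  measurable A -> nonneg f -> (forall x, A x -> c <= f x) ->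
  (c * fine (nu A) <= \int[nu]_x (f x : R))%R.
Proof.
move=> mA f0 cf; have iA : nu.-integrable [set: B] (EFin \o (\1_A : B -> R)).
  exact: integrable_indic.
have -> : c * fine (nu A) = (\int[nu]_x (c * \1_A x))%R.
  by rewrite RintegralZl// /Rintegral integral_indic// setIT.
apply: le_Rintegral => //; [|exact: borel_integrable|].
  have -> : EFin \o (fun x : B => c * \1_A x) = (fun x : B => c%:E * (EFin \o \1_A) x)%E by [].
  exact: integrableZl.
move=> x _; rewrite indicE; case: (boolP (x \in A)) => [/set_mem/cf|_]; first by rewrite mulr1.
by rewrite mulr0; exact: f0.
Qed.

Local Notation Int f := (\int[riesz_measure]_x (f x : R))%R.

Lemma borel_open (U : set S) : open U -> measurable (U : set B).
Proof. exact: sub_sigma_algebra. Qed.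

Lemma open_support f (c : R) : open [set x | c < f x].
Proof. by have /continuousP/(_ [set z : R | c < z]) := @cts_fun _ _ f; apply; exact: open_gt. Qed.

(* Peels off the layers [min(f, e)] of [f] one at a time. *)
Lemma riesz_layer (e : R) k f : 0 < e -> nonneg f -> (forall x, f x <= k%:R * e) ->
  P f <= Int f + e * outer [set x | 0 < f x].
Proof.
move=> e0; elim: k f => [|k IHk] f f0 fk.
  have -> : f = 0.
    apply: csphereP => x; rewrite csphere_zeroE; apply/eqP.
    by rewrite eq_le f0 andbT (le_trans (fk x))// mul0r.
  rewrite cone0 addr_ge0 ?mulr_ge0 ?outer_ge0 ?(ltW e0)//.
  by apply: Rintegral_ge0 => x _; rewrite csphere_zeroE.
have [m mE] : exists m : C, forall x, m x = Num.min (f x) e.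
  apply: (@csphere_comp (fun t => Num.min t e)).
  by move=> t; apply: (@continuous_min _ _ id (fun=> e) t); [exact: cvg_id|exact: cvg_cst].
have m0 : nonneg m by move=> x; rewrite mE le_min f0 ltW.
have mf x : m x <= f x by rewrite mE ge_min lexx.
pose h := f - m; have h0 : nonneg h by exact: nonnegB.
have fE : f = m + h by rewrite /h subrKC.
have hk x : h x <= k%:R * e.
  rewrite /h csphere_subE mE; have := fk x; rewrite -natr1 mulrDl mul1r => fkx.
  have [fe|fe] := leP (f x) e; last by rewrite lerBlDr.
  by rewrite subrr mulr_ge0// ltW.
have PE : P f = P m + P h by rewrite -coneD// -fE.
have IE : Int f = Int m + Int h by rewrite -csphere_integralD -fE.
have Ph := IHk h h0 hk; rewrite PE IE.
(* The remainder of the induction hypothesis is now [e * outer [set x | e < f x]], which is at most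
   [Int m]: errors do not accumulate over the layers. *)
rewrite (_ : [set x | 0 < h x] = [set x | e < f x]) in Ph; last first.
  apply/seteqP; split=> x /=; rewrite /h csphere_subE mE; have [fe|fe] := leP (f x) e; lra.
have Pm : P m <= e * outer [set x | 0 < f x].
  rewrite -ler_pdivrMl// -coneZ ?invr_ge0 ?(ltW e0)//; apply: outer_ge => x.
  - by rewrite csphere_scaleE mulr_ge0 ?invr_ge0 ?(ltW e0)//; exact: m0.
  - by rewrite csphere_scaleE ler_pdivrMl// mulr1 mE ge_min lexx orbT.
  - by rewrite csphere_scaleE pmulr_rgt0 ?invr_gt0// => /lt_le_trans; exact.
have Im : e * outer [set x | e < f x] <= Int m.
  have mE' : measurable ([set x | e < f x] : set B) by apply: borel_open; exact: open_support.
  apply: (@csphere_integral_ge (riesz_measure : {finite_measure set B -> \bar R}) m e _ mE' m0).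
  by move=> x /= efx; rewrite mE min_r// ltW.
by rewrite (le_trans (lerD Pm Ph))// [leLHS]addrC lerD2r [leRHS]addrC lerD2l.
Qed.

(** Thin layers in [riesz_layer] give [P f <= Int f]. The converse is the same inequality for the
    nonnegative function [|f| - f], with [|f|] the norm, as the total mass is at most
    [P (ccst 1)]. *)
Lemma riesz_integral f : nonneg f -> P f = Int f.
Proof.
have le g : nonneg g -> P g <= Int g.
  move=> g0; apply/ler_addgt0Pr => e e0; set m := outer [set x | 0 < g x].
  have m0 : 0 <= m by exact: outer_ge0.
  have e1 : 0 < e / (m + 1) by rewrite divr_gt0// ltr_wpDl.
  have := @riesz_layer (e / (m + 1)) (Num.bound (`|g| / (e / (m + 1)))) g e1 g0.
  have gb x : g x <= (Num.bound (`|g| / (e / (m + 1))))%:R * (e / (m + 1)).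
    rewrite -ler_pdivrMr// (le_trans _ (ltW (archi_boundP _)))//; last first.
      by rewrite divr_ge0// ltW.
    by rewrite ler_pM2r ?invr_gt0// (le_trans (ler_norm _))// ler_unif_norm.
  move=> /(_ gb) /le_trans; apply; rewrite lerD2l -/m mulrAC ler_pdivrMr ?ltr_wpDl//.
  by rewrite ler_pM2l// lerDl.
move=> f0; apply/eqP; rewrite eq_le le//=.
have fM x : f x <= ccst `|f| x by rewrite (le_trans (ler_norm _))// ler_unif_norm.
have := le _ (nonnegB fM); rewrite coneB// cone_cst//.
rewrite csphere_integralD -(scaleN1r f) csphere_integralZ csphere_integral_cst mulN1r.
have m1 : outer setT <= P (ccst 1).
  apply: (@outer_le _ (fun=> ccst 1)) => //; split; [by move=> n x; exact: ler01|by []|by move=> x _; exists 0%N => /=].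
have : `|f| * fine (riesz_measure setT) <= `|f| * P (ccst 1) by rewrite ler_wpM2l.
lra.
Qed.

Lemma riesz_positive :
  exists mu : {finite_measure set B -> \bar R},
    (forall f, nonneg f -> P f = (\int[mu]_x (f x : R))%R) /\
    forall (A : set B) (e : R), 0 < e ->
      exists U : set B, [/\ open (U : set (sphere R d)), A `<=` U & (mu U <= mu A + e%:E)%E].
Proof.
exists (riesz_measure : {finite_measure set B -> \bar R}); split.
  exact: riesz_integral.
move=> A e e0; have [U [oU AU Ue]] := outer_regular A e0.
by exists U; split.
Qed.

End riesz_outer.

(** * Splitting a signed functional; regularity of finite measures *)

Section signed_riesz.
Context {R : realType} {d : nat}.
Local Notation S := (sphere R d).
Local Notation C := (csphere R d).
Local Notation B := (borel_sphere R d).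
Implicit Types (f g h : C) (x y z : S).

Lemma csphere_min f g : exists m : C, forall x, m x = Num.min (f x) (g x).
Proof.
have c : continuous (fun x : S => Num.min (f x) (g x)).
  move=> x; apply: (@continuous_min _ _ (f : S -> R) (g : S -> R) x); exact: cts_fun.
by exists (mkcts c).
Qed.

Section positive_part.
Variables (Phi : {linear C -> R}) (K : R).
Hypothesis PhiK : forall f (F : R), (forall x, `|f x| <= F) -> `|Phi f| <= K * F.

Let PhiZ (a : R) f : Phi (a *: f) = a * Phi f.
Proof. by rewrite linearZ. Qed.

Definition below f := [set r | exists2 g, nonneg g /\ (forall x, g x <= f x) & Phi g = r].

(** The Riesz-Kantorovich formula for the positive part of [Phi] in the order dual. *)
Definition upper_part f : R := sup (below f).

Lemma below_has_sup f : nonneg f -> has_sup (below f).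
Proof.
move=> f0; split; first by exists (Phi 0), 0 => //; split=> x; rewrite ?csphere_zeroE.
exists (K * `|f|) => _ [g [g0 gf] <-]; rewrite (le_trans (ler_norm _))//.
apply: PhiK => x; rewrite ger0_norm// (le_trans (gf x))// (le_trans (ler_norm _))//.
exact: ler_unif_norm.
Qed.

Lemma le_upper_part f g : nonneg g -> (forall x, g x <= f x) -> Phi g <= upper_part f.
Proof.
move=> g0 gf; apply: ub_le_sup; last by exists g.
apply: (below_has_sup _).2 => x; exact: le_trans (g0 x) (gf x).
Qed.

Lemma upper_part_le f (r : R) : nonneg f ->
  (forall g, nonneg g -> (forall x, g x <= f x) -> Phi g <= r) -> upper_part f <= r.
Proof.
move=> f0 fr; apply: ge_sup; first exact: (below_has_sup f0).1.
by move=> _ [g [g0 gf] <-]; exact: fr.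
Qed.

Lemma upper_part_ge0 f : nonneg f -> 0 <= upper_part f.
Proof.
move=> f0; rewrite -(linear0 Phi); apply: le_upper_part => x; first by rewrite csphere_zeroE.
exact: f0.
Qed.

(** Riesz decomposition: any [0 <= h <= f + g] is the sum of [min h f], below [f], and
    [h - min h f], below [g]. *)
Lemma upper_partD f g : nonneg f -> nonneg g ->
  upper_part (f + g) = upper_part f + upper_part g.
Proof.
move=> f0 g0; have fg0 : nonneg (f + g) by move=> x; rewrite csphere_addE addr_ge0.
apply/eqP; rewrite eq_le; apply/andP; split.
  apply: upper_part_le => // h h0 hfg; have [m mE] := csphere_min h f.
  have mh x : m x <= h x by rewrite mE ge_min lexx.
  have -> : h = m + (h - m) by rewrite subrKC.
  rewrite raddfD lerD// le_upper_part//.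
  - by move=> x; rewrite mE le_min h0 f0.
  - by move=> x; rewrite mE ge_min lexx orbT.
  - exact: nonnegB.
  - move=> x; rewrite csphere_subE mE lerBlDl; have := hfg x; rewrite csphere_addE => hx.
    by have [_|//] := leP (h x) (f x); rewrite lerDl.
rewrite -lerBrDr; apply: upper_part_le => // f' f'0 f'f.
rewrite lerBrDl -lerBrDr; apply: upper_part_le => // g' g'0 g'g.
rewrite lerBrDr -raddfD le_upper_part// => x; rewrite !csphere_addE; first exact: addr_ge0.
by rewrite addrC lerD.
Qed.

Lemma upper_partZ (c : R) f : 0 <= c -> nonneg f -> upper_part (c *: f) = c * upper_part f.
Proof.
have le (a : R) g : 0 < a -> nonneg g -> a * upper_part g <= upper_part (a *: g).
  move=> a0 g0; rewrite -ler_pdivlMl//; apply: upper_part_le => // h h0 hg.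
  rewrite ler_pdivlMl// -PhiZ; apply: le_upper_part => x; rewrite !csphere_scaleE.
    by rewrite mulr_ge0 ?(ltW a0)//; exact: h0.
  by rewrite ler_pM2l.
rewrite le_eqVlt => /predU1P[<-|c0] f0.
  rewrite scale0r mul0r; apply/eqP; rewrite eq_le upper_part_ge0// andbT.
  apply: upper_part_le => // g g0 g0'.
  have -> : g = 0; last by rewrite linear0.
  by apply: csphereP => x; apply/eqP; rewrite eq_le g0' g0.
apply/eqP; rewrite eq_le le// andbT -ler_pdivrMl//.
have cf0 : nonneg (c *: f) by move=> x; rewrite csphere_scaleE mulr_ge0 ?(ltW c0)//; exact: f0.
have := le c^-1 (c *: f); rewrite invr_gt0 => /(_ c0 cf0) /le_trans; apply.
by rewrite scalerA mulVf ?gt_eqF// scale1r.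
Qed.

Lemma cone_upper_part : cone_functional upper_part.
Proof. by split; [exact: upper_part_ge0|exact: upper_partD|exact: upper_partZ]. Qed.

Lemma cone_lower_part : cone_functional (fun f => upper_part f - Phi f).
Proof.
split=> [f f0|f g f0 g0|c f c0 f0].
- by rewrite subr_ge0 le_upper_part.
- by rewrite upper_partD// raddfD; ring.
- by rewrite upper_partZ// PhiZ mulrBr.
Qed.

End positive_part.

Lemma le_sub_measure (mu : {finite_measure set B -> \bar R}) (A U : set B) (e : R) :
  measurable A -> measurable U -> A `<=` U -> (mu U <= mu A + e%:E)%E -> (mu (U `\` A) <= e%:E)%E.
Proof.
move=> mA mU AU h; rewrite measureD//; last by rewrite ltey_eq fin_num_measure.
rewrite (_ : U `&` A = A); last by apply/seteqP; split=> x; [case|move=> Ax; split=> //; exact: AU].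
by rewrite leeBlDl// fin_num_measure.
Qed.

(** Inner approximation of [A] by closed sets is outer approximation of its complement by open
    ones. *)
Lemma finite_measure_regular (mu : {finite_measure set B -> \bar R}) :
  (forall (A : set B) (e : R), 0 < e ->
      exists U : set B, [/\ open (U : set S), A `<=` U & (mu U <= mu A + e%:E)%E]) ->
  forall (A : set B) (e : R), measurable A -> 0 < e ->
  exists F U : set B, [/\ closed (F : set S), open (U : set S), F `<=` A, A `<=` U &
    (mu (U `\` F) <= e%:E)%E].
Proof.
move=> reg A e mA e0; have e2 : 0 < e / 2 by rewrite divr_gt0.
have [U [oU AU Ue]] := reg A (e / 2) e2.
have [V [oV AV Ve]] := reg (~` A) (e / 2) e2.
have mU : measurable U by exact: borel_open.
have mV : measurable V by exact: borel_open.
exists (~` V), U; split => //.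
- exact: open_closedC.
- by move=> x Vx; apply: contrapT => /AV.
have -> : U `\` ~` V = (U `\` A) `|` ((U `&` A) `\` ~` V).
  apply/seteqP; split=> x /=.
    by move=> [Ux Vx]; have [Ax|Ax] := pselect (A x); [right|left].
  move=> [[Ux nA]|[[Ux Ax] nV]]; split=> //.
  by move=> nV; apply: nV; exact: AV.
have mA' : measurable (~` A) by exact: measurableC.
apply: (le_trans (measureU2 _ _ _)).
- exact: measurableD.
- by apply: measurableD; [exact: measurableI|exact: measurableC].
have -> : e%:E = ((e / 2)%:E + (e / 2)%:E)%E by rewrite -EFinD; congr EFin; field.
apply: leeD; first exact: le_sub_measure.
apply: (@le_trans _ _ (mu (V `\` ~` A))); last exact: le_sub_measure.
apply: le_measure; rewrite ?inE.
- by apply: measurableD; [exact: measurableI|exact: measurableC].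
- exact: measurableD.
- by move=> x [[Ux Ax] /contrapT Vx]; split=> //; apply.
Qed.

End signed_riesz.

(** * The Riesz representation theorem with a regular signed measure *)

Section representation.
Context {R : realType} {d : nat}.
Local Notation S := (sphere R d).
Local Notation C := (csphere R d).
Local Notation B := (borel_sphere R d).
Implicit Types (f g h : C) (x y z : S).

Lemma csphere_integral_add (m1 m2 m3 m4 : {finite_measure set B -> \bar R}) f :
  (forall A, measurable A -> m1 A + m2 A = m3 A + m4 A)%E -> nonneg f ->
  (\int[m1]_x (f x : R) + \int[m2]_x (f x : R) = \int[m3]_x (f x : R) + \int[m4]_x (f x : R))%R.
Proof.
move=> h f0.
have E (m m' : {finite_measure set B -> \bar R}) :
    (\int[measure_add m m']_x (f x)%:E = (\int[m]_x (f x : R) + \int[m']_x (f x : R))%R%:E)%E.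
  rewrite ge0_integral_measure_add//.
  - by rewrite EFinD /Rintegral !fineK//; apply: integrable_fin_num => //; exact: borel_integrable.
  - by move=> x _; rewrite lee_fin; exact: f0.
  - by apply/measurable_EFinP; exact: borel_measurable_fun.
apply: EFin_inj; rewrite -!E; apply: eq_measure_integral => A mA _.
by transitivity (m1 A + m2 A)%E; [exact: measure_addE|rewrite h//; exact/esym/measure_addE].
Qed.

(** The measures of the upper and lower parts of a functional are not known to be mutually singular,
    while [signed_integral] uses the Jordan decomposition. Written with sums, [pos + m2 = neg + m1],
    the identity involves positive measures only. *)
Lemma signed_integral_sub (mu : {charge set B -> \bar R})
    (m1 m2 : {finite_measure set B -> \bar R}) f :
  (forall A, measurable A -> mu A = m1 A - m2 A)%E -> nonneg f ->
  signed_integral mu f = (\int[m1]_x (f x : R) - \int[m2]_x (f x : R))%R.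
Proof.
move=> h f0; rewrite /signed_integral.
have : (\int[pos_part mu]_x (f x : R) + \int[m2]_x (f x : R) =
        \int[neg_part mu]_x (f x : R) + \int[m1]_x (f x : R))%R.
  apply: (@csphere_integral_add (pos_part mu : {finite_measure set B -> \bar R}) m2
    (neg_part mu : {finite_measure set B -> \bar R}) m1) => // A mA.
  suff: (pos_part mu A + m2 A = neg_part mu A + m1 A)%E by [].
  have := h A mA.
  have -> : mu A = (pos_part mu A - neg_part mu A)%E.
    rewrite (jordan_decomp (hahn_posneg mu) mA) /cadd/=.
    by rewrite cscaleN1.
  have pE : pos_part mu A \is a fin_num by exact: fin_num_measure.
  have nE : neg_part mu A \is a fin_num by exact: fin_num_measure.
  have m1E : m1 A \is a fin_num by exact: fin_num_measure.
  have m2E : m2 A \is a fin_num by exact: fin_num_measure.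
  move: pE nE m1E m2E; move: (pos_part mu A) (neg_part mu A) (m1 A) (m2 A).
  move=> [p| |] [q| |] [r| |] [s| |] // _ _ _ _ [e]; congr EFin; lra.
by move=> e; apply/eqP; rewrite subr_eq eq_sym addrAC subr_eq e addrC.
Qed.

Lemma signed_integralD (mu : {charge set B -> \bar R}) f g :
  signed_integral mu (f + g) = signed_integral mu f + signed_integral mu g.
Proof.
rewrite /signed_integral (@csphere_integralD _ _ (pos_part mu : {finite_measure set B -> \bar R})).
rewrite (@csphere_integralD _ _ (neg_part mu : {finite_measure set B -> \bar R})).
by rewrite opprD addrACA.
Qed.

(** Minimality of the Jordan decomposition: on the Hahn positive set [mu <= m1], on the negative one
    [- mu <= m2]. *)
Lemma total_variation_le (mu : {charge set B -> \bar R})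
    (m1 m2 : {finite_measure set B -> \bar R}) (A : set B) :
  (forall A, measurable A -> mu A = m1 A - m2 A)%E -> measurable A ->
  (Defs.total_variation mu A <= m1 A + m2 A)%E.
Proof.
move=> h mA; have [[mP _] [mN _] _ _] := hahn_posneg mu.
apply: leeD; rewrite ?jordan_posE ?jordan_negE ?cjordan_posE ?cjordan_negE /crestr0 mem_set//= /crestr.
  rewrite h; last exact: measurableI.
  apply: (@le_trans _ _ (m1 (A `&` hahn_pos mu))); last first.
    by apply: le_measure; rewrite ?inE//; exact: measurableI.
  by rewrite leeBlDr ?fin_num_measure//; [rewrite leeDl|exact: measurableI].
rewrite h; last exact: measurableI.
apply: (@le_trans _ _ (m2 (A `&` hahn_neg mu))); last first.
  by apply: le_measure; rewrite ?inE//; exact: measurableI.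
have mI : measurable (A `&` hahn_neg mu) by exact: measurableI.
rewrite fin_num_oppeB ?fin_num_measure//.
by rewrite addeC leeBlDr ?fin_num_measure// leeDl.
Qed.

Lemma closed_sphere_compact (F : set S) : closed F -> compact F.
Proof. by move=> cF; apply: subclosed_compact cF sphere_compact _. Qed.

Lemma riesz_representation (Phi : {linear C -> R}) (K : R) :
  (forall f (F : R), (forall x, `|f x| <= F) -> `|Phi f| <= K * F) ->
  exists mu : {charge set B -> \bar R}, regular mu /\ forall f, Phi f = signed_integral mu f.
Proof.
move=> PhiK; have [m1 [m1E m1r]] := riesz_positive (cone_upper_part PhiK).
have [m2 [m2E m2r]] := riesz_positive (cone_lower_part PhiK).
pose mu : {charge set B -> \bar R} := cadd (charge_of_finite_measure m1)
  (cscale (-1) (charge_of_finite_measure m2)).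
have muE A : measurable A -> (mu A = m1 A - m2 A)%E.
  by move=> mA; rewrite /mu/= /cadd/= cscaleN1.
have repr f : nonneg f -> Phi f = signed_integral mu f.
  move=> f0; rewrite (signed_integral_sub muE f0) -m1E// -m2E//.
  by rewrite opprB addrC subrK.
exists mu; split; last first.
  (* Adding the norm as a constant reduces the identity to nonnegative functions. *)
  move=> f; pose c : C := ccst `|f|.
  have n1 : nonneg c by move=> x; exact: normr_ge0.
  have n2 : nonneg (f + c).
    move=> x; rewrite csphere_addE -lerBlDr sub0r.
    by have := ler_unif_norm f x; rewrite ler_norml => /andP[].
  have PD : Phi (f + c) = Phi f + Phi c by rewrite raddfD.
  by apply: (addIr (Phi c)); rewrite -PD (repr _ n2) (repr _ n1) signed_integralD.
(* Two errors of [e / 3] leave room for the strict inequality that [regular] demands. *)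
move=> A mA e e0; have e3 : 0 < e / 3 by rewrite divr_gt0.
have [F1 [U1 [cF1 oU1 FA1 AU1 r1]]] := finite_measure_regular m1r mA e3.
have [F2 [U2 [cF2 oU2 FA2 AU2 r2]]] := finite_measure_regular m2r mA e3.
have closedm (F : set S) : closed F -> measurable (F : set B).
  move=> cF; have oF : measurable (~` F : set B) by apply: borel_open; exact: closed_openC.
  by have := measurableC oF; rewrite setCK.
have mF : measurable (F1 `|` F2 : set B) by apply: closedm; exact: closedU.
have mU : measurable (U1 `&` U2 : set B) by apply: measurableI; exact: borel_open.
exists (F1 `|` F2), (U1 `&` U2); split.
- by apply: closed_sphere_compact; exact: closedU.
- exact: openI.
- by move=> x [/FA1|/FA2].
- by move=> x Ax; split; [exact: AU1|exact: AU2].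
apply: le_lt_trans (total_variation_le muE _) _; first exact: measurableD.
apply: (@le_lt_trans _ _ ((e / 3)%:E + (e / 3)%:E)%E).
  apply: leeD.
    apply: le_trans r1; apply: le_measure; rewrite ?inE.
    - exact: measurableD.
    - by apply: measurableD; [exact: borel_open|exact: closedm].
    - by move=> x [[Ux _] nF]; split=> // Fx; apply: nF; left.
  apply: le_trans r2; apply: le_measure; rewrite ?inE.
  - exact: measurableD.
  - by apply: measurableD; [exact: borel_open|exact: closedm].
  - by move=> x [[_ Ux] nF]; split=> // Fx; apply: nF; right.
by rewrite -EFinD lte_fin; lra.
Qed.

End representation.

(** * Negative mass as a supremum over functions between 0 and 1 *)

Section negative_mass.
Context {R : realType} {d : nat}.
Local Notation S := (sphere R d).
Local Notation C := (csphere R d).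
Local Notation B := (borel_sphere R d).
Implicit Types (f g h : C) (x y z : S).

(** By compactness some cut-off [u_n] of [F] is below 1/2 everywhere outside [U]; then
    [max 0 (2 u_n - 1)] vanishes there and is still 1 on [F]. *)
Lemma closed_open_separation (F U : set S) : closed F -> open U -> F `<=` U ->
  exists f : C, [/\ forall x, 0 <= f x <= 1, forall x, F x -> f x = 1 & forall x, 0 < f x -> U x].
Proof.
move=> cF oU FU; have [u [u01 ui uF uN]] := closed_cutoffs cF.
have um m n x : (m <= n)%N -> u n x <= u m x.
  move=> /subnK <-; elim: (n - m)%N => [//|k IHk].
  by rewrite addSn (le_trans (ui _ _)).
have [n un] : exists n, forall x, ~ U x -> u n x < 1 / 2.
  pose V n := U `|` [set x : S | u n x < 1 / 2].
  have oV n : open (V n).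
    apply: openU => //; have /continuousP/(_ [set z : R | z < 1 / 2]) := @cts_fun _ _ (u n).
    by apply; exact: open_lt.
  have := @sphere_compact R d; rewrite compact_cover => /(_ nat setT V) [//|x _|D _ cD].
    have [Ux|nUx] := pselect (U x); first by exists 0%N => //; left.
    have [n un] := uN x (fun Fx => nUx (FU x Fx)); exists n => //; right => /=.
    by rewrite un divr_gt0.
  exists (\max_(i <- finmap.enum_fset D) i)%N => x nUx; have [n nD [//|/= un]] := cD x Logic.I.
  apply: le_lt_trans un; apply: um.
  exact: (@leq_bigmax_seq _ _ _ id).
have [f fE] : exists f : C, forall x, f x = Num.max 0 (2 * u n x - 1).
  apply: (@csphere_comp _ _ (fun t => Num.max 0 (2 * t - 1))) => t.
  apply: (@continuous_max _ _ (fun=> 0) (fun t : R => 2 * t - 1) t); first exact: cvg_cst.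
  by apply: cvgB; [exact: mulrl_continuous|exact: cvg_cst].
exists f; split=> x.
- rewrite fE le_max lexx/= ge_max ler01/=; have /andP[] := u01 n x; lra.
- by move=> Fx; rewrite fE uF// mulr1 max_r//; lra.
- rewrite fE lt_max ltxx/= => fx; apply: contrapT => /un; lra.
Qed.

Lemma csphere_integral_le (nu : {finite_measure set B -> \bar R}) f (A : set B) :
  measurable A -> (forall x, f x <= 1) -> (forall x, 0 < f x -> A x) ->
  (\int[nu]_x (f x : R) <= fine (nu A))%R.
Proof.
move=> mA f1 fA; have iA : nu.-integrable [set: B] (EFin \o (\1_A : B -> R)).
  exact: integrable_indic.
have -> : fine (nu A) = (\int[nu]_x (\1_A x))%R.
  by rewrite /Rintegral integral_indic// setIT.
apply: le_Rintegral => //; first exact: borel_integrable.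
move=> x _; rewrite indicE; case: (boolP (x \in A)) => [_|/negP nA]; first exact: f1.
by rewrite leNgt; apply/negP => fx; apply: nA; rewrite inE; exact: fA.
Qed.

Lemma sphere_hausdorff : hausdorff_space S.
Proof.
move=> p q pq; apply: val_inj; apply: (@norm_hausdorff R 'rV[R]_d.+1) => A B' pA qB.
have [x [Ax Bx]] := pq _ _ (@val_continuous R d p A pA) (@val_continuous R d q B' qB).
by exists (val x).
Qed.

Variables (mu : {charge set B -> \bar R}).

Let mP : measurable (hahn_pos mu). Proof. by have [[]] := hahn_posneg mu. Qed.
Let mN : measurable (hahn_neg mu). Proof. by have [_ []] := hahn_posneg mu. Qed.

Lemma neg_part_ge f : (forall x, 0 <= f x <= 1) ->
  ((- signed_integral mu f)%:E <= neg_part mu [set: B])%E.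
Proof.
move=> f01; rewrite -[leRHS]fineK ?fin_num_measure// lee_fin /signed_integral opprB.
have h : (\int[neg_part mu]_x (f x : R) <= fine (neg_part mu [set: B]))%R.
  by apply: (@csphere_integral_le (neg_part mu : {finite_measure set B -> \bar R})) => // x;
    have /andP[] := f01 x.
have : (0 <= \int[pos_part mu]_x (f x : R))%R.
  by apply: Rintegral_ge0 => x _; have /andP[] := f01 x.
by move=> p; rewrite (le_trans _ h)// gerBl.
Qed.

(** Regularity squeezes the Hahn negative set between a compact [K] and an open [U]. For [f] equal
    to 1 on [K] and positive only in [U], [- signed_integral mu f] falls short of the negative mass
    of [K] by at most the positive mass of [U], which lives on [U \ K]; the negative mass outside
    [K] is small too. *)
Lemma neg_part_le (M : R) : regular mu ->
  (forall f, (forall x, 0 <= f x <= 1) -> - signed_integral mu f <= M) ->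
  (neg_part mu [set: B] <= M%:E)%E.
Proof.
move=> reg fM; apply/lee_addgt0Pr => e e0; have e2 : 0 < e / 2 by rewrite divr_gt0.
have [K [U [cK oU KN NU KU]]] := reg _ mN (e / 2) e2.
have cK' : closed K by apply: compact_closed cK; exact: sphere_hausdorff.
have [f [f01 fK fU]] := closed_open_separation cK' oU (subset_trans KN NU).
have mK : measurable (K : set B).
  have oF : measurable (~` K : set B) by apply: borel_open; exact: closed_openC.
  by have := measurableC oF; rewrite setCK.
have mU : measurable (U : set B) by exact: borel_open.
have hT : (Defs.total_variation mu (U `\` K) = pos_part mu (U `\` K) + neg_part mu (U `\` K))%E by [].
have mUK : measurable (U `\` K : set B) by exact: measurableD.
have PUK : (pos_part mu (U `\` K) <= (e / 2)%:E)%E.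
  by rewrite (le_trans _ (ltW KU))// hT leeDl.
have NUK : (neg_part mu (U `\` K) <= (e / 2)%:E)%E.
  by rewrite (le_trans _ (ltW KU))// hT leeDr.
have [_ _ PN PN0] := hahn_posneg mu.
have pK : pos_part mu K = 0%E.
  rewrite /pos_part jordan_posE cjordan_posE /crestr0 mem_set//= /crestr.
  rewrite (_ : K `&` hahn_pos mu = set0) ?charge0//.
  apply/seteqP; split=> x //= [/KN Nx Px].
  by suff : set0 x by []; rewrite -PN0; split.
have nT : neg_part mu [set: B] = neg_part mu U.
  rewrite /neg_part !jordan_negE !cjordan_negE /crestr0 !mem_set//= /crestr.
  rewrite setTI (_ : U `&` hahn_neg mu = hahn_neg mu)//.
  by apply/seteqP; split=> x /=; [case|move=> Nx; split=> //; exact: NU].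
have UK : U = K `|` (U `\` K).
  apply/seteqP; split=> x /= => [Ux|[/KN/NU|[]]//].
  by have [Kx|nKx] := pselect (K x); [left|right].
have UKE (m : {finite_measure set B -> \bar R}) : (m U = m K + m (U `\` K))%E.
  by rewrite [in LHS]UK measureU//; apply/seteqP; split=> x //= [Kx [_ nK]].
have UKp : (pos_part mu U = pos_part mu K + pos_part mu (U `\` K))%E.
  exact: (UKE (pos_part mu : {finite_measure set B -> \bar R})).
have UKn : (neg_part mu U = neg_part mu K + neg_part mu (U `\` K))%E.
  exact: (UKE (neg_part mu : {finite_measure set B -> \bar R})).
have nK : (neg_part mu K)%E = (fine (neg_part mu K))%:E by rewrite fineK ?fin_num_measure.
have pU : (pos_part mu U <= (e / 2)%:E)%E.
  by rewrite UKp pK add0e.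
rewrite nT UKn nK.
have I1 : (fine (neg_part mu K) <= \int[neg_part mu]_x (f x : R))%R.
  rewrite -[leLHS]mul1r; apply: (@csphere_integral_ge _ _ (neg_part mu : {finite_measure set B -> \bar R})) => //.
    by move=> x; have /andP[] := f01 x.
  by move=> x Kx; rewrite fK.
have I2 : (\int[pos_part mu]_x (f x : R) <= e / 2)%R.
  apply: (@le_trans _ _ (fine (pos_part mu U))).
    by apply: (@csphere_integral_le (pos_part mu : {finite_measure set B -> \bar R})) => // x; have /andP[] := f01 x.
  by rewrite -lee_fin fineK ?fin_num_measure.
rewrite -EFinD [e]splitr addrA EFinD; apply: leeD => //; rewrite lee_fin.
have := fM f f01; rewrite /signed_integral opprB lerBlDr => h.
by rewrite (le_trans I1)// (le_trans h)// lerD2l.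
Qed.

End negative_mass.

(** * Operator norm and positivity loss *)

Section operator_norm.
Context {R : realType} {d : nat}.
Local Notation S := (sphere R d).
Local Notation C := (csphere R d).
Local Notation B := (borel_sphere R d).
Implicit Types (f g h : C) (x y z : S) (A : {linear C -> C}).

Lemma bounded_near_bound A : bounded_near A (nbhs (0 : C)) ->
  exists K : R, forall f (F : R) x, (forall y, `|f y| <= F) -> `|A f x| <= K * F.
Proof.
move=> /linear_boundedP/pinfty_ex_gt0[K K0 AK]; exists K => f F x fF.
apply: le_trans (ler_unif_norm (A f) x) _; apply: le_trans (AK f) _.
by rewrite ler_pM2l//; exact: unif_norm_le.
Qed.

Lemma opnorm_ge A g x : bounded_near A (nbhs (0 : C)) -> (forall y, `|g y| <= 1) ->
  A g x <= opnorm A.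
Proof.
move=> /bounded_near_bound[K AK] g1; rewrite (le_trans (ler_norm _))//.
rewrite (le_trans (ler_unif_norm (A g) x))//; apply: ub_le_sup; last first.
  by exists g => //; exact: unif_norm_le.
exists K => _ [f /= f1 <-]; apply: unif_norm_le => y; rewrite -[leRHS]mulr1.
by apply: AK => z; rewrite (le_trans (ler_unif_norm f z)).
Qed.

Lemma opnorm_le A (M : R) :
  (forall f x, (forall y, `|f y| <= 1) -> `|A f x| <= M) -> opnorm A <= M.
Proof.
move=> AM; apply: ge_sup.
  by exists `|A 0|, 0 => //=; rewrite normr0.
move=> _ [f /= f1 <-]; apply: unif_norm_le => y; apply: AM => z.
by rewrite (le_trans (ler_unif_norm f z)).
Qed.

(** This serves the lower bound on the positivity loss, a supremum over representing measures, for
    which one must be exhibited; the upper bound treats an arbitrary one. *)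
Lemma evaluation_representable A x : bounded_near A (nbhs (0 : C)) ->
  exists mu, represents A x mu.
Proof.
move=> /bounded_near_bound[K AK].
have linA : linear_for *:%R (fun f : C => A f x : R).
  by move=> a f g; rewrite linearP.
pose Phi : {linear C -> R} := HB.pack (fun f : C => A f x : R)
  (GRing.isLinear.Build R C R *:%R (fun f : C => A f x : R) linA).
have PhiK f (F : R) : (forall y, `|f y| <= F) -> `|Phi f| <= K * F by move=> fF; exact: AK.
by have [mu [rmu muE]] := riesz_representation PhiK; exists mu.
Qed.

Lemma admissible_cst A L N c : (1 <= d)%N -> admissible L N A -> A (ccst c) = ccst c.
Proof.
by move=> d1 [_ AL _]; apply: AL; apply: spoly_spherical_poly => //; exact: spoly_cst.
Qed.

Lemma positivity_loss_ge A L N g x (a : R) : (1 <= d)%N -> admissible L N A ->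
  (forall y, `|g y| <= 1) -> 1 + a <= A g x -> ((a / 2)%:E <= positivity_loss A)%E.
Proof.
move=> d1 aA g1 Ag; have [bA _ _] := aA.
have [mu rmu] := evaluation_representable x bA.
apply: (@le_trans _ _ (neg_part mu [set: B])); last first.
  by apply: ereal_sup_ubound; exists x, mu.
pose f : C := 2^-1 *: (ccst 1 - g).
have fE y : f y = 2^-1 * (1 - g y) by [].
apply: (@le_trans _ _ (- signed_integral mu f)%:E); last first.
  apply: neg_part_ge => y; rewrite fE; have := g1 y; rewrite ler_norml; lra.
have [_ <-] := rmu.
have -> : A f x = 2^-1 * (1 - A g x).
  by rewrite linearZ/= csphere_scaleE raddfB/= (admissible_cst 1 d1 aA).
by rewrite lee_fin; lra.
Qed.

Lemma positivity_loss_le A L N (a : R) : (1 <= d)%N -> admissible L N A ->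
  (forall f x, (forall y, `|f y| <= 1) -> `|A f x| <= 1 + a) ->
  (positivity_loss A <= (a / 2)%:E)%E.
Proof.
move=> d1 aA Aa; apply: ge_ereal_sup => _ [x [mu [[rmu muE] ->]]].
apply: neg_part_le => // f f01; rewrite -muE.
pose g : C := ccst 1 - 2 *: f.
have gE y : g y = 1 - 2 * f y by [].
have g1 y : `|g y| <= 1 by rewrite gE ler_norml; have := f01 y; lra.
have AgE : A g x = 1 - 2 * A f x.
  by rewrite raddfB/= linearZ/= (admissible_cst 1 d1 aA).
have := Aa g x g1; rewrite AgE ler_norml => /andP[]; lra.
Qed.

End operator_norm.

Unset Implicit Arguments.

Theorem theorem1p3 (R : realType) (d : nat) (hd : (1 <= d)%N) :
  exists c : R, 0 < c /\
  forall kappa : R, 0 < kappa -> kappa < 1 ->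
  exists C : R, c <= C /\
  forall L N : nat, (1 <= L)%N -> L%:R <= kappa * N%:R ->
    [/\ ((c * (L%:R / (N.+1)%:R) ^+ 2)%:E <= lambda R d L N - 1%:E)%E,
        (lambda R d L N - 1%:E <= (C * (L%:R / (N.+1)%:R) ^+ 2)%:E)%E,
        ((c / 2 * (L%:R / (N.+1)%:R) ^+ 2)%:E <=
          ereal_inf [set positivity_loss A | A in @admissible R d L N])%E &
        (ereal_inf [set positivity_loss A | A in @admissible R d L N] <=
          (C / 2 * (L%:R / (N.+1)%:R) ^+ 2)%:E)%E].
Proof.
exists 9^-1; split; first by rewrite invr_gt0.
move=> kappa k0 k1; have [K upper] := @upper_operator R d kappa hd k0 k1.
(* The maximum secures [c <= C]. *)
exists (Num.max 9^-1 K); split; first by rewrite le_max lexx.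
move=> L N L1 LN; set q := _ ^+ 2; have q0 : 0 <= q by exact: sqr_ge0.
have LN' : (1 <= L <= N)%N.
  rewrite L1 -(ler_nat R) (le_trans LN)// ler_piMl ?ler0n//; exact: ltW.
have lower A : admissible L N A ->
    exists (g : csphere R d) x, (forall y, `|g y| <= 1) /\ 1 + 9^-1 * q <= A g x.
  by move=> [_ AL AN]; exact: admissible_lower.
have [A [aA AK]] := upper L N L1 LN.
have AM (f : csphere R d) x : (forall y, `|f y| <= 1) -> `|A f x| <= 1 + Num.max 9^-1 K * q.
  move=> f1; rewrite (le_trans (AK f 1 x f1))// mul1r lerD2l ler_wpM2r//.
  by rewrite le_max lexx orbT.
split.
- rewrite leeBrDr// -EFinD; apply: le_ereal_inf_tmp => _ [A' aA' <-].
  have [g [x [g1 Ag]]] := lower A' aA'; have [bA _ _] := aA'.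
  by rewrite lee_fin addrC (le_trans Ag)// opnorm_ge.
- rewrite leeBlDr// -EFinD; apply: (@le_trans _ _ (opnorm A)%:E).
    by apply: ereal_inf_lbound; exists A.
  by rewrite lee_fin addrC; exact: opnorm_le.
- apply: le_ereal_inf_tmp => _ [A' aA' <-]; have [g [x [g1 Ag]]] := lower A' aA'.
  by rewrite mulrAC; exact: positivity_loss_ge aA' g1 Ag.
- apply: (@le_trans _ _ (positivity_loss A)).
    by apply: ereal_inf_lbound; exists A.
  by rewrite mulrAC; exact: positivity_loss_le aA AM.
Qed.
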